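(* Let $b_n$ be the number of isomorphism classes of $K_5$ descendants of level $3$ with $n$ vertices. Then \[ \sum_{n\ge 0} b_n x^n=\frac{x^9(1+x^2)}{(1-x)^3(1+x+x^2)}. \]
   Context: Graphs are finite, simple and undirected. Double triangle expansion (DTE): let $G$ be a $4$-regular graph containing four distinct vertices $v_1,v_2,v_3,v_4$ such that $\{v_1,v_2,v_3\}$ is a triangle and $\{v_2,v_4\}$ is an edge. The DTE of $G$ at this subgraph is obtained by deleting the edges $\{v_1,v_3\}$ and $\{v_2,v_4\}$ and adding one new vertex adjacent to exactly $v_1,v_2,v_3,v_4$. A $K_5$ descendant is a graph obtained from $K_5$ by a finite (possibly empty) sequence of DTEs. The level of a graph $G$ is $L(G)=$ (number of vertices of $G$) $-$ (number of triangles of $G$). *)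

(* Defs.v *)
From HB Require Import structures.
From mathcomp Require Import all_boot all_order all_algebra.
From mathcomp Require Import boolp.

Set Implicit Arguments.
Unset Strict Implicit.
Unset Printing Implicit Defensive.

Import Order.TTheory GRing.Theory Num.Theory.

Local Open Scope ring_scope.

(* Finite simple undirected graphs with vertex set V, as adjacency functions.
   The subtype inherits the finType structure, so graphs on V can be counted. *)
Record sgraph (V : finType) := SGraph {
  adjf : {ffun V * V -> bool};
  _ : [forall x, ~~ adjf (x, x)] &&
      [forall x, forall y, adjf (x, y) == adjf (y, x)] }.

HB.instance Definition _ (V : finType) := [isSub for @adjf V].
HB.instance Definition _ (V : finType) := [Finite of sgraph V by <:].

Definition adj (V : finType) (G : sgraph V) : rel V :=
  fun x y => adjf G (x, y).

Lemma adj_irr (V : finType) (G : sgraph V) : irreflexive (adj G).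
Proof.
rewrite /adj; case: G => f /= /andP[h _] x.
by move/forallP/(_ x): h => /negbTE.
Qed.

Lemma adj_sym (V : finType) (G : sgraph V) : symmetric (adj G).
Proof.
rewrite /adj; case: G => f /= /andP[_ h] x y.
by move/forallP/(_ x)/forallP/(_ y)/eqP: h.
Qed.

Lemma sgraph_of_subproof (V : finType) (e : rel V) :
  let f := [ffun p : V * V => (p.1 != p.2) && (e p.1 p.2 || e p.2 p.1)] in
  [forall x, ~~ f (x, x)] && [forall x, forall y, f (x, y) == f (y, x)].
Proof.
cbv zeta; apply/andP; split; first by apply/forallP=> x; rewrite ffunE /= eqxx.
apply/forallP=> x; apply/forallP=> y.
by rewrite !ffunE /= [y == x]eq_sym [e y x || _]orbC.
Qed.

(* The simple graph whose edges are the pairs {x, y}, x != y, with e x y or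
   e y x. *)
Definition sgraph_of (V : finType) (e : rel V) : sgraph V :=
  SGraph (sgraph_of_subproof e).

Lemma adj_sgraph_of (V : finType) (e : rel V) (x y : V) :
  adj (sgraph_of e) x y = (x != y) && (e x y || e y x).
Proof. by rewrite /adj /= ffunE. Qed.

Definition complete_graph (V : finType) : sgraph V := sgraph_of (fun _ _ => true).

Definition isomorphic (V W : finType) (G : sgraph V) (H : sgraph W) : Prop :=
  exists2 f : V -> W, bijective f & forall x y, adj H (f x) (f y) = adj G x y.

Definition regular (V : finType) (k : nat) (G : sgraph V) : bool :=
  [forall x, #|[set y | adj G x y]| == k].

Definition triangles (V : finType) (G : sgraph V) : {set {set V}} :=
  [set T : {set V} |
     (#|T| == 3) && [forall x in T, forall y in T, (x != y) ==> adj G x y]].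

Definition level (V : finType) (G : sgraph V) : int :=
  #|V|%:Z - #|triangles G|%:Z.

Definition dte_site (V : finType) (G : sgraph V) (v1 v2 v3 v4 : V) : bool :=
  [&& uniq [:: v1; v2; v3; v4], adj G v1 v2, adj G v2 v3, adj G v1 v3
    & adj G v2 v4].

(* The new vertex is None. *)
Definition dte (V : finType) (G : sgraph V) (v1 v2 v3 v4 : V) :
    sgraph (option V) :=
  sgraph_of (fun a b =>
    match a, b with
    | Some x, Some y =>
        [&& adj G x y, [set x; y] != [set v1; v3] & [set x; y] != [set v2; v4]]
    | None, Some y => y \in [:: v1; v2; v3; v4]
    | _, None => false
    end).

(* Closure under isomorphism makes the vertex type immaterial: dte itself
   changes it from V to option V. *)
Inductive K5_descendant : forall V : finType, sgraph V -> Prop :=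
| K5_descendant_base : K5_descendant (complete_graph 'I_5)
| K5_descendant_dte (V : finType) (G : sgraph V) (v1 v2 v3 v4 : V) :
    K5_descendant G -> regular 4 G -> dte_site G v1 v2 v3 v4 ->
    K5_descendant (dte G v1 v2 v3 v4)
| K5_descendant_iso (V W : finType) (G : sgraph V) (H : sgraph W) :
    K5_descendant G -> isomorphic G H -> K5_descendant H.

Definition num_iso_classes (n : nat) (D : {set sgraph 'I_n}) : nat :=
  #|equivalence_partition (fun G H => `[< isomorphic G H >]) D|.

Definition num_K5_descendants (l : int) (n : nat) : nat :=
  num_iso_classes
    [set G : sgraph 'I_n | `[< K5_descendant G >] && (level G == l)].

Lemma isomorphic_refl (V : finType) (G : sgraph V) : isomorphic G G.
Proof. by exists id => //; exists id. Qed.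

Lemma isomorphic_sym (V W : finType) (G : sgraph V) (H : sgraph W) :
  isomorphic G H -> isomorphic H G.
Proof.
case=> f [g fK gK] fP; exists g; first by exists f.
by move=> x y; rewrite -fP !gK.
Qed.

Lemma isomorphic_trans (U V W : finType)
    (G : sgraph U) (H : sgraph V) (K : sgraph W) :
  isomorphic G H -> isomorphic H K -> isomorphic G K.
Proof.
case=> f bf fP [g bg gP]; exists (g \o f); first exact: bij_comp.
by move=> x y /=; rewrite gP fP.
Qed.

(* Formal power series over a field F are coefficient sequences nat -> F. *)
Definition fps_of_poly (F : fieldType) (p : {poly F}) : nat -> F :=
  fun n => p`_n.

Definition fps_mul (F : fieldType) (f g : nat -> F) : nat -> F :=
  fun n => \sum_(i < n.+1) f i * g (n - i)%N.

(* The first n coefficients of f / g, by long division; meaningful when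
   g 0 != 0, see fps_divK. *)
Fixpoint fps_div_take (F : fieldType) (f g : nat -> F) (n : nat) : seq F :=
  if n is m.+1 then
    let h := fps_div_take f g m in
    rcons h ((f m - \sum_(i < m) h`_i * g (m - i)%N) / g 0%N)
  else [::].

Definition fps_div (F : fieldType) (f g : nat -> F) : nat -> F :=
  fun n => (fps_div_take f g n.+1)`_n.

Lemma size_fps_div_take (F : fieldType) (f g : nat -> F) (n : nat) :
  size (fps_div_take f g n) = n.
Proof. by elim: n => //= n IHn; rewrite size_rcons IHn. Qed.

Lemma nth_fps_div_take (F : fieldType) (f g : nat -> F) (n i : nat) :
  (i < n)%N -> (fps_div_take f g n)`_i = fps_div f g i.
Proof.
elim: n => // n IHn; rewrite ltnS leq_eqVlt => /predU1P[-> //|lt_in].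
by rewrite /= nth_rcons size_fps_div_take lt_in IHn.
Qed.

Lemma fps_divK (F : fieldType) (f g : nat -> F) :
  g 0%N != 0 -> fps_mul (fps_div f g) g =1 f.
Proof.
move=> g0 n; rewrite /fps_mul big_ord_recr /= subnn.
rewrite [fps_div f g n]/fps_div /= nth_rcons size_fps_div_take ltnn eqxx divfK //.
rewrite (eq_bigr (fun i : 'I_n => fps_div f g i * g (n - i)%N)) => [|i _].
  by under [in X in _ - X]eq_bigr => i _ do rewrite nth_fps_div_take //; rewrite addrC subrK.
by [].
Qed.

(* Main.v *)
Require Import Defs.
From mathcomp Require Import all_boot all_order all_algebra perm.
From mathcomp Require Import boolp zify ring.

(** A double triangle expansion of a graph [G] at [v1 v2 v3 v4] destroys the
    triangles on the edges [v1 v3] and [v2 v4] and creates one triangle with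
    the new vertex for each edge left among [v1, ..., v4].  Balancing the two
    (lemma [level_dte_ge]) shows that the level never drops, and that it rises
    by the number of common neighbours of [v1, v3] other than [v2] and of
    [v2, v4] other than [v1, v3].  Hence the descendants of level at most 3 can
    be found by following only the expansions that keep the level at most 3.

    All of them are ring graphs: vertices [Z_n], edges [x, x+1], edges
    [x, x+2] except over a few breaks [x+1], and one extra chord per break.
    When the only triangles are the [x-1, x, x+1] with [x] not a break, the
    level is the number of breaks ([level_ring]), and the triangles between
    two successive breaks form a zigzag.  Up to isomorphism an expansion
    depends only on its triangle and on the apex [v2] ([dte_swap]), so a ring
    graph has few kinds of expansion ([ring_siteP]): an apex in the middle of
    its triangle lengthens a zigzag ([ring_insert]); an apex at an end of its
    triangle twists a path of four vertices and creates two new breaks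
    ([ring_twist]), except where these already were breaks; an apex at a break
    raises the level.

    This leaves three families ([K5_descendant_low_level]): the circulants
    [C_n(1,2)] (level 0 from seven vertices on), a graph with two zigzags of
    lengths at least 3 (level 2), and two kinds of graphs with three zigzags
    (level 3).  In the first kind, two zigzags have lengths [b, c >= 3] and can
    be exchanged, while the third one has any length [s >= 0]; in the second
    kind all three lengths are at least 3 and can be permuted at will.  In both
    kinds the number of vertices is the sum of the lengths plus 3.  Every such
    graph occurs ([three_descendant]): a twist of a circulant gives two
    zigzags, a twist at the end of one of these gives the first kind, a
    twist of a zigzag of length 2 in the first kind gives the second, and
    insertions do the rest.

    That different parameters give different graphs is proved by recognising
    the zigzags of length at least 3 intrinsically, as chains of triangles
    ([ring_strip]), and by looking at which pairs of zigzags leaving a common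
    vertex have adjacent vertices near their far ends: one pair in the first
    kind, all three in the second ([three_fork_gaps]).

    The number of classes with [n] vertices is therefore the coefficient of
    [x^n] in
    [x^9/((1-x)^2(1-x^2)) + x^12/((1-x)(1-x^2)(1-x^3))],
    which is the announced fraction.  The two counts are computed as sums over
    the first break, and the recurrence with characteristic polynomial
    [(1-x)^3(1+x+x^2)] that they satisfy ([count_rec]) determines the power
    series. *)

Set Implicit Arguments.
Unset Strict Implicit.
Unset Printing Implicit Defensive.

Import Order.TTheory GRing.Theory Num.Theory.

(** * Triangles and isomorphism invariants *)

Section Triangles.
Variables (V : finType) (G : sgraph V).

Lemma adj_neq x y : adj G x y -> x != y.
Proof. by apply: contraTneq => ->; rewrite adj_irr. Qed.

Lemma triangle3 x y z :
  adj G x y -> adj G y z -> adj G x z -> [set x; y; z] \in triangles G.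
Proof.
move=> xy yz xz.
rewrite inE -setUA cardsU1 cards2 !inE !negb_or.
rewrite (adj_neq xy) (adj_neq yz) (adj_neq xz) /=.
by apply/forall_inP=> a; rewrite !inE => /or3P[]/eqP->;
   apply/forall_inP=> b; rewrite !inE => /or3P[]/eqP->; apply/implyP;
   rewrite ?eqxx // adj_sym.
Qed.

Lemma triangleP (T : {set V}) :
  reflect (exists x y z, [/\ T = [set x; y; z], adj G x y, adj G y z & adj G x z])
          (T \in triangles G).
Proof.
apply: (iffP idP) => [|[x [y [z [-> xy yz xz]]]]]; last exact: triangle3.
rewrite inE => /andP[/eqP T3 /forall_inP hT].
have /card_gt0P[x xT] : 0 < #|T| by rewrite T3.
have : #|T :\ x| = 2 by move: T3; rewrite (cardsD1 x) xT => -[].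
move/eqP/cards2P=> [y [z [yz eT]]].
have yT : y \in T :\ x by rewrite eT !inE eqxx.
have zT : z \in T :\ x by rewrite eT !inE eqxx orbT.
move: (yT) (zT) => /setD1P[yx yT'] /setD1P[zx zT'].
have h a b : a \in T -> b \in T -> a != b -> adj G a b.
  by move=> aT bT; move/forall_inP: (hT a aT) => /(_ b bT) /implyP.
exists x, y, z; split; try by apply: h => //; rewrite eq_sym.
by rewrite -setUA -eT setD1K.
Qed.

End Triangles.

Section IsoInvariance.

Lemma isomorphic_inj (V W : finType) (G : sgraph V) (H : sgraph W) (f : V -> W) :
  #|V| = #|W| -> injective f -> (forall x y, adj H (f x) (f y) = adj G x y) ->
  isomorphic G H.
Proof.
move=> eVW f_inj fP; exists f => //.
by apply: inj_card_bij f_inj _; rewrite eVW.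
Qed.

Lemma isomorphic_card (V W : finType) (G : sgraph V) (H : sgraph W) :
  isomorphic G H -> #|V| = #|W|.
Proof. by case=> f bf _; exact: bij_eq_card bf. Qed.

Lemma triangles_iso_le (V W : finType) (G : sgraph V) (H : sgraph W) :
  isomorphic G H -> #|triangles G| <= #|triangles H|.
Proof.
case=> f bf fP.
rewrite -(card_imset _ (imset_inj (bij_inj bf))).
apply/subset_leq_card/subsetP => _ /imsetP[T /triangleP[x [y [z [-> xy yz xz]]]] ->].
by rewrite !imsetU !imset_set1; apply: triangle3; rewrite fP.
Qed.

Lemma level_iso (V W : finType) (G : sgraph V) (H : sgraph W) :
  isomorphic G H -> level G = level H.
Proof.
move=> GH; rewrite /level (isomorphic_card GH).
suff -> : #|triangles G| = #|triangles H| by [].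
by apply/eqP; rewrite eqn_leq !triangles_iso_le //; apply: isomorphic_sym.
Qed.

Lemma regular_iso (V W : finType) (G : sgraph V) (H : sgraph W) k :
  isomorphic G H -> regular k G -> regular k H.
Proof.
case=> f [g fK gK] fP /forallP rG; apply/forallP=> y.
rewrite -(eqP (rG (g y))) -(card_imset _ (can_inj fK)); apply/eqP.
apply: eq_card => z; rewrite inE; apply/idP/imsetP => [yz|[t]].
  by exists (g z); rewrite ?gK // inE -fP !gK.
by rewrite inE -fP gK => yt ->.
Qed.

End IsoInvariance.

(** * Double triangle expansion *)

Lemma notin_imset_Some (V : finType) (B : {set V}) : (None \in Some @: B) = false.
Proof. by apply/negbTE/imsetP; case. Qed.

Section Dte.
Variables (V : finType) (G : sgraph V).
Implicit Types v : V.

Lemma set2_eq (a b c d : V) : a != b ->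
  ([set a; b] == [set c; d]) = ((a == c) && (b == d)) || ((a == d) && (b == c)).
Proof.
move=> ab; apply/eqP/orP => [E|[]/andP[/eqP-> /eqP->]//]; last exact: setUC.
have := set21 a b; have := set22 a b; rewrite E !inE.
by move=> /orP[]/eqP bE /orP[]/eqP aE; move: ab; rewrite aE bE ?eqxx;
   [|right|left|].
Qed.

Lemma dte_SomeE v1 v2 v3 v4 x y :
  adj (dte G v1 v2 v3 v4) (Some x) (Some y) =
  [&& adj G x y, [set x; y] != [set v1; v3] & [set x; y] != [set v2; v4]].
Proof.
rewrite adj_sgraph_of (adj_sym G y x) [[set y; x]]setUC orbb.
case xy: (adj G x y); rewrite ?andbF // (inj_eq (@Some_inj _)).
by rewrite (adj_neq xy).
Qed.

Lemma dte_SomeNone v1 v2 v3 v4 x :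
  adj (dte G v1 v2 v3 v4) (Some x) None = (x \in [:: v1; v2; v3; v4]).
Proof. by rewrite adj_sgraph_of. Qed.

Lemma dte_NoneSome v1 v2 v3 v4 x :
  adj (dte G v1 v2 v3 v4) None (Some x) = (x \in [:: v1; v2; v3; v4]).
Proof. by rewrite adj_sgraph_of orbF. Qed.

(** The two deleted edges and the four neighbours of the new vertex are the
    same.  When [v3] and [v4] are adjacent, this moves the expansion from the
    triangle [v1 v2 v3] to the triangle [v2 v3 v4]. *)
Lemma dte_rev v1 v2 v3 v4 :
  isomorphic (dte G v1 v2 v3 v4) (dte G v4 v3 v2 v1).
Proof.
exists id; first by exists id.
case=> [x|] [y|]; rewrite ?dte_SomeE ?dte_SomeNone ?dte_NoneSome ?adj_irr //.
- by congr (_ && _); rewrite andbC [[set v4; _]]setUC [[set v3; _]]setUC.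
- by rewrite !inE; do 4!case: (x == _).
- by rewrite !inE; do 4!case: (y == _).
Qed.

Lemma dte_sym v1 v2 v3 v4 :
  isomorphic (dte G v1 v2 v3 v4) (dte G v3 v2 v1 v4).
Proof.
exists id; first by exists id.
case=> [x|] [y|]; rewrite ?dte_SomeE ?dte_SomeNone ?dte_NoneSome ?adj_irr //.
- by rewrite [[set v3; _]]setUC.
- by rewrite !inE; do 4!case: (x == _).
- by rewrite !inE; do 4!case: (y == _).
Qed.

Lemma dte_site_sym v1 v2 v3 v4 :
  dte_site G v1 v2 v3 v4 -> dte_site G v3 v2 v1 v4.
Proof.
rewrite /dte_site /= !inE => /and5P[/and4P[h1 h2 h3 _] a12 a23 a13 a24].
rewrite (adj_sym G v3 v2) (adj_sym G v2 v1) (adj_sym G v3 v1) a12 a23 a13 a24 /=.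
move: h1 h2 h3; rewrite !negb_or [v2 == v1]eq_sym [v3 == v2]eq_sym [v3 == v1]eq_sym.
by move=> /and3P[-> -> ->] /andP[-> ->] ->.
Qed.

Section Site.
Variables v1 v2 v3 v4 : V.
Hypothesis site : dte_site G v1 v2 v3 v4.

Lemma siteP : [/\ adj G v1 v2, adj G v2 v3, adj G v1 v3 & adj G v2 v4] /\
  [/\ v1 != v2, v1 != v3, v1 != v4 & [/\ v2 != v3, v2 != v4 & v3 != v4]].
Proof.
move: site; rewrite /dte_site /= !inE !negb_or.
by case/and5P=> /and4P[/and3P[-> -> ->] /andP[-> ->] -> _] -> -> -> ->.
Qed.

(** Each [vi] loses one of the two deleted edges and gains the new vertex. *)
Lemma regular_dte : regular 4 G -> regular 4 (dte G v1 v2 v3 v4).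
Proof.
have [[a12 a23 a13 a24] [n12 n13 n14 [n23 n24 n34]]] := siteP.
move=> /forallP rG; apply/forallP => -[x|].
  pose A := [set y | adj G x y].
  pose B := [set y in A | ([set x; y] != [set v1; v3]) && ([set x; y] != [set v2; v4])].
  have -> : [set y | adj (dte G v1 v2 v3 v4) (Some x) y] =
      (if x \in [:: v1; v2; v3; v4] then [set None] else set0) :|: (Some @: B).
    apply/setP=> -[y|]; rewrite !inE ?dte_SomeNone ?dte_SomeE.
      rewrite (mem_imset _ _ (@Some_inj _)) !inE.
      by case: ifP; rewrite ?inE.
    by rewrite notin_imset_Some orbF; case: ifP; rewrite ?inE.
  have cA : #|A| = 4 by apply/eqP/rG.
  (* [b] is the other end of the deleted edge at [x]. *)
  have oth b : adj G x b -> (forall y, adj G x y ->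
      ([set x; y] != [set v1; v3]) && ([set x; y] != [set v2; v4]) = (y != b)) ->
      #|None |: Some @: B| == 4.
    move=> xb hb.
    have -> : B = A :\ b.
      apply/setP=> y; rewrite !inE andbC; case xy: (adj G x y); rewrite ?andbF //.
      by rewrite !andbT hb.
    rewrite cardsU1 (card_imset _ (@Some_inj _)).
    rewrite notin_imset_Some.
    by move: cA; rewrite (cardsD1 b) inE xb !add1n => -[->].
  case: (boolP (x \in [:: v1; v2; v3; v4])) => [xin|xnin].
    have := xin; rewrite !inE => /or4P[] /eqP xE; subst x.
    + apply: (oth v3) => // y /adj_neq v1y.
      by rewrite !set2_eq // eqxx (negbTE n12) (negbTE n13) (negbTE n14) /= orbF andbT.
    + apply: (oth v4) => // y /adj_neq v1y.
      by rewrite !set2_eq // eqxx (negbTE n23) [v2 == v1]eq_sym (negbTE n12) (negbTE n24) /= orbF.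
    + apply: (oth v1) => //; first by rewrite adj_sym.
      move=> y /adj_neq v1y; rewrite !set2_eq // eqxx [v3 == v1]eq_sym (negbTE n13).
      by rewrite [v3 == v2]eq_sym (negbTE n23) (negbTE n34) /= andbT.
    + apply: (oth v2) => //; first by rewrite adj_sym.
      move=> y /adj_neq v1y; rewrite !set2_eq // eqxx [v4 == v1]eq_sym (negbTE n14).
      by rewrite [v4 == v3]eq_sym (negbTE n34) [v4 == v2]eq_sym (negbTE n24) /=.
  rewrite set0U (card_imset _ (@Some_inj _)) -cA; apply/eqP/eq_card => y; rewrite !inE.
  case xy: (adj G x y) => //=; rewrite !set2_eq ?(adj_neq xy) //.
  by move: xnin; rewrite !inE !negb_or => /and4P[/negbTE-> /negbTE-> /negbTE-> /negbTE->].
apply/eqP; transitivity #|Some @: [set x in [:: v1; v2; v3; v4]]|.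
  apply: eq_card => -[y|]; rewrite !inE ?adj_irr ?dte_NoneSome.
    by rewrite (mem_imset _ _ (@Some_inj _)) !inE.
  by rewrite notin_imset_Some.
rewrite (card_imset _ (@Some_inj _)) cardsE.
by apply/card_uniqP; case/and5P: site.
Qed.

End Site.

(** In the expansion [v2] and the new vertex are adjacent, are both adjacent
    to [v1] and [v3], and share out the other two neighbours of [v2].
    Exchanging them replaces [v4] by the remaining neighbour of [v2]: up to
    isomorphism only the triangle and its apex [v2] matter. *)
Lemma dte_swap v1 v2 v3 v4 w4 : regular 4 G ->
  dte_site G v1 v2 v3 v4 -> dte_site G v1 v2 v3 w4 ->
  isomorphic (dte G v1 v2 v3 v4) (dte G v1 v2 v3 w4).
Proof.
move=> rG s4 s4'; have [<-|nw] := eqVneq v4 w4; first exact: isomorphic_refl.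
have [[a12 a23 a13 a24] [n12 n13 n14 [n23 n24 n34]]] := siteP s4.
have [[_ _ _ b24] [_ _ m14 [_ m24 m34]]] := siteP s4'.
have nb y : adj G v2 y = (y \in [:: v1; v3; v4; w4]).
  have u : uniq [:: v1; v3; v4; w4].
    by rewrite /= !inE !negb_or n13 n14 m14 n34 m34 nw.
  have sub : [set z in [:: v1; v3; v4; w4]] \subset [set z | adj G v2 z].
    apply/subsetP=> z; rewrite !inE => /or4P[]/eqP->//.
    by rewrite adj_sym.
  have /setP/(_ y) : [set z in [:: v1; v3; v4; w4]] = [set z | adj G v2 z].
    apply/eqP; rewrite eqEcard sub; move/forallP: rG => /(_ v2)/eqP ->.
    by rewrite cardsE (card_uniqP u).
  by rewrite !inE => <-.
(* The transposition of [v2] and the new vertex. *)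
pose f (a : option V) := if a == None then Some v2 else if a == Some v2 then None else a.
have fS x : x != v2 -> f (Some x) = Some x.
  by rewrite /f /= (inj_eq (@Some_inj _)) => /negbTE->.
have fN : f None = Some v2 by [].
have f2 : f (Some v2) = None by rewrite /f /= eqxx.
have fK : involutive f.
  case=> [x|]; last by rewrite fN f2.
  by have [->|x2] := eqVneq x v2; [rewrite f2 fN | rewrite !fS].
have core x : x != v2 ->
  adj (dte G v1 v2 v3 w4) (Some x) None = adj (dte G v1 v2 v3 v4) (Some x) (Some v2).
  move=> x2; rewrite dte_SomeNone dte_SomeE adj_sym nb !set2_eq //.
  rewrite (negbTE x2) [v2 == v1]eq_sym (negbTE n12) (negbTE n23) (negbTE n24) eqxx !inE /= (negbTE x2).
  rewrite !andbF !andbT /=.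
  have [->|] := eqVneq x v1; first by rewrite n14.
  have [->|] := eqVneq x v3; first by rewrite n34.
  by have [->|x4] := eqVneq x v4; rewrite ?(negbTE nw) /= ?orbF ?andbF ?andbT.
have core' x : x != v2 ->
  adj (dte G v1 v2 v3 w4) (Some x) (Some v2) = adj (dte G v1 v2 v3 v4) (Some x) None.
  move=> x2; rewrite dte_SomeNone dte_SomeE adj_sym nb !set2_eq //.
  rewrite (negbTE x2) [v2 == v1]eq_sym (negbTE n12) (negbTE n23) (negbTE m24) eqxx !inE /= (negbTE x2).
  rewrite !andbF !andbT /=.
  have [->|] := eqVneq x v1; first by rewrite m14.
  have [->|] := eqVneq x v3; first by rewrite m34.
  by have [->|x4] := eqVneq x w4; rewrite ?[w4 == v4]eq_sym ?(negbTE nw) /= ?orbF ?andbF ?andbT.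
exists f; first by exists f.
case=> [x|] [y|]; rewrite ?fN ?adj_irr //.
- have [->|x2] := eqVneq x v2; have [->|y2] := eqVneq y v2; rewrite ?f2 ?adj_irr //.
  + by rewrite fS // adj_sym core // adj_sym.
  + by rewrite fS // core.
  + by rewrite !fS // !dte_SomeE; case xy: (adj G x y) => //=;
      rewrite !set2_eq ?(adj_neq xy) // (negbTE x2) (negbTE y2) ?andbF.
- have [->|x2] := eqVneq x v2; first by rewrite f2 dte_SomeNone dte_NoneSome !inE eqxx !orbT.
  by rewrite fS // core'.
- have [->|x2] := eqVneq y v2; first by rewrite f2 dte_SomeNone dte_NoneSome !inE eqxx !orbT.
  by rewrite fS // adj_sym core' // adj_sym.
Qed.

End Dte.

Lemma dte_iso (V W : finType) (G : sgraph V) (H : sgraph W) (f : V -> W) v1 v2 v3 v4 :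
  bijective f -> (forall x y, adj H (f x) (f y) = adj G x y) ->
  isomorphic (dte G v1 v2 v3 v4) (dte H (f v1) (f v2) (f v3) (f v4)).
Proof.
move=> bf fP; have fI := bij_inj bf; case: (bf) => g fK gK.
exists (omap f).
  by exists (omap g); case=> //= x; rewrite ?fK ?gK.
have fset x y a b : ([set f x; f y] == [set f a; f b]) = ([set x; y] == [set a; b]).
  by rewrite -(inj_eq (imset_inj fI)) !imsetU !imset_set1.
case=> [x|] [y|] /=; rewrite ?adj_irr ?dte_SomeE ?dte_SomeNone ?dte_NoneSome //.
- by rewrite fP !fset.
- by rewrite !inE !(inj_eq fI).
- by rewrite !inE !(inj_eq fI).
Qed.

Lemma site_iso (V W : finType) (G : sgraph V) (H : sgraph W) (f : V -> W) v1 v2 v3 v4 :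
  bijective f -> (forall x y, adj H (f x) (f y) = adj G x y) ->
  dte_site H (f v1) (f v2) (f v3) (f v4) = dte_site G v1 v2 v3 v4.
Proof.
move=> bf fP; rewrite /dte_site !fP.
by congr (_ && _); rewrite -(map_inj_uniq (bij_inj bf)).
Qed.

(** * Expansions and the level *)

Section LevelDte.
Variables (V : finType) (G : sgraph V) (v1 v2 v3 v4 : V).
Hypothesis site : dte_site G v1 v2 v3 v4.

Let G' := dte G v1 v2 v3 v4.

Definition triangles_on (x y : V) : {set {set V}} :=
  [set T in triangles G | (x \in T) && (y \in T)].

Lemma in_triangles_on x y (T : {set V}) :
  (T \in triangles_on x y) = (T \in triangles G) && ((x \in T) && (y \in T)).
Proof. by rewrite in_set. Qed.

Lemma leq_triangles_on x y (s : seq V) : adj G x y -> uniq s ->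
  {in s, forall z, adj G z x && adj G z y} -> size s <= #|triangles_on x y|.
Proof.
move=> xy us hs.
have ut : uniq [seq [set x; y; z] | z <- s].
  rewrite map_inj_in_uniq // => z t /hs /andP[zx zy] /hs /andP[tx ty] E.
  have : z \in [set x; y; t] by rewrite -E !inE eqxx orbT.
  by rewrite !inE (negbTE (adj_neq zx)) (negbTE (adj_neq zy)) => /eqP.
rewrite -(size_map (fun z => [set x; y; z])) -(card_uniqP ut).
apply/subset_leq_card/subsetP => _ /mapP[z /hs /andP[zx zy] ->].
rewrite in_triangles_on triangle3 //; [|by rewrite adj_sym..].
by rewrite !inE !eqxx orbT.
Qed.

(** A triangle that avoids the new vertex is a triangle of [G] that uses
    neither deleted edge. *)
Lemma old_triangles_le :
  #|[set T in triangles G' | None \notin T]| <=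
  #|triangles G :\: (triangles_on v1 v3 :|: triangles_on v2 v4)|.
Proof.
rewrite -[X in _ <= X](card_imset _ (imset_inj (@Some_inj _))).
apply/subset_leq_card/subsetP => T; rewrite inE => /andP[/triangleP[a [b [c]]]].
case: a b c => [a|] [b|] [c|] [-> ab bc ac]; rewrite !inE //= => _.
move: ab bc ac; rewrite !dte_SomeE => /and3P[ab ab1 ab2] /and3P[bc bc1 bc2] /and3P[ac ac1 ac2].
apply/imsetP; exists [set a; b; c]; last by rewrite !imsetU !imset_set1.
have [_ [_ n13 _ [_ n24 _]]] := siteP site.
have abc := triangle3 ab bc ac.
have avoid x y : x != y -> [set a; b] != [set x; y] -> [set b; c] != [set x; y] ->
    [set a; c] != [set x; y] -> ~~ ((x \in [set a; b; c]) && (y \in [set a; b; c])).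
  move=> xy h1 h2 h3; apply/andP; rewrite !inE; case.
  by move=> /orP[/orP[]|] /eqP xE /orP[/orP[]|] /eqP yE; subst x y;
    move: xy h1 h2 h3; rewrite ?eqxx // ?[[set b; a]]setUC ?[[set c; a]]setUC
      ?[[set c; b]]setUC ?eqxx.
by rewrite in_setD in_setU !in_triangles_on abc /= negb_or !avoid.
Qed.

Lemma new_triangles_le :
  #|[set T in triangles G' | None \in T]| <= 2 + adj G v1 v4 + adj G v3 v4.
Proof.
pose pr (p : V * V) := [set None; Some p.1; Some p.2].
pose s := [:: (v1, v2); (v2, v3)] ++ [seq p <- [:: (v1, v4); (v3, v4)] | adj G p.1 p.2].
have -> : 2 + adj G v1 v4 + adj G v3 v4 = size [seq pr p | p <- s].
  by rewrite size_map size_cat /=; case: (adj G v1 v4); case: (adj G v3 v4).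
apply: leq_trans (card_size _).
apply/subset_leq_card/subsetP => T; rewrite inE => /andP[/triangleP Tt NT].
have [x [y [-> xN yN xy]]] : exists x y, [/\ T = [set None; Some x; Some y],
    x \in [:: v1; v2; v3; v4], y \in [:: v1; v2; v3; v4] & adj G' (Some x) (Some y)].
  case: Tt NT => a [b [c]]; case: a b c => [a|] [b|] [c|] [-> ab bc ac];
    rewrite ?inE //=; move: ab bc ac; rewrite ?adj_irr // => ab bc ac _.
  - exists a, b; split=> //; first by rewrite setUC setUA.
    + by move: ac; rewrite dte_SomeNone.
    + by move: bc; rewrite dte_SomeNone.
  - exists a, c; split=> //; first by rewrite [[set Some a; None]]setUC.
    + by move: ab; rewrite dte_SomeNone.
    + by move: bc; rewrite dte_NoneSome.
  - exists b, c; split=> //.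
    + by move: ab; rewrite dte_NoneSome.
    + by move: ac; rewrite dte_NoneSome.
have prC p q : pr (p, q) = pr (q, p) by rewrite /pr /= -!setUA [[set Some p; _]]setUC.
suff : ((x, y) \in s) || ((y, x) \in s).
  case/orP=> h; first exact: (map_f pr h).
  by rewrite -[X in X \in _]/(pr (x, y)) prC; exact: (map_f pr h).
have s12 : (v1, v2) \in s by rewrite inE eqxx.
have s23 : (v2, v3) \in s by rewrite !inE eqxx orbT.
have s14 : adj G v1 v4 -> (v1, v4) \in s.
  by move=> h; rewrite mem_cat mem_filter !inE eqxx h !orbT.
have s34 : adj G v3 v4 -> (v3, v4) \in s.
  by move=> h; rewrite mem_cat mem_filter !inE eqxx h !orbT.
move: xy; rewrite dte_SomeE => /and3P[xy h13 h24].
move: (s) s12 s23 s14 s34 => {}s s12 s23 s14 s34.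
move: xN yN xy h13 h24; rewrite !in_cons !in_nil !orbF.
move=> /or4P[]/eqP-> /or4P[]/eqP->;
  rewrite ?adj_irr ?s12 ?s23 ?orbT ?eqxx // ?[[set v3; v1]]setUC ?[[set v4; v2]]setUC ?eqxx //.
- by move=> /s14->.
- by move=> /s34->.
- by rewrite adj_sym => /s14->; rewrite orbT.
- by rewrite adj_sym => /s34->; rewrite orbT.
Qed.

Lemma triangles_on_disjoint : [disjoint triangles_on v1 v3 & triangles_on v2 v4].
Proof.
apply/pred0P=> T; apply/negbTE/negP; rewrite /= !inE.
case/andP=> /andP[/andP[/eqP T3 _] /andP[h1 h3]] /andP[_ /andP[h2 h4]].
have us : uniq [:: v1; v2; v3; v4] by case/and5P: site.
have : #|[:: v1; v2; v3; v4]| <= #|T|.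
  by apply/subset_leq_card/subsetP=> z; rewrite !inE => /or4P[]/eqP->.
by rewrite (card_uniqP us) T3.
Qed.

(** The new triangles correspond to the edges [v1 v2], [v2 v3] and, if
    present, [v1 v4], [v3 v4].  The lost triangles [v1 v2 v3], [v1 v2 v4] and
    [v3 v2 v4] compensate for all of them but one, which the new vertex
    compensates for.  So every further lost triangle, with third vertex in
    [s1] or [s2], raises the level. *)
Lemma level_dte_ge (s1 s2 : seq V) :
  uniq s1 -> uniq s2 ->
  {in s1, forall z, [&& z != v2, adj G z v1 & adj G z v3]} ->
  {in s2, forall z, [&& z != v1, z != v3, adj G z v2 & adj G z v4]} ->
  (level G + (size s1 + size s2)%:Z <= level G')%R.
Proof.
move=> u1 u2 h1 h2.
have [[a12 a23 a13 a24] [n12 n13 n14 [n23 n24 n34]]] := siteP site.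
have b1 : size s1 < #|triangles_on v1 v3|.
  apply: (@leq_triangles_on v1 v3 (v2 :: s1)) => //=.
    by rewrite u1 andbT; apply/negP => /h1; rewrite eqxx.
  by move=> z; rewrite inE => /predU1P[->|/h1 /andP[]//]; rewrite a23 adj_sym a12.
have b2 : size s2 + adj G v1 v4 + adj G v3 v4 <= #|triangles_on v2 v4|.
  (* The vertices [v1], [v3] give further triangles on [v2 v4] if adjacent to [v4]. *)
  pose t := [seq z <- [:: v1; v3] | adj G z v4].
  have -> : size s2 + adj G v1 v4 + adj G v3 v4 = size (s2 ++ t).
    by rewrite size_cat /t /=; case: (adj G v1 v4); case: (adj G v3 v4); rewrite /= ?addn0 ?addn1 ?addn2.
  apply: leq_triangles_on => //.
    rewrite cat_uniq u2 filter_uniq /= ?inE ?n13 // andbT.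
    apply/hasPn => z; rewrite mem_filter !inE => /andP[_ zE].
    by apply/negP => /h2 /and4P[/negbTE z1 /negbTE z3]; move: zE; rewrite z1 z3.
  move=> z; rewrite mem_cat => /orP[/h2 /and4P[_ _ -> ->]//|].
  rewrite mem_filter !inE => /andP[-> /orP[]/eqP->]; first by rewrite a12.
  by rewrite adj_sym a23.
set e1 := nat_of_bool _ in b2; set e3 := nat_of_bool _ in b2.
set L13 := triangles_on v1 v3 in b1 *; set L24 := triangles_on v2 v4 in b2 *.
have cU : #|L13 :|: L24| = #|L13| + #|L24|.
  by apply/eqP; rewrite (leq_card_setU L13 L24) triangles_on_disjoint.
have sU : L13 :|: L24 \subset triangles G.
  by apply/subsetP=> T; rewrite in_setU !in_triangles_on => /orP[]/andP[].
have cG : #|L13 :|: L24| + #|triangles G :\: (L13 :|: L24)| = #|triangles G|.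
  by rewrite -[RHS](cardsID (L13 :|: L24)) (setIidPr sU).
have cG' : #|[set T in triangles G' | None \in T]| +
           #|[set T in triangles G' | None \notin T]| = #|triangles G'|.
  rewrite -[RHS](cardsID [set T : {set option V} | None \in T]).
  by congr (_ + _); apply: eq_card => T; rewrite !in_set ?in_setD ?in_setI ?in_set // andbC.
have := old_triangles_le; have := new_triangles_le.
rewrite -/e1 -/e3 -/L13 -/L24 => hn ho.
suff : #|triangles G'| + (size s1 + size s2) <= #|triangles G|.+1.
  rewrite /level card_option; move: #|triangles G'| #|triangles G| (size s1 + size s2) #|V|.
  by clear; lia.
move: cU cG cG' b1 b2 hn ho.
move: #|L13 :|: L24| #|triangles G :\: _| #|L13| #|L24| #|triangles G| => x1 x2 x3 x4 x5.
move: #|triangles G'| #|[set _ in _ | None \in _]| #|[set _ in _ | None \notin _]|.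
move: (size s1) (size s2) e1 e3 => x6 x7 x8 x9 x10 x11 x12.
clear; lia.
Qed.

End LevelDte.

(** * Ring graphs *)

Local Open Scope ring_scope.

(** Edges are counted as ordered pairs. *)
Lemma card_arcs (W : finType) (G : sgraph W) : regular 4 G ->
  #|[set p : W * W | adj G p.1 p.2]| = (4 * #|W|)%N.
Proof.
move/forallP=> rG; rewrite -sum1_card.
rewrite (eq_bigl (fun p => (p.1 \in predT) && adj G p.1 p.2)); last by move=> p; rewrite inE.
rewrite -(pair_big_dep predT (fun x y => adj G x y) (fun _ _ => 1%N)) /=.
rewrite (eq_bigr (fun _ => 4%N)); first by rewrite sum_nat_const mulnC cardT.
by move=> x _; rewrite -(eqP (rG x)) -sum1_card; apply: eq_bigl => y; rewrite inE.
Qed.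

Section Cyclic.
Variable m : nat.
Local Notation V := 'I_m.+2.
Implicit Types (x y z v w : V) (P : seq V) (M : seq (V * V)).

Lemma ord_addS x : nat_of_ord (x + 1) = if x == m.+1 :> nat then 0%N else x.+1.
Proof.
have -> : nat_of_ord (x + 1) = ((x + 1 %% m.+2) %% m.+2)%N by [].
rewrite [(1 %% _)%N]modn_small // addn1; have := ltn_ord x; rewrite /=.
case: (nat_of_ord x =P m.+1) => [->|ne lt]; first by rewrite modnn.
by rewrite modn_small //; lia.
Qed.

Lemma natr_ord k : (k < m.+2)%N -> nat_of_ord (k%:R : V) = k.
Proof. by move=> lt; have := @val_Zp_nat m.+2 isT k; rewrite (modn_small lt). Qed.

Lemma natr_eq0 k : (0 < k < m.+2)%N -> (k%:R : V) != 0.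
Proof.
case/andP=> k0 km; apply/eqP => /(congr1 (@nat_of_ord _)); rewrite natr_ord //= => E.
by rewrite E in k0.
Qed.

Lemma addr_neq x k : (0 < k < m.+2)%N -> x + k%:R != x.
Proof. by move=> h; rewrite -subr_eq0 addrC addKr natr_eq0. Qed.

Lemma neq_shift k x y : (0 < k < m.+2)%N -> y = x + k%:R -> x != y.
Proof. by move=> h ->; rewrite eq_sym addr_neq. Qed.

Lemma ord_subS x : nat_of_ord (x - 1) = if x == 0%N :> nat then m.+1 else x.-1.
Proof.
have := ord_addS (x - 1); rewrite subrK => ->.
by case: (nat_of_ord (x - 1) =P m.+1) => [->|].
Qed.

Lemma ord_N1 : nat_of_ord (-1 : V) = m.+1.
Proof. by rewrite -[-1]add0r ord_subS. Qed.

Lemma ord_1 : nat_of_ord (1 : V) = 1%N.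
Proof. by rewrite -[1]add0r ord_addS. Qed.

Lemma ord_addS_val x k : nat_of_ord x = k -> (k < m.+1)%N -> nat_of_ord (x + 1) = k.+1.
Proof. by move=> E km; rewrite ord_addS E ltn_eqF. Qed.

Lemma ord_subS_val x k : nat_of_ord x = k -> (0 < k)%N -> nat_of_ord (x - 1) = k.-1.
Proof. by move=> E k0; rewrite ord_subS E gtn_eqF. Qed.

Lemma ord_eqE x y : (x == y) = (nat_of_ord x == y).
Proof. by []. Qed.

Lemma addrSS x : x + 1 + 1 = x + 2%:R.
Proof. ring. Qed.

Lemma ord_opp (x : V) : x != 0 -> nat_of_ord (- x) = (m.+2 - x)%N.
Proof.
move=> x0; have {}x0 : nat_of_ord x != 0%N by [].
have -> : nat_of_ord (- x) = ((m.+2 - x) %% m.+2)%N by [].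
by rewrite modn_small //; have := ltn_ord x; lia.
Qed.

(** The elements of [P] are the breaks, those of [M] the chords.  The number
    of vertices is [m.+2], so that ['I_m.+2] carries the ring structure of the
    integers modulo it. *)
Definition ring_graph (P : seq V) (M : seq (V * V)) : sgraph V :=
  sgraph_of (fun x y =>
    [|| y == x + 1, (y == x + 2%:R) && (x + 1 \notin P) | (x, y) \in M]).

Lemma ring_adjS P M x : adj (ring_graph P M) x (x + 1).
Proof. by rewrite adj_sgraph_of eqxx andbT (@neq_shift 1%N). Qed.

Lemma ring_adjSS P M x : (0 < m)%N -> x + 1 \notin P ->
  adj (ring_graph P M) x (x + 2%:R).
Proof. by move=> m0 xP; rewrite adj_sgraph_of eqxx xP orbT andbT (@neq_shift 2%N). Qed.

Lemma ring_adjM P M x y : x != y -> (x, y) \in M -> adj (ring_graph P M) x y.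
Proof. by move=> xy xyM; rewrite adj_sgraph_of xy xyM !orbT. Qed.

Variant ring_adj_spec P M x y : Prop :=
  | RingS of y = x + 1
  | RingSS of y = x + 2%:R & x + 1 \notin P
  | RingM of (x, y) \in M.

Lemma ring_adjP P M x y : adj (ring_graph P M) x y ->
  ring_adj_spec P M x y \/ ring_adj_spec P M y x.
Proof.
rewrite adj_sgraph_of => /andP[_ /orP[]/or3P[/eqP h|/andP[/eqP h1 h2]|h]].
- by left; apply: RingS.
- by left; apply: RingSS.
- by left; apply: RingM.
- by right; apply: RingS.
- by right; apply: RingSS.
- by right; apply: RingM.
Qed.

(** There are [n] edges [x, x+1], then [n - size P] edges [x, x+2] and at most
    [size M] chords. *)
Lemma card_ring_arcs P M : uniq P -> (size M <= size P)%N ->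
  (#|[set p : V * V | adj (ring_graph P M) p.1 p.2]| <= 4 * m.+2)%N.
Proof.
move=> uP MP.
(* One orientation of each edge. *)
pose T := [seq (x, x + 1) | x <- enum V] ++
          [seq (x, x + 2%:R) | x <- [seq x : V <- enum V | x + 1 \notin P]] ++ M.
have sT : (size T <= 2 * m.+2)%N.
  have sV : size (enum V) = m.+2 by rewrite -cardE card_ord.
  rewrite /T !size_cat (size_map (fun x => (x, x + 1))) (size_map (fun x => (x, x + 2%:R))) sV.
  rewrite [size (filter _ _)]size_filter.
  have : (count (fun x : V => (x + 1)%R \notin P) (enum V) + size P <= m.+2)%N.
    have u : uniq ([seq x : V <- enum V | x + 1 \notin P] ++ [seq x - 1 | x <- P]).
      rewrite cat_uniq filter_uniq ?enum_uniq // map_inj_uniq ?uP; last exact: addIr.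
      rewrite andbT; apply/hasPn => _ /mapP[y yP ->].
      by rewrite mem_filter subrK yP.
    rewrite -size_filter -(size_map (fun x => x - 1) P) -size_cat -(card_uniqP u).
    by apply: leq_trans (max_card _) _; rewrite card_ord.
  by move=> h; rewrite mulSn mul1n leq_add2l (leq_trans _ h) // leq_add2l.
apply: (@leq_trans (size (T ++ [seq (p.2, p.1) | p <- T]))); last first.
  by rewrite size_cat size_map; lia.
apply: leq_trans (card_size _); apply/subset_leq_card/subsetP=> -[x y]; rewrite inE /=.
have key a b : ring_adj_spec P M a b -> (a, b) \in T.
  rewrite !mem_cat => -[->|-> aP|->]; last by rewrite !orbT.
    by rewrite map_f ?mem_enum.
  by rewrite [X in _ || (X || _)]map_f ?orbT // mem_filter aP mem_enum.
case/ring_adjP=> /key h; rewrite mem_cat ?h //.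
by apply/orP; right; apply/mapP; exists (y, x).
Qed.

Section Embedding.
Variables (W : finType) (G : sgraph W) (P : seq V) (M : seq (V * V)) (f : W -> V).
Hypotheses (rG : regular 4 G) (cW : #|W| = m.+2) (f_inj : injective f).
Hypotheses (uP : uniq P) (sMP : (size M <= size P)%N).
Hypothesis fE : forall x y : W, adj G x y -> adj (ring_graph P M) (f x) (f y).

(** A 4-regular graph on [n] vertices has [2n] edges and the ring graph has at
    most as many, so an injection that preserves edges preserves non-edges
    too.  Thanks to this, only edges are ever checked when two ring graphs are
    compared. *)
Lemma ring_embedding_adj (x y : W) : adj (ring_graph P M) (f x) (f y) = adj G x y.
Proof.
pose ff (p : W * W) := (f p.1, f p.2).
have ff_inj : injective ff by move=> [a b] [c d] [/f_inj -> /f_inj ->].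
set EG := [set p : W * W | adj G p.1 p.2].
have sub : ff @: EG \subset [set p | adj (ring_graph P M) p.1 p.2].
  by apply/subsetP=> _ /imsetP[[a b] + ->]; rewrite !inE => /fE.
have E : ff @: EG = [set p | adj (ring_graph P M) p.1 p.2].
  apply/eqP; rewrite eqEcard sub (card_imset _ ff_inj) (card_arcs rG) cW.
  exact: card_ring_arcs.
move/setP/(_ (f x, f y)): E; rewrite !inE /= => <-.
by rewrite (mem_imset _ (x, y) ff_inj) inE.
Qed.

Lemma ring_embedding : isomorphic G (ring_graph P M).
Proof.
by apply: (isomorphic_inj _ f_inj ring_embedding_adj); rewrite card_ord.
Qed.

End Embedding.

End Cyclic.

(** * Consecutive triangles *)

Section Consecutive.
Variable m : nat.
Local Notation V := 'I_m.+2.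
Implicit Types (x y z v w : V) (P : seq V) (M : seq (V * V)).

Definition consecutive v x y z : bool :=
  (x, y, z) \in [:: (v - 1, v, v + 1); (v + 1, v, v - 1); (v, v - 1, v + 1);
                    (v, v + 1, v - 1); (v - 1, v + 1, v); (v + 1, v - 1, v)].

Lemma consecutiveP v x y z : consecutive v x y z ->
  [\/ x = v /\ (y = v - 1 /\ z = v + 1 \/ y = v + 1 /\ z = v - 1),
      y = v /\ (x = v - 1 /\ z = v + 1 \/ x = v + 1 /\ z = v - 1)
    | z = v /\ (x = v - 1 /\ y = v + 1 \/ x = v + 1 /\ y = v - 1)].
Proof.
rewrite /consecutive !inE => /or4P[|||/or3P[]] /eqP[-> -> ->];
  by [constructor 1; split; auto|constructor 2; split; auto|constructor 3; split; auto].
Qed.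

Lemma consecutive_set v x y z : consecutive v x y z ->
  [set x; y; z] = [set v - 1; v; v + 1].
Proof.
by case/consecutiveP=> -[-> [[-> ->]|[-> ->]]]; apply/setP=> t; rewrite !inE;
  case: (t == v); case: (t == v - 1); case: (t == v + 1).
Qed.

(** No chord lies in a triangle. *)
Definition triangles_consecutive P M := forall x y z,
  adj (ring_graph P M) x y -> adj (ring_graph P M) y z -> adj (ring_graph P M) x z ->
  exists2 v, v \notin P & consecutive v x y z.

(** The six orders of a triangle are covered by [consecutive], so the
    increasing one suffices. *)
Lemma sorted_triangles_consecutive P M :
  (forall x y z, (x < y < z)%N ->
    adj (ring_graph P M) x y -> adj (ring_graph P M) y z -> adj (ring_graph P M) x z ->
    exists2 v, v \notin P & consecutive v x y z) ->
  triangles_consecutive P M.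
Proof.
move=> H.
have perm12 v x y z : consecutive v x y z = consecutive v y x z.
  rewrite /consecutive !inE !xpair_eqE.
  by case: (x =P v - 1) => ?; case: (y =P v - 1) => ?; case: (z =P v - 1) => ?;
     case: (x =P v) => ?; case: (y =P v) => ?; case: (z =P v) => ?;
     case: (x =P v + 1) => ?; case: (y =P v + 1) => ?; case: (z =P v + 1) => ?.
have perm23 v x y z : consecutive v x y z = consecutive v x z y.
  rewrite /consecutive !inE !xpair_eqE.
  by case: (x =P v - 1) => ?; case: (y =P v - 1) => ?; case: (z =P v - 1) => ?;
     case: (x =P v) => ?; case: (y =P v) => ?; case: (z =P v) => ?;
     case: (x =P v + 1) => ?; case: (y =P v + 1) => ?; case: (z =P v + 1) => ?.
move=> x y z xy yz xz; have [yx zy zx] : [/\ adj (ring_graph P M) y x,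
  adj (ring_graph P M) z y & adj (ring_graph P M) z x] by rewrite !(adj_sym _ _ x) (adj_sym _ z).
case: (ltngtP (val x) (val y)) => [lxy|lyx|/val_inj exy]; last first.
- by rewrite exy adj_irr in xy.
- case: (ltngtP (val x) (val z)) => [lxz|lzx|/val_inj exz]; last first.
  + by rewrite exz adj_irr in xz.
  + case: (ltngtP (val y) (val z)) => [lyz|lzy|/val_inj eyz]; last first.
    * by rewrite eyz adj_irr in yz.
    * case: (H z y x) => // [|v vP]; first by rewrite lzy.
      by rewrite perm23 perm12 perm23 => h; exists v.
    * case: (H y z x) => // [|v vP]; first by rewrite lyz.
      by rewrite perm23 perm12 => h; exists v.
  + case: (H y x z) => // [|v vP]; first by rewrite lyx.
    by rewrite perm12 => h; exists v.
- case: (ltngtP (val y) (val z)) => [lyz|lzy|/val_inj eyz]; last first.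
  + by rewrite eyz adj_irr in yz.
  + case: (ltngtP (val x) (val z)) => [lxz|lzx|/val_inj exz]; last first.
    * by rewrite exz adj_irr in xz.
    * case: (H z x y) => // [|v vP]; first by rewrite lzx.
      by rewrite perm12 perm23 => h; exists v.
    * case: (H x z y) => // [|v vP]; first by rewrite lxz.
      by rewrite perm23 => h; exists v.
  + by apply: H => //; rewrite lxy.
Qed.

Lemma ring_triangle P M v : (0 < m)%N -> v \notin P ->
  [/\ adj (ring_graph P M) (v - 1) v, adj (ring_graph P M) v (v + 1)
    & adj (ring_graph P M) (v - 1) (v + 1)].
Proof.
move=> m0 vP; split; last 1 first.
- have := @ring_adjSS m P M (v - 1); rewrite subrK => /(_ m0 vP).
  by rewrite (_ : v - 1 + 2%:R = v + 1) //; ring.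
- by have := @ring_adjS m P M (v - 1); rewrite subrK.
- exact: ring_adjS.
Qed.

(** Sending [v] to the triangle with centre [v] is a bijection from the
    complement of [P] to the set of triangles. *)
Lemma level_ring P M : (4 < m)%N -> uniq P -> triangles_consecutive P M ->
  level (ring_graph P M) = (size P)%:Z.
Proof.
move=> m4 uP tP.
have E : triangles (ring_graph P M) = (fun v => [set v - 1; v; v + 1]) @: [set v | v \notin P].
  apply/setP=> T; apply/triangleP/imsetP => [[x [y [z [-> xy yz xz]]]]|[v]].
    by have [v vP /consecutive_set ->] := tP x y z xy yz xz; exists v; rewrite ?inE.
  rewrite inE => vP ->; have [] := @ring_triangle P M v _ vP; first by lia.
  by exists (v - 1), v, (v + 1).
rewrite /level E card_in_imset => [|v w _ _ /setP vw].
  have : (#|[set v | v \notin P]| + size P = m.+2)%N.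
    have <- : #|[set x in P]| = size P by rewrite cardsE; apply/card_uniqP.
    rewrite addnC.
    have -> : [set v | v \notin P] = ~: [set x in P] by apply/setP=> v; rewrite !inE.
    by rewrite cardsC card_ord.
  by rewrite card_ord; move: #|_| (size P) => a b <-; lia.
have v1 := vw (v + 1); have v0 := vw v; have v2 := vw (v - 1).
move: v0 v1 v2; rewrite !inE !eqxx ?orbT /=.
have F k x y : (0 < k < 7)%N -> y = x + k%:R -> (x == y) = false.
  by move=> h e; apply/negbTE/(@neq_shift _ k) => //; lia.
case/esym/orP=> [/orP[]|] /eqP->; rewrite ?eqxx //.
- have -> : (w - 1 - 1 == w - 1) = false by apply: (F 1%N) => //; ring.
  have -> : (w - 1 - 1 == w) = false by apply: (F 2%N) => //; ring.
  by have -> : (w - 1 - 1 == w + 1) = false by apply: (F 3%N) => //; ring.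
- rewrite ![w + 1 + 1 == _]eq_sym.
  have -> : (w + 1 == w + 1 + 1) = false by apply: (F 1%N) => //; ring.
  have -> : (w == w + 1 + 1) = false by apply: (F 2%N) => //; ring.
  by have -> : (w - 1 == w + 1 + 1) = false by apply: (F 3%N) => //; ring.
Qed.

End Consecutive.

(** * Expansion sites of a ring graph *)

Local Opaque dte.

Section Sites.
Variable m : nat.
Hypothesis m_gt4 : (4 < m)%N.
Local Notation V := 'I_m.+2.
Implicit Types (x y z v w e p : V).
Variables (P : seq V) (M : seq (V * V)).
Local Notation G := (ring_graph P M).

(** The direction in which the ring is read.  Since the conditions defining a
    ring graph are invariant under reversal, statements parametrised by a
    direction cover mirror images. *)
Definition unit_step e := (e == 1) || (e == -1).

Lemma step_neq e k x y : unit_step e -> (0 < k < 7)%N -> y = x + e *+ k -> x != y.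
Proof.
case/orP=> /eqP-> h ->; first by apply: (@neq_shift m k) => //; lia.
rewrite eq_sym; apply: (@neq_shift m k); first lia.
by rewrite mulNrn addrNK.
Qed.

Lemma step_adj e x : unit_step e -> adj G x (x + e).
Proof.
case/orP=> /eqP->; first exact: ring_adjS.
by rewrite adj_sym -{2}[x](subrK 1); exact: ring_adjS.
Qed.

Lemma step_adj2 e x : unit_step e -> x + e \notin P -> adj G x (x + e *+ 2).
Proof.
have m0 : (0 < m)%N by apply: leq_trans m_gt4.
case/orP=> /eqP-> xP; first exact: ring_adjSS.
rewrite adj_sym; have := @ring_adjSS m P M (x - 1 *+ 2) m0.
have -> : x - 1 *+ 2 + 1 = x - 1 by ring.
have -> : x - 1 *+ 2 + 2%:R = x by ring.
by rewrite -mulNrn; apply.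
Qed.

Ltac forward_neq he :=
  first [ apply: (step_neq (k := 1) he) => //; ring | apply: (step_neq (k := 2) he) => //; ring
        | apply: (step_neq (k := 3) he) => //; ring | apply: (step_neq (k := 4) he) => //; ring
        | apply: (step_neq (k := 5) he) => //; ring | apply: (step_neq (k := 6) he) => //; ring ].

Ltac step_ne he := solve [ forward_neq he | rewrite eq_sym; forward_neq he ].

Lemma adj_step1 e x y : unit_step e -> y = x + e -> adj G x y.
Proof. by move=> he ->; exact: step_adj. Qed.

Lemma adj_step2 e x y z : unit_step e -> z \notin P -> z = x + e -> y = x + e *+ 2 -> adj G x y.
Proof. by move=> he zP zE ->; apply: step_adj2 => //; rewrite -zE. Qed.

(** With [twist_site] below, the two kinds of sites on a path [v-e, v, v+e,
    v+2e] of four vertices whose middle vertices are not breaks.  The apex is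
    here the middle [v] of the triangle [v-e, v, v+e]; in [twist_site] it is
    the end [v+e] of that triangle. *)
Lemma insert_site e v : unit_step e -> v \notin P -> v + e \notin P ->
  dte_site G (v - e) v (v + e) (v + e *+ 2).
Proof.
move=> he P1 P2; apply/and5P; split.
- by rewrite /= !inE !negb_or !andbT; do ?[apply/andP; split]; step_ne he.
- by apply: (adj_step1 he); ring.
- exact: step_adj.
- by apply: (adj_step2 he P1); ring.
- by apply: (adj_step2 he P2); ring.
Qed.

Lemma twist_site e v : unit_step e -> v \notin P -> v + e \notin P ->
  dte_site G (v - e) (v + e) v (v + e *+ 2).
Proof.
move=> he P1 P2; apply/and5P; split.
- by rewrite /= !inE !negb_or !andbT; do ?[apply/andP; split]; step_ne he.
- by apply: (adj_step2 he P1); ring.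
- by rewrite adj_sym; exact: step_adj.
- by apply: (adj_step1 he); ring.
- by apply: (adj_step1 he); ring.
Qed.

Lemma break_site e p : unit_step e -> p + e \notin P -> p - e \notin P ->
  dte_site G (p + e *+ 2) p (p + e) (p - e).
Proof.
move=> he P1 P2; apply/and5P; split.
- by rewrite /= !inE !negb_or !andbT; do ?[apply/andP; split]; step_ne he.
- by rewrite adj_sym; apply: (adj_step2 he P1); ring.
- exact: step_adj.
- by rewrite adj_sym; apply: (adj_step1 he); ring.
- by rewrite adj_sym; apply: (adj_step1 he); ring.
Qed.

(** If [v-e] is not a break, [v-2e] is a common neighbour of [v-e] and [v]; if
    [v+2e] is not a break, [v+3e] is one of [v+e] and [v+2e]. *)
Lemma twist_level e v : unit_step e -> v \notin P -> v + e \notin P ->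
  level G + ((v - e \notin P) + (v + e *+ 2 \notin P))%:Z <=
  level (dte G (v - e) (v + e) v (v + e *+ 2)).
Proof.
move=> he P1 P2.
have := @level_dte_ge _ G _ _ _ _ (twist_site he P1 P2)
  (nseq (v - e \notin P) (v - e *+ 2)) (nseq (v + e *+ 2 \notin P) (v + e *+ 3)).
rewrite !size_nseq; apply; try by case: (_ \notin _).
- move=> z; rewrite mem_nseq; case P3: (v - e \notin P) => //= /eqP->.
  apply/and3P; split; first by step_ne he.
    by apply: (adj_step1 he); ring.
  by apply: (adj_step2 he P3); ring.
- move=> z; rewrite mem_nseq; case P3: (v + e *+ 2 \notin P) => //= /eqP->.
  apply/and4P; split; [by step_ne he|by step_ne he|rewrite adj_sym..].
    by apply: (adj_step2 he P3); ring.
  by apply: (adj_step1 he); ring.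
Qed.

(** If [p+2e] is not a break, [p+3e] is a common neighbour of [p+e] and
    [p+2e]; if [p-e] is not a break, choosing [p-e] as fourth vertex, [p-2e]
    is one of [p] and [p-e]. *)
Lemma break_level e p v4 : regular 4 G -> unit_step e -> p + e \notin P ->
  dte_site G (p + e *+ 2) p (p + e) v4 ->
  level G + ((p + e *+ 2 \notin P) + (p - e \notin P))%:Z <=
  level (dte G (p + e *+ 2) p (p + e) v4).
Proof.
move=> rG he P1 site.
have S1 z : z \in nseq (p + e *+ 2 \notin P) (p + e *+ 3) ->
    [&& z != p, adj G z (p + e *+ 2) & adj G z (p + e)].
  rewrite mem_nseq; case P3: (p + e *+ 2 \notin P) => //= /eqP->.
  apply/and3P; split; [by step_ne he|rewrite adj_sym..].
    by apply: (adj_step1 he); ring.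
  by apply: (adj_step2 he P3); ring.
have [P2|P2] := boolP (p - e \notin P); last first.
  have := @level_dte_ge _ G _ _ _ _ site (nseq (p + e *+ 2 \notin P) (p + e *+ 3)) [::].
  rewrite !size_nseq; apply => //; by case: (_ \notin _).
rewrite (level_iso (dte_swap rG site (break_site he P1 P2))).
have := @level_dte_ge _ G _ _ _ _ (break_site he P1 P2)
  (nseq (p + e *+ 2 \notin P) (p + e *+ 3)) [:: p - e *+ 2].
rewrite !size_nseq; apply => //; first by case: (_ \notin _).
move=> z; rewrite inE => /eqP->.
apply/and4P; split; [by step_ne he|by step_ne he|..].
  by apply: (adj_step2 he P2); ring.
by apply: (adj_step1 he); ring.
Qed.

(** The position of the apex in its triangle decides: the middle [v] of the
    triangle with a non-break next to it ([InsertSite]), the middle of a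
    zigzag of one triangle ([ShortSite]), an end that is not a break
    ([TwistSite]), an end [b] that is a break ([BreakSite]). *)
Variant ring_site_spec v1 v2 v3 v4 : Prop :=
  | InsertSite v of v \notin P & v + 1 \notin P &
      isomorphic (dte G v1 v2 v3 v4) (dte G (v - 1) v (v + 1) (v + 1 *+ 2))
  | ShortSite v of v \notin P & v - 1 \in P & v + 1 \in P &
      forall w, w != v - 1 -> w != v + 1 -> adj G v w ->
      isomorphic (dte G v1 v2 v3 v4) (dte G (v - 1) v (v + 1) w)
  | TwistSite v of v \notin P & v + 1 \notin P &
      isomorphic (dte G v1 v2 v3 v4) (dte G (v - 1) (v + 1) v (v + 1 *+ 2))
  | BreakSite e p of unit_step e & p \in P & p + e \notin P &
      level G + ((p + e *+ 2 \notin P) + (p - e \notin P))%:Z <= level (dte G v1 v2 v3 v4).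

Lemma ring_site_swap v1 v2 v3 v4 : ring_site_spec v3 v2 v1 v4 -> ring_site_spec v1 v2 v3 v4.
Proof.
have iso := dte_sym G v1 v2 v3 v4.
case=> [w w1 w2 h|w w1 w2 w3 h|w w1 w2 h|e p he pP pe h].
- by apply: (@InsertSite _ _ _ _ w) => //; apply: isomorphic_trans iso h.
- apply: (@ShortSite _ _ _ _ w) => // x x1 x2 x3.
  by apply: isomorphic_trans iso (h _ x1 x2 x3).
- by apply: (@TwistSite _ _ _ _ w) => //; apply: isomorphic_trans iso h.
- by apply: (BreakSite he pP pe); rewrite (level_iso iso).
Qed.

Lemma run_shift v : [/\ v - 1 - 1 = v - 1 *+ 2, v - 1 + 1 = v & v - 1 + 1 *+ 2 = v + 1].
Proof. by split; ring. Qed.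

Lemma unit_step1 : unit_step 1. Proof. by rewrite /unit_step eqxx. Qed.
Lemma unit_stepN1 : unit_step (-1). Proof. by rewrite /unit_step eqxx orbT. Qed.

(** If [v+1] is a break but [v-1] is not, the path [v-2, v-1, v, v+1] is used,
    read backwards. *)
Lemma ring_site_middle v v4 : regular 4 G -> v \notin P ->
  dte_site G (v - 1) v (v + 1) v4 -> ring_site_spec (v - 1) v (v + 1) v4.
Proof.
move=> rG vP site; have [E1 E2 E3] := run_shift v.
have [v1P|v1P] := boolP (v + 1 \in P); last first.
  by apply: (@InsertSite _ _ _ _ v) => //; apply: dte_swap => //; apply: insert_site => //; exact: unit_step1.
have [v2P|v2P] := boolP (v - 1 \in P).
  apply: (@ShortSite _ _ _ _ v) => // w w1 w2 vw; apply: dte_swap => //.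
  move: site; rewrite /dte_site => /and5P[u -> -> -> _]; rewrite vw !andbT.
  move: u; rewrite /= !inE !negb_or => /and4P[/and3P[-> -> _] /andP[-> _] _ _].
  by rewrite ![_ == w]eq_sym w1 w2 eq_sym (adj_neq vw).
apply: (@InsertSite _ _ _ _ (v - 1)) => //; first by rewrite E2.
have := insert_site unit_stepN1 vP v2P; rewrite opprK mulNrn => site'.
apply: isomorphic_trans (dte_swap rG site (dte_site_sym site')) _.
apply: isomorphic_trans (dte_sym _ _ _ _ _) _.
apply: isomorphic_trans (dte_rev _ _ _ _ _) _.
by rewrite E1 E2 E3; exact: isomorphic_refl.
Qed.

(** A non-break end is the third vertex of a path of four, on which the
    expansion is a twist; the path is read forwards or backwards according to
    the sign of [e]. *)
Lemma ring_site_end e v v4 : regular 4 G -> unit_step e -> v \notin P ->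
  dte_site G (v - e) (v + e) v v4 -> ring_site_spec (v - e) (v + e) v v4.
Proof.
move=> rG he vP site; have [E1 E2 E3] := run_shift v.
have [v1P|v1P] := boolP (v + e \in P).
  have hNe : unit_step (- e) by move: he; rewrite /unit_step !eqr_oppLR opprK orbC.
  have E4 : v + e + (- e) *+ 2 = v - e by ring.
  have E5 : v + e - e = v by ring.
  have := @break_level (- e) (v + e) v4 rG hNe.
  rewrite E5 E4 => /(_ vP site) bound.
  by apply: (BreakSite hNe v1P); rewrite ?E5 ?E4.
have iso := dte_swap rG site (twist_site he vP v1P).
case/orP: he => /eqP eE; subst e; first exact: (@TwistSite _ _ _ _ v).
apply: (@TwistSite _ _ _ _ (v - 1)) => //; first by rewrite subrK.
apply: isomorphic_trans iso _; apply: isomorphic_trans (dte_rev _ _ _ _ _) _.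
by rewrite opprK mulNrn E1 E2 E3; exact: isomorphic_refl.
Qed.

(** The triangle of the site is consecutive, so its apex is the centre or one
    of the two ends. *)
Lemma ring_siteP v1 v2 v3 v4 : regular 4 G -> triangles_consecutive P M ->
  dte_site G v1 v2 v3 v4 -> ring_site_spec v1 v2 v3 v4.
Proof.
move=> rG tP site; have site' := dte_site_sym site.
have [[a12 a23 a13 _] _] := siteP site.
have [v vP /consecutiveP con] := tP _ _ _ a12 a23 a13.
case: con => -[vE [[w1E w2E]|[w1E w2E]]]; subst v1 v2 v3.
- apply: ring_site_swap; have := @ring_site_end (-1) v v4 rG unit_stepN1 vP.
  by rewrite opprK; apply.
- by apply: ring_site_swap; apply: (@ring_site_end 1 v v4 rG unit_step1 vP).
- exact: ring_site_middle.
- by apply: ring_site_swap; apply: ring_site_middle.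
- by have := @ring_site_end 1 v v4 rG unit_step1 vP site.
- have := @ring_site_end (-1) v v4 rG unit_stepN1 vP.
  by rewrite opprK; apply.
Qed.

End Sites.

(** * Expansions between ring graphs *)

Section Stretch.
Variable m : nat.
Local Notation V := 'I_m.+2.
Local Notation W := 'I_m.+3.
Implicit Types (x y z v w e p : V).

(** Lengthening the ring by one vertex: [stretch v] maps [Z_n] into [Z_(n+1)]
    in order, leaving free the position [gap v] between the images of [v] and
    [v+1]. *)
Definition gap v : W := lift ord0 v.
Definition stretch v x : W := lift (gap v) x.

Lemma stretch_inj v : injective (stretch v).
Proof. exact: lift_inj. Qed.

Lemma stretch_gap v x : stretch v x != gap v.
Proof. by rewrite eq_sym neq_lift. Qed.

Lemma ord_stretch v x : nat_of_ord (stretch v x) = ((v < x) + x)%N.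
Proof. by []. Qed.

Lemma ord_gap v : nat_of_ord (gap v) = v.+1.
Proof. by []. Qed.

Lemma stretchS v x : x != v -> stretch v (x + 1) = stretch v x + 1.
Proof.
rewrite -val_eqE /= => xv; apply: ord_inj.
rewrite ord_addS !ord_stretch !ord_addS /=.
have := ltn_ord x; have := ltn_ord v.
by case: (nat_of_ord x =P m.+1) => h; case: ifP; lia.
Qed.

Lemma stretch_gapl v : stretch v v + 1 = gap v.
Proof.
apply: ord_inj; rewrite ord_addS ord_stretch ord_gap /= ltnn add0n.
by have := ltn_ord v; case: eqP => //; lia.
Qed.

Lemma stretch_gapr v : gap v + 1 = stretch v (v + 1).
Proof.
apply: ord_inj; rewrite ord_addS ord_stretch ord_gap !ord_addS /=.
by have := ltn_ord v; case: (nat_of_ord v =P m.+1) => h; case: ifP; lia.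
Qed.

Lemma stretchSS v x : x != v -> x + 1 != v -> stretch v (x + 2%:R) = stretch v x + 2%:R.
Proof.
move=> xv x1v; have -> : x + 2%:R = x + 1 + 1 by ring.
rewrite !stretchS //; ring.
Qed.

Lemma stretch_over v : stretch v (v + 1) = stretch v v + 2%:R.
Proof. rewrite -stretch_gapr -stretch_gapl; ring. Qed.

Lemma stretch_subK v : stretch v (v - 1) + 1 = stretch v v.
Proof. by rewrite -stretchS ?subrK // (@neq_shift _ 1%N) ?subrK. Qed.

Lemma gap_stretch v : gap v = stretch v (v - 1) + 2%:R.
Proof. rewrite -stretch_gapl -stretch_subK; ring. Qed.

Lemma stretch0 v : stretch v 0 = 0.
Proof. by apply: ord_inj; rewrite ord_stretch. Qed.

Lemma stretchB1 v x : x != v + 1 -> stretch v (x - 1) = stretch v x - 1.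
Proof.
move=> xv; rewrite -{2}(subrK 1 x) stretchS ?addrK //.
by apply: contraNneq xv => <-; rewrite subrK.
Qed.

Lemma stretch1 v : v != 0 -> stretch v 1 = 1.
Proof. by move=> v0; rewrite -[X in stretch v X]add0r stretchS ?stretch0 ?add0r // eq_sym. Qed.

Lemma stretchN1 v : v + 1 != 0 -> stretch v (-1) = -1.
Proof. by move=> v0; rewrite -[X in stretch v X]add0r stretchB1 ?stretch0 ?add0r // eq_sym. Qed.

Lemma stretch_over2 v : stretch v (v + 1 *+ 2) = gap v + 2%:R.
Proof.
have vv : v + 1 != v by rewrite eq_sym (@neq_shift _ 1%N).
by rewrite mulr2n addrA stretchS // -stretch_gapr addrSS.
Qed.

Section Moves.
Hypothesis m_gt4 : (4 < m)%N.
Variables (P : seq V) (M : seq (V * V)) (P' : seq W) (M' : seq (W * W)).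
Local Notation G := (ring_graph P M).
Local Notation H := (ring_graph P' M').
Hypotheses (rG : regular 4 G) (uP' : uniq P') (sM' : (size M' <= size P')%N).
Variable v : V.
Hypothesis gapP : gap v \notin P'.

(** The new vertex goes to the free position; by [ring_embedding] it is enough
    to follow the edges that survive. *)
Lemma dte_ring_embedding (f : V -> W) v1 v2 v3 v4 :
  dte_site G v1 v2 v3 v4 -> injective f -> (forall x, f x != gap v) ->
  (forall x y, ring_adj_spec P M x y -> [set x; y] != [set v1; v3] ->
     [set x; y] != [set v2; v4] -> adj H (f x) (f y)) ->
  {in [:: v1; v2; v3; v4], forall x, adj H (f x) (gap v)} ->
  isomorphic (dte G v1 v2 v3 v4) H.
Proof.
move=> site f_inj f_gap fE fN.
pose g (a : option V) := if a is Some x then f x else gap v.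
apply: (@ring_embedding _ _ _ _ _ g) => //.
- exact: regular_dte.
- by rewrite card_option card_ord.
- case=> [x|] [y|] //= E; first by rewrite (f_inj _ _ E).
    by move: (f_gap x); rewrite E eqxx.
  by move: (f_gap y); rewrite -E eqxx.
case=> [x|] [y|] /=; rewrite ?adj_irr //.
- rewrite dte_SomeE => /and3P[/ring_adjP[] h h1 h2]; first exact: fE.
  by rewrite adj_sym; apply: fE => //; rewrite setUC.
- by rewrite dte_SomeNone; exact: fN.
- by rewrite dte_NoneSome adj_sym; exact: fN.
Qed.

(** The new vertex is placed between [v] and [v+1].  It takes over the edges
    of [v] to [v+1] at distance two and to [w], where [w] is [v+2] inside a
    zigzag and the end of a chord at [v] when [v+1] is a break. *)
Lemma ring_insert w :
  dte_site G (v - 1) v (v + 1) w -> v \notin P -> (v + 1 \notin P -> w = v + 1 *+ 2) ->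
  (forall x, x \notin P -> stretch v x \notin P') ->
  (forall x y, (x, y) \in M -> [set x; y] != [set v; w] ->
     adj H (stretch v x) (stretch v y)) ->
  adj H (stretch v w) (gap v) ->
  isomorphic (dte G (v - 1) v (v + 1) w) H.
Proof.
move=> site vP wE hP hM hw.
apply: (dte_ring_embedding site (@stretch_inj v) (stretch_gap v)) => [x y|].
  case=> [->|-> xP|/hM h] h1 h2; last exact: h.
    have [->|xv] := eqVneq x v; last by rewrite stretchS //; exact: ring_adjS.
    rewrite stretch_over; apply: (@ring_adjSS _ P' M' _ isT).
    by rewrite stretch_gapl.
  have [xv|xv] := eqVneq x v.
    by move: h2; rewrite xv (wE _) -?xv // mulr2n eqxx.
  have [xv'|xv'] := eqVneq (x + 1) v.
    move: h1; rewrite -xv' addrK (_ : x + 1 + 1 = x + 2%:R) ?eqxx //; ring.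
  rewrite stretchSS //; apply: (@ring_adjSS _ P' M' _ isT).
  by rewrite -stretchS // hP.
move=> x; rewrite !inE => /or4P[]/eqP->.
- by rewrite gap_stretch; apply: (@ring_adjSS _ P' M' _ isT); rewrite stretch_subK hP.
- by rewrite -stretch_gapl; exact: ring_adjS.
- by rewrite -stretch_gapr adj_sym; exact: ring_adjS.
- exact: hw.
Qed.

(** In a twist the five vertices are read in the order [v-1, v+1], new vertex,
    [v, v+2], so [v] and [v+1] change places. *)
Definition flip x : W := stretch v (tperm v (v + 1) x).

(** In the new order [v-1] and [v+2] are breaks.  If they were not already
    breaks, the edges [v-2, v] and [v+1, v+3] become chords. *)
Lemma ring_twist :
  v \notin P -> v + 1 \notin P ->
  (forall x, x \notin P -> x != v - 1 -> x != v + 2%:R -> stretch v x \notin P') ->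
  (forall x y, (x, y) \in M -> adj H (flip x) (flip y)) ->
  (v - 1 \notin P -> adj H (stretch v (v - 2%:R)) (stretch v (v + 1))) ->
  (v + 2%:R \notin P -> adj H (stretch v v) (stretch v (v + 3%:R))) ->
  isomorphic (dte G (v - 1) (v + 1) v (v + 1 *+ 2)) H.
Proof.
move=> vP v1P hP hM hl hr.
have site := @twist_site _ m_gt4 P M 1 v (unit_step1 m) vP v1P.
have f_inj : injective flip by move=> x y /stretch_inj /perm_inj.
have N k x y : (0 < k < 7)%N -> y = x + k%:R -> x != y.
  by move=> h e; apply: (@neq_shift _ k) => //; lia.
have fl : flip v = stretch v (v + 1) by rewrite /flip tpermL.
have fr : flip (v + 1) = stretch v v by rewrite /flip tpermR.
have fD x : x != v -> x != v + 1 -> flip x = stretch v x.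
  by move=> h1 h2; rewrite /flip tpermD // eq_sym.
have m0 : (0 < m.+1)%N by [].
apply: (dte_ring_embedding site f_inj) => [x|x y|x]; first exact: stretch_gap.
  case=> [->|-> xP|/hM h] h1 h2; last exact: h.
    have [xv|xv] := eqVneq x v.
      rewrite xv fl fr adj_sym stretch_over; apply: (@ring_adjSS _ P' M' _ isT).
      by rewrite stretch_gapl.
    have [xv1|xv1] := eqVneq (x + 1) v.
      by move: h1; rewrite -xv1 addrK eqxx.
    have [xv2|xv2] := eqVneq x (v + 1).
      by move: h2; rewrite xv2 (_ : v + 1 + 1 = v + 1 *+ 2) ?eqxx //; ring.
    rewrite !fD ?stretchS ?(inj_eq (addIr _)) //; exact: ring_adjS.
  have [xv|xv] := eqVneq x v.
    rewrite xv fl fD.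
    + rewrite (_ : v + 2%:R = v + 1 + 1); last by ring.
      rewrite [stretch v (v + 1 + 1)]stretchS; first exact: ring_adjS.
      by rewrite eq_sym (N 1%N).
    + by rewrite eq_sym (N 2%N).
    + by rewrite eq_sym (N 1%N) //; ring.
  have [xv1|xv1] := eqVneq x (v + 1).
    rewrite xv1 fr (_ : v + 1 + 2%:R = v + 3%:R); last by ring.
    rewrite fD; first by apply: hr; move: xP; rewrite xv1 -addrA.
      by rewrite eq_sym (N 3%N).
    by rewrite eq_sym (N 2%N) //; ring.
  have [xv2|xv2] := eqVneq (x + 1) v.
    have -> : x + 2%:R = v + 1 by rewrite -xv2; ring.
    have E : stretch v v = stretch v x + 1 by rewrite -stretchS // xv2.
    rewrite fr fD // E; exact: ring_adjS.
  have [xv3|xv3] := eqVneq (x + 2%:R) v.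
    rewrite xv3 fl fD //.
    have -> : x = v - 2%:R by rewrite -xv3 addrK.
    apply: hl; rewrite (_ : v - 1 = x + 1) // -xv3; ring.
  have xv4 : x + 2%:R != v + 1.
    by apply: contraNneq xv2 => h; apply/eqP/(addIr 1); rewrite -h; ring.
  rewrite !fD // stretchSS //; apply: (@ring_adjSS _ P' M' _ isT).
  rewrite -stretchS //; apply: hP => //.
    by apply: contraNneq xv3 => h; apply/eqP/(addIr (-1)); rewrite -h; ring.
  by apply: contraNneq xv1 => h; apply/eqP/(addIr 1); rewrite h; ring.
rewrite !inE => /or4P[]/eqP->.
- rewrite fD; last 2 first.
  + by rewrite (N 1%N) ?subrK.
  + by rewrite (N 2%N) //; ring.
  rewrite gap_stretch; apply: (@ring_adjSS _ P' M' _ isT); rewrite stretch_subK; apply: hP => //.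
    by rewrite eq_sym (N 1%N) ?subrK.
  by rewrite (N 2%N).
- by rewrite fr -stretch_gapl; exact: ring_adjS.
- by rewrite fl -stretch_gapr adj_sym; exact: ring_adjS.
- rewrite fD; last 2 first.
  + by rewrite eq_sym (N 2%N) // mulr2n.
  + by rewrite eq_sym (N 1%N) //; ring.
  have vN : v + 1 != v by rewrite eq_sym (N 1%N).
  have -> : stretch v (v + 1 *+ 2) = gap v + 2%:R.
    rewrite (_ : v + 1 *+ 2 = v + 1 + 1); last by ring.
    by rewrite stretchS // -stretch_gapr; ring.
  rewrite adj_sym; apply: (@ring_adjSS _ P' M' _ isT); rewrite stretch_gapr; apply: hP => //.
    by rewrite eq_sym (N 2%N) //; ring.
  by rewrite (N 1%N) //; ring.
Qed.

End Moves.
End Stretch.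

(** * The families with no, two and three breaks *)

Definition three_edge (c : bool) (m p q a b : nat) : Prop :=
  b = a.+1 \/ b = a.+2 /\ a.+1 <> p /\ a.+1 <> q \/ a = 0%N /\ b = m.+1 \/ a = 0%N /\ b = m \/
  a = p.-1 /\ b = q.+1 \/
  if c then a = 1%N /\ b = q.-1 \/ a = p.+1 /\ b = m.+1
  else a = 1%N /\ b = p.+1 \/ a = q.-1 /\ b = m.+1.

(** The long edge of the triangle is treated first: it is a step of length
    two, and then the claim holds, or a chord or an edge across 0, and then
    its two ends are known and have no common neighbour in between. *)
Lemma three_edge_triangle c m p q x y z :
  (3 < p)%N -> (p < q)%N -> (q + 4 <= m.+2)%N -> c ==> (p + 4 <= q)%N -> (x < y)%N -> (y < z)%N ->
  three_edge c m p q x y -> three_edge c m p q y z -> three_edge c m p q x z ->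
  y = x.+1 /\ z = x.+2 /\ y <> p /\ y <> q \/ x = 0%N /\ y = m /\ z = m.+1.
Proof.
move=> p4 pq qm cc xy yz h1 h2.
move=> [h|[[h [hp hq]]|h]].
- by exfalso; clear -xy yz h; lia.
- by left; clear -xy yz h hp hq; lia.
case: c cc h1 h2 h => cc; rewrite /three_edge => h1 h2
  [[hx hz]|[[hx hz]|[[hx hz]|[[hx hz]|[hx hz]]]]]; subst x z; lia.
Qed.

Section Families.
Variable m : nat.
Local Notation V := 'I_m.+2.
Implicit Types (x y z v w e p q : V) (P : seq V) (M : seq (V * V)).

Definition circulant : sgraph V := ring_graph [::] [::].
(** Zigzags of [p-1] and [n-p-1] triangles, sharing their end vertices 0 and
    [p].  The chords join the neighbours of these ends. *)
Definition two_zigzags p : sgraph V := ring_graph [:: 0; p] [:: (1, p + 1); (p - 1, -1)].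
(** Zigzags of [p-1], [q-p-1] and [n-q-1] triangles, sharing their end
    vertices 0, [p] and [q].  One chord joins [p-1] and [q+1]; the flag [c]
    tells how the other four neighbours of the ends are joined.  With [c] set,
    the zigzags play cyclically symmetric roles; otherwise the one between [p]
    and [q] is special. *)
Definition three_zigzags (c : bool) p q : sgraph V :=
  ring_graph [:: 0; p; q]
    ((p - 1, q + 1) :: if c then [:: (1, q - 1); (p + 1, -1)] else [:: (1, p + 1); (q - 1, -1)]).

Definition two_wf p := (4 <= p)%N && (p + 4 <= m.+2)%N.
(** The two zigzags that end at 0 have length at least 3.  The third one may
    be short, even without any triangle, when [c] is not set. *)
Definition three_wf (c : bool) p q :=
  [&& (4 <= p)%N, (p < q)%N, (q + 4 <= m.+2)%N & c ==> (p + 4 <= q)%N].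

(** An edge with [x < y], by cases: a step of the ring, possibly across 0, or
    a chord. *)
Definition nat_edge P M x y : Prop :=
  [\/ y = x.+1 :> nat, y = x.+2 :> nat /\ x + 1 \notin P,
      nat_of_ord x = 0%N /\ nat_of_ord y = m.+1 |
      [\/ (nat_of_ord x = 0%N /\ nat_of_ord y = m) /\ -1 \notin P,
          (nat_of_ord x = 1%N /\ nat_of_ord y = m.+1) /\ 0 \notin P,
          (x, y) \in M | (y, x) \in M]].

Lemma adj_nat_edge P M x y : (x < y)%N -> adj (ring_graph P M) x y -> nat_edge P M x y.
Proof.
have lx := ltn_ord x; have ly := ltn_ord y.
move=> xy /ring_adjP[] [E|E aP|h].
- constructor 1; move: xy; rewrite E ord_addS.
  by case: eqP.
- constructor 2; split=> //; move: xy.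
  have -> : y = x + 1 + 1 by rewrite E; ring.
  rewrite !ord_addS; case: (nat_of_ord x =P m.+1) => [->|x1] //=.
  by case: (x.+1 =P m.+1).
- by constructor 4; constructor 3.
- constructor 3; move: xy; rewrite E ord_addS.
  by case: eqP => [->|_] //; rewrite ltnNge leqnSn.
- constructor 4; move: xy.
  have -> : nat_of_ord x = nat_of_ord (y + 1 + 1) by rewrite E; congr nat_of_ord; ring.
  rewrite !ord_addS; case: (nat_of_ord y =P m.+1) => [h|h] /=.
    move=> _; constructor 2; split => //.
    by move: aP; rewrite (_ : y + 1 = 0) //; apply: ord_inj; rewrite ord_addS h eqxx.
  case: (y.+1 =P m.+1) => [h'|]; last by rewrite ltnNge ltnW.
  move=> _; constructor 1; split; first by split=> //; case: h'.
  by rewrite (_ : -1 = y + 1) //; apply: ord_inj; rewrite ord_N1 ord_addS; case: eqP.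
- by constructor 4; constructor 4.
Qed.

Lemma triangles_consecutive_nat P M : (1 < m)%N ->
  (forall x y z, (x < y)%N -> (y < z)%N ->
    adj (ring_graph P M) x y -> adj (ring_graph P M) y z -> adj (ring_graph P M) x z ->
    y = x.+1 :> nat /\ z = x.+2 :> nat /\ y \notin P \/
    (nat_of_ord x = 0%N /\ nat_of_ord y = m /\ nat_of_ord z = m.+1) /\ z \notin P \/
    (nat_of_ord x = 0%N /\ nat_of_ord y = 1%N /\ nat_of_ord z = m.+1) /\ x \notin P) ->
  triangles_consecutive P M.
Proof.
move=> m1 H; apply: sorted_triangles_consecutive => x y z /andP[xy yz] axy ayz axz.
have lz := ltn_ord z.
case: (H x y z xy yz axy ayz axz) => [[E1 [E2 yP]]|[[[E1 [E2 E3]] zP]|[[E1 [E2 E3]] xP]]].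
- exists y => //; have -> : x = y - 1 by apply: ord_inj; rewrite ord_subS E1.
  have -> : z = y + 1 by apply: ord_inj; rewrite ord_addS E1 E2; case: eqP => //; lia.
  by rewrite /consecutive inE eqxx.
- exists z => //; have -> : x = z + 1 by apply: ord_inj; rewrite ord_addS E1 E3 eqxx.
  have -> : y = z - 1 by apply: ord_inj; rewrite ord_subS E2 E3.
  by rewrite /consecutive !inE eqxx !orbT.
- exists x => //; have -> : y = x + 1 by apply: ord_inj; rewrite ord_addS E1 E2.
  have -> : z = x - 1 by apply: ord_inj; rewrite ord_subS E1 E3.
  by rewrite /consecutive !inE eqxx !orbT.
Qed.

Lemma circulant_triangles : (4 < m)%N -> triangles_consecutive ([::] : seq V) [::].
Proof.
move=> m4; apply: triangles_consecutive_nat; first by apply: leq_trans m4.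
move=> x y z xy yz axy ayz axz; rewrite !in_nil.
have xz := ltn_trans xy yz.
have H (a b : V) : (a < b)%N -> adj (ring_graph [::] [::]) a b ->
  nat_of_ord b = a.+1 \/ nat_of_ord b = a.+2 \/ nat_of_ord a = 0%N /\ nat_of_ord b = m.+1
    \/ nat_of_ord a = 0%N /\ nat_of_ord b = m \/ nat_of_ord a = 1%N /\ nat_of_ord b = m.+1.
  by move=> ab /(adj_nat_edge ab) [h|[h _]|h|[[h _]|[h _]|//|//]]; auto 6.
have lz := ltn_ord z.
have : y = x.+1 :> nat /\ z = x.+2 :> nat \/
    (nat_of_ord x = 0%N /\ nat_of_ord y = m /\ nat_of_ord z = m.+1) \/
    (nat_of_ord x = 0%N /\ nat_of_ord y = 1%N /\ nat_of_ord z = m.+1).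
  have := H _ _ xz axz; have := H _ _ yz ayz; have := H _ _ xy axy; move: m4 xy yz lz {xz axy ayz axz H}.
  by move: (nat_of_ord x) (nat_of_ord y) (nat_of_ord z); clear; lia.
by intuition.
Qed.

Lemma notin_nat x P y : y \in P -> x \notin P -> nat_of_ord x <> nat_of_ord y.
Proof. by move=> yP xP E; move: xP; rewrite (ord_inj E) yP. Qed.

Lemma two_edge_nat p (a b : V) : two_wf p -> (a < b)%N -> adj (two_zigzags p) a b ->
  nat_of_ord b = a.+1 \/ nat_of_ord b = a.+2 /\ a.+1 <> p :> nat \/
  nat_of_ord a = 0%N /\ nat_of_ord b = m.+1 \/ nat_of_ord a = 0%N /\ nat_of_ord b = m \/
  nat_of_ord a = 1%N /\ nat_of_ord b = p.+1 \/ nat_of_ord a = p.-1 /\ nat_of_ord b = m.+1.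
Proof.
move=> /andP[p4 pm] ab; have lb := ltn_ord b.
have Ep : nat_of_ord (p + 1) = p.+1 by rewrite ord_addS; case: eqP => //; lia.
have Em : nat_of_ord (p - 1) = p.-1 by rewrite ord_subS; case: eqP => //; lia.
case/(adj_nat_edge ab) => [h|[h /notin_nat h2]|h|[[h _]|[_ /negP[]]||]]; auto 6.
- right; left; split=> // E; apply: (h2 p); rewrite ?inE ?eqxx ?orbT //.
  by rewrite ord_addS; case: eqP => //; lia.
- rewrite !inE => /orP[]/eqP[-> ->]; rewrite ?Ep ?Em ?ord_1 ?ord_N1; clear; lia.
- move=> h; exfalso; move: h ab; rewrite !inE => /orP[]/eqP[-> ->].
    by rewrite Ep ord_1; lia.
  by rewrite Em ord_N1; lia.
Qed.

Lemma three_edge_nat c p q (a b : V) : three_wf c p q -> (a < b)%N -> adj (three_zigzags c p q) a b ->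
  three_edge c m p q a b.
Proof.
move=> /and4P[p4 pq qm cc] ab; have lb := ltn_ord b.
have Ep : nat_of_ord (p + 1) = p.+1 by rewrite ord_addS; case: eqP => //; lia.
have Em : nat_of_ord (p - 1) = p.-1 by rewrite ord_subS; case: eqP => //; lia.
have Fp : nat_of_ord (q + 1) = q.+1 by rewrite ord_addS; case: eqP => //; lia.
have Fm : nat_of_ord (q - 1) = q.-1 by rewrite ord_subS; case: eqP => //; lia.
rewrite /three_edge.
case/(adj_nat_edge ab) => [h|[h /notin_nat h2]|h|[[h _]|[_ /negP[]]||]]; auto 6.
- have Ea : nat_of_ord (a + 1) = a.+1 by rewrite ord_addS; case: eqP => //; lia.
  by right; left; split=> //; rewrite -Ea; split; apply: h2; rewrite !inE eqxx ?orbT.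
- case: c cc => cc; rewrite !inE => /or3P[]/eqP[-> ->]; rewrite ?Ep ?Em ?Fp ?Fm ?ord_1 ?ord_N1; clear; lia.
- move=> h; exfalso; move: h ab.
  by case: c cc => cc; rewrite !inE => /or3P[]/eqP[-> ->]; rewrite ?Ep ?Em ?Fp ?Fm ?ord_1 ?ord_N1; lia.
Qed.

Lemma two_triangles p : two_wf p -> triangles_consecutive [:: 0; p] [:: (1, p + 1); (p - 1, -1)].
Proof.
move=> wf; have /andP[p4 pm] := wf.
have m6 : (5 < m)%N by clear -p4 pm; lia.
apply: triangles_consecutive_nat => [|x y z xy yz axy ayz axz]; first by clear -m6; lia.
have xz := ltn_trans xy yz; have lz := ltn_ord z.
have : y = x.+1 :> nat /\ z = x.+2 :> nat /\ y <> p :> nat \/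
    (nat_of_ord x = 0%N /\ nat_of_ord y = m /\ nat_of_ord z = m.+1).
  have := two_edge_nat wf xz axz; have := two_edge_nat wf yz ayz; have := two_edge_nat wf xy axy.
  move: m6 xy yz lz p4 pm {xz axy ayz axz}.
  by move: (nat_of_ord x) (nat_of_ord y) (nat_of_ord z) (nat_of_ord p); clear; lia.
case=> [[E1 [E2 h]]|[E1 [E2 E3]]]; [left|right; left]; do 2?split=> //;
  rewrite !inE negb_or -!val_eqE /=; move: xy yz p4 pm; clear -h || clear -E3; lia.
Qed.

Lemma three_triangles c p q : three_wf c p q ->
  triangles_consecutive [:: 0; p; q]
    ((p - 1, q + 1) :: if c then [:: (1, q - 1); (p + 1, -1)] else [:: (1, p + 1); (q - 1, -1)]).
Proof.
move=> wf; have /and4P[p4 pq qm cc] := wf.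
have m6 : (6 < m)%N by clear -p4 pq qm; lia.
apply: triangles_consecutive_nat => [|x y z xy yz axy ayz axz]; first by clear -m6; lia.
have xz := ltn_trans xy yz; have lz := ltn_ord z.
have : y = x.+1 :> nat /\ z = x.+2 :> nat /\ y <> p :> nat /\ y <> q :> nat \/
    (nat_of_ord x = 0%N /\ nat_of_ord y = m /\ nat_of_ord z = m.+1).
  exact: three_edge_triangle p4 pq qm cc xy yz (three_edge_nat wf xy axy)
    (three_edge_nat wf yz ayz) (three_edge_nat wf xz axz).
case=> [[E1 [E2 h]]|[E1 [E2 E3]]]; [left|right; left]; do 2?split=> //;
  rewrite !inE !negb_or -!val_eqE /=; move: xy yz pq p4 qm; clear -h || clear -E3; lia.
Qed.

Lemma level_circulant : (4 < m)%N -> level circulant = 0.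
Proof. by move=> m4; rewrite (level_ring m4 _ (circulant_triangles m4)). Qed.

Lemma level_two p : two_wf p -> level (two_zigzags p) = 2.
Proof.
move=> wf; have /andP[p4 pm] := wf.
rewrite (level_ring _ _ (two_triangles wf)) //=; first by clear -p4 pm; lia.
by rewrite inE -val_eqE /=; clear -p4; lia.
Qed.

Lemma three_uniq c p q : three_wf c p q -> uniq [:: 0; p; q].
Proof.
case/and4P=> p4 pq _ _.
by rewrite /= !inE -!val_eqE /=; clear -p4 pq; lia.
Qed.

Lemma level_three c p q : three_wf c p q -> level (three_zigzags c p q) = 3.
Proof.
move=> wf; have /and4P[p4 pq qm _] := wf.
rewrite (level_ring _ (three_uniq wf) (three_triangles wf)) //.
by clear -p4 pq qm; lia.
Qed.

End Families.

(** * Dihedral maps and expansions of circulants *)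

Section Affine.
Variable m : nat.
Hypothesis m4 : (4 < m)%N.
Local Notation V := 'I_m.+2.
Implicit Types (x y z v w e p q r : V) (P : seq V) (M : seq (V * V)).

Lemma affine_bij e r : unit_step e -> bijective (fun x => e * x + r).
Proof.
move=> he; apply: inj_card_bij => // x y /addIr.
by case/orP: he => /eqP->; rewrite ?mul1r // !mulN1r => /oppr_inj.
Qed.

(** The dihedral symmetries of the ring transport breaks and chords. *)
Lemma affine_adj P M P' M' e r :
  unit_step e -> regular 4 (ring_graph P M) -> uniq P' -> (size M' <= size P')%N ->
  (forall x, x \notin P -> e * x + r \notin P') ->
  (forall x y, (x, y) \in M -> adj (ring_graph P' M') (e * x + r) (e * y + r)) ->
  forall x y, adj (ring_graph P' M') (e * x + r) (e * y + r) = adj (ring_graph P M) x y.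
Proof.
move=> he rG uP' sM' hP hM.
apply: (@ring_embedding_adj m _ _ P' M' (fun x => e * x + r)) => //.
- by rewrite card_ord.
- exact: bij_inj (affine_bij r he).
have key x y : ring_adj_spec P M x y -> adj (ring_graph P' M') (e * x + r) (e * y + r).
  case=> [->|-> xP|]; last exact: hM.
    rewrite (_ : e * (x + 1) + r = e * x + r + e); first exact: step_adj.
    ring.
  rewrite (_ : e * (x + 2%:R) + r = e * x + r + e *+ 2); last by ring.
  apply: step_adj2 => //; rewrite (_ : e * x + r + e = e * (x + 1) + r) ?hP //.
  ring.
by move=> x y /ring_adjP[] /key //; rewrite adj_sym.
Qed.

End Affine.

Section CircMoves.
Variable m : nat.
Hypothesis m4 : (4 < m)%N.
Local Notation V := 'I_m.+2.
Implicit Types (x y z v w e p q r : V).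
Hypothesis rG : regular 4 (circulant m).

(** No break, no chord: all conditions of [ring_insert] are void but the last. *)
Lemma circulant_insert v : isomorphic (dte (circulant m) (v - 1) v (v + 1) (v + 1 *+ 2)) (circulant m.+1).
Proof.
apply: ring_insert => //.
  by apply: (@insert_site m m4 [::] [::] 1) => //; exact: unit_step1.
by rewrite stretch_over2 adj_sym; apply: ring_adjSS.
Qed.

(** By rotation [v] may be taken to be 1.  The twisted path is then 0, 2, new
    vertex, 1, 3, which becomes a zigzag of three triangles from 0 to 4. *)
Lemma circulant_twist v :
  isomorphic (dte (circulant m) (v - 1) (v + 1) v (v + 1 *+ 2)) (two_zigzags (4%:R : 'I_m.+3)).
Proof.
have sh : forall x y, adj (circulant m) (1 * x + (1 - v)) (1 * y + (1 - v)) = adj (circulant m) x y.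
  exact: (affine_adj m4 (unit_step1 m)).
apply: isomorphic_trans (dte_iso _ _ _ _ (affine_bij (1 - v) (unit_step1 m)) sh) _.
rewrite (_ : 1 * (v - 1) + (1 - v) = 1 - 1); last by ring.
rewrite (_ : 1 * (v + 1) + (1 - v) = 1 + 1); last by ring.
rewrite (_ : 1 * v + (1 - v) = 1); last by ring.
rewrite (_ : 1 * (v + 1 *+ 2) + (1 - v) = 1 + 1 *+ 2); last by ring.
have E1 : nat_of_ord (1 : V) = 1%N by rewrite ord_1.
have E2 : nat_of_ord (1 + 1 : V) = 2%N by apply: ord_addS_val => //; lia.
have E3 : nat_of_ord (1 + 2%:R : V) = 3%N by rewrite -addrSS; apply: ord_addS_val => //; lia.
have E4 : nat_of_ord (1 + 3%:R : V) = 4%N by rewrite -(natrD _ 1 3) natr_ord //; lia.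
have F4 : nat_of_ord (4%:R : 'I_m.+3) = 4%N by rewrite natr_ord //; lia.
have F5 : nat_of_ord (4%:R + 1 : 'I_m.+3) = 5%N by apply: ord_addS_val => //; lia.
have F3 : nat_of_ord (4%:R - 1 : 'I_m.+3) = 3%N by apply: (ord_subS_val F4).
have EN : nat_of_ord (1 - 2%:R : V) = m.+1 by rewrite (_ : 1 - 2%:R = -1) ?ord_N1 //; ring.
apply: ring_twist => //.
- by rewrite /= inE ord_eqE F4.
- by rewrite !inE !ord_eqE F4 ord_gap E1.
- move=> x _; rewrite !inE !ord_eqE F4 ord_stretch E1 E3 subrr /=.
  by clear; lia.
- move=> _; rewrite adj_sym; apply: ring_adjM.
    by rewrite ord_eqE !ord_stretch E1 E2 EN; clear -m4; lia.
  by rewrite !inE !xpair_eqE !ord_eqE !ord_stretch E1 E2 EN F3 ord_N1; clear -m4; lia.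
- move=> _; apply: ring_adjM; first by rewrite ord_eqE !ord_stretch E1 E4; clear; lia.
  by rewrite !inE !xpair_eqE !ord_eqE !ord_stretch E1 E4 F5 ord_1.
Qed.

End CircMoves.

(** * Longer zigzags *)

Section TwoMoves.
Variable m : nat.
Local Notation V := 'I_m.+2.
Implicit Types (x y z v w e p q r : V).

Lemma two_size p : two_wf p -> (4 < m)%N.
Proof. by case/andP => p4 pm; clear -p4 pm; lia. Qed.

Lemma two_uniq p : two_wf p -> uniq [:: 0; p].
Proof. by case/andP => p4 _; rewrite /= inE ord_eqE /=; clear -p4; lia. Qed.

(** Insertion commutes with the formulas for breaks and chords, as these only
    involve neighbours of breaks, and neither [v] nor [v+1] is a break. *)
Lemma two_insert p v : two_wf p -> regular 4 (two_zigzags p) ->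
  v \notin [:: 0; p] -> v + 1 \notin [:: 0; p] ->
  two_wf (stretch v p) /\
  isomorphic (dte (two_zigzags p) (v - 1) v (v + 1) (v + 1 *+ 2)) (two_zigzags (stretch v p)).
Proof.
move=> wf rG vP v1P; have m4 := two_size wf.
have /andP[p4 pm] := wf.
have wf' : two_wf (stretch v p).
  by rewrite /two_wf ord_stretch; clear -p4 pm; case: ltnP; lia.
have [[v0 vp] [w0 wp]] : (v != 0 /\ v != p) /\ (v + 1 != 0 /\ v + 1 != p).
  by move: vP v1P; rewrite !inE !negb_or => /andP[-> ->] /andP[-> ->].
have mapP x : (stretch v x \in [:: 0; stretch v p]) = (x \in [:: 0; p]).
  by rewrite !inE -{1}(stretch0 v) !(inj_eq (@stretch_inj _ v)).
split=> //; apply: ring_insert => //.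
- by rewrite -(stretch0 v) (map_inj_uniq (@stretch_inj _ v) [:: 0; p]) two_uniq.
- by rewrite -(stretch0 v) !inE ![gap v == _]eq_sym !(negbTE (stretch_gap _ _)).
- by apply: insert_site => //; exact: unit_step1.
- by move=> x; rewrite mapP.
- move=> x y xyM _; apply: ring_adjM.
    rewrite (inj_eq (@stretch_inj _ v)); move: xyM; rewrite !inE => /orP[]/eqP[-> ->].
      by rewrite -subr_eq0 opprD addrCA subrr addr0 oppr_eq0 ord_eqE /=; clear -p4; lia.
    by rewrite -subr_eq0 opprK subrK ord_eqE /=; clear -p4; lia.
  move: xyM; rewrite !inE => /orP[]/eqP[-> ->].
    by rewrite stretch1 // stretchS 1?eq_sym // eqxx.
  by rewrite stretchN1 // stretchB1 1?eq_sym // eqxx orbT.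
- by rewrite stretch_over2 adj_sym; apply: ring_adjSS => //; rewrite stretch_gapr mapP.
Qed.

Lemma three_size c p q : three_wf c p q -> (4 < m)%N.
Proof. by case/and4P => p4 pq qm _; clear -p4 pq qm; lia. Qed.

Section ThreeInsert.
Variables (c : bool) (p q v : V).
Hypotheses (wf : three_wf c p q) (rG : regular 4 (three_zigzags c p q)).
Let P := [:: 0; p; q].
Let P' := [:: 0; stretch v p; stretch v q].

Lemma three_wf_stretch : v != p -> three_wf c (stretch v p) (stretch v q).
Proof.
rewrite ord_eqE => vp; have /and4P[p4 pq qm cc] := wf.
rewrite /three_wf !ord_stretch; move: cc; clear -p4 pq qm vp => cc.
by case: (ltnP v p); case: (ltnP v q); case: c cc => //=; lia.
Qed.

Lemma stretch_breaks x : (stretch v x \in P') = (x \in P).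
Proof. by rewrite !inE -{1}(stretch0 v) !(inj_eq (@stretch_inj _ v)). Qed.

Lemma stretch_uniq : uniq P'.
Proof. by rewrite /P' -(stretch0 v) (map_inj_uniq (@stretch_inj _ v) [:: 0; p; q]) (three_uniq wf). Qed.

Lemma gap_not_break : gap v \notin P'.
Proof. by rewrite /P' -(stretch0 v) !inE ![gap v == _]eq_sym !(negbTE (stretch_gap _ _)). Qed.

Lemma three_chord_neq x y :
  (x, y) \in ((p - 1, q + 1) :: if c then [:: (1, q - 1); (p + 1, -1)] else [:: (1, p + 1); (q - 1, -1)]) ->
  x != y.
Proof.
have /and4P[p4 pq qm cc] := wf.
have Ep : nat_of_ord (p + 1) = p.+1 by apply: ord_addS_val => //; clear -pq qm; lia.
have Em : nat_of_ord (p - 1) = p.-1 by apply: ord_subS_val => //; clear -p4; lia.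
have Fp : nat_of_ord (q + 1) = q.+1 by apply: ord_addS_val => //; clear -qm; lia.
have Fm : nat_of_ord (q - 1) = q.-1 by apply: ord_subS_val => //; clear -p4 pq; lia.
rewrite !inE ord_eqE; case: c cc => cc;
  rewrite !inE => /or3P[]/eqP[-> ->]; rewrite ?Ep ?Em ?Fp ?Fm ?ord_1 ?ord_N1; move: cc; clear -p4 pq qm; lia.
Qed.

Lemma three_insert : v \notin P -> v + 1 \notin P ->
  three_wf c (stretch v p) (stretch v q) /\
  isomorphic (dte (three_zigzags c p q) (v - 1) v (v + 1) (v + 1 *+ 2)) (three_zigzags c (stretch v p) (stretch v q)).
Proof.
move=> vP v1P; have m4 := three_size wf.
have [[v0 vp vq] [w0 wp wq]] : [/\ v != 0, v != p & v != q] /\ [/\ v + 1 != 0, v + 1 != p & v + 1 != q].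
  by move: vP v1P; rewrite !inE !negb_or => /and3P[-> -> ->] /and3P[-> -> ->].
split; first exact: three_wf_stretch.
apply: ring_insert => //.
- exact: stretch_uniq.
- by case: (c).
- exact: gap_not_break.
- by apply: insert_site => //; exact: unit_step1.
- by move=> x; rewrite stretch_breaks.
- move=> x y xyM _; apply: ring_adjM; first by rewrite (inj_eq (@stretch_inj _ v)) three_chord_neq.
  by move: xyM; case: (c); rewrite !inE => /or3P[]/eqP[-> ->];
    rewrite ?stretch1 // ?stretchN1 // ?stretchS ?stretchB1 // 1?eq_sym // ?eqxx ?orbT.
- by rewrite stretch_over2 adj_sym; apply: ring_adjSS => //; rewrite stretch_gapr stretch_breaks.
Qed.

End ThreeInsert.

(** The zigzag from [p] to [q] is the single triangle with centre [v]; both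
    chords [1, p+1] and [q-1, -1] end at [v], and the second one is given to
    the new vertex. *)
Lemma three_short p q v : q = p + 2%:R ->
  three_wf false p q -> regular 4 (three_zigzags false p q) -> v = p + 1 ->
  three_wf false (stretch v p) (stretch v q) /\
  isomorphic (dte (three_zigzags false p q) (v - 1) v (v + 1) (-1)) (three_zigzags false (stretch v p) (stretch v q)).
Proof.
move=> qE wf rG vE; have m4 := three_size wf.
have /and4P[p4 pq qm _] := wf.
have vq : v + 1 = q by rewrite vE addrSS qE.
have vp : v - 1 = p by rewrite vE addrK.
have Ev : nat_of_ord v = p.+1 by rewrite vE; apply: ord_addS_val => //; clear -pq qm; lia.
have Eq : nat_of_ord q = p.+2 by rewrite -vq; apply: ord_addS_val => //; clear -pq qm Ev; lia.
have v0 : v != 0 by rewrite ord_eqE Ev.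
have pv : p != v by rewrite ord_eqE Ev; clear; lia.
have qv : q != v by rewrite ord_eqE Ev Eq; clear; lia.
have q0 : q != 0 by rewrite ord_eqE Eq.
have Em : nat_of_ord (p - 1) = p.-1 by apply: ord_subS_val => //; clear -p4; lia.
have vP : v \notin [:: 0; p; q] by rewrite !inE !negb_or v0 eq_sym pv eq_sym qv.
split; first by apply: three_wf_stretch => //; rewrite eq_sym.
apply: ring_insert => //.
- exact: stretch_uniq wf.
- exact: gap_not_break.
- have [a1 a2 a3] := @ring_triangle _ [:: 0; p; q] [:: (p - 1, q + 1); (1, p + 1); (q - 1, -1)] v (ltnW (ltnW (ltnW (ltnW m4)))) vP.
  rewrite /dte_site a1 a2 a3 /= vp vq !inE !negb_or pv /=.
  rewrite [v == q]eq_sym qv !ord_eqE Eq Ev ord_N1 /=.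
  rewrite ring_adjM ?ord_eqE ?Ev ?ord_N1 //; last by rewrite -vq addrK !inE eqxx !orbT.
    by rewrite andbT; move: pq qm; rewrite Eq; clear; lia.
  by move: pq qm; rewrite Eq; clear; lia.
- by rewrite vq !inE eqxx !orbT.
- by move=> x; rewrite stretch_breaks.
- move=> x y xyM h; apply: ring_adjM; first by rewrite (inj_eq (@stretch_inj _ v)) (three_chord_neq wf).
  move: xyM h; rewrite !inE => /or3P[]/eqP[-> ->] h.
  + rewrite stretchS // stretchB1 ?eqxx //.
    by rewrite vq ord_eqE Eq; clear; lia.
  + by rewrite stretch1 // stretchS // eqxx orbT.
  + by move: h; rewrite -vq addrK eqxx.
- rewrite stretchN1 ?vq //; have -> : gap v = stretch v q - 1 by rewrite -vq -stretch_gapr addrK.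
  rewrite adj_sym; apply: ring_adjM; last by rewrite !inE eqxx !orbT.
  have : nat_of_ord (stretch v q) = q.+1 by rewrite ord_stretch Ev Eq; clear; lia.
  move/ord_subS_val => /(_ isT) E; rewrite ord_eqE E ord_N1; move: pq qm; rewrite Eq; clear; lia.
Qed.

(** Here both [v-1 = p] and [v+2 = q] are breaks already, so the level stays
    3.  The two inner vertices of the zigzag trade their chords, which turns
    the pattern [c = false] into [c = true]. *)
Lemma three_twist p q v : q = p + 3%:R ->
  three_wf false p q -> regular 4 (three_zigzags false p q) -> v = p + 1 ->
  three_wf true (stretch v p) (stretch v q) /\
  isomorphic (dte (three_zigzags false p q) (v - 1) (v + 1) v (v + 1 *+ 2))
    (three_zigzags true (stretch v p) (stretch v q)).
Proof.
move=> qE wf rG vE; have m4 := three_size wf.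
have /and4P[p4 pq qm _] := wf.
have vq : v + 2%:R = q by rewrite vE qE; ring.
have vq' : v + 1 + 1 = q by rewrite addrSS.
have vp : v - 1 = p by rewrite vE addrK.
have Ev : nat_of_ord v = p.+1 by rewrite vE; apply: ord_addS_val => //; clear -pq qm; lia.
have Ew : nat_of_ord (v + 1) = p.+2 by apply: ord_addS_val => //; clear -pq qm Ev; lia.
have Eq : nat_of_ord q = p.+3 by rewrite -vq'; apply: ord_addS_val => //; clear -pq qm Ev; lia.
have v0 : v != 0 by rewrite ord_eqE Ev.
have w0 : v + 1 != 0 by rewrite ord_eqE Ew.
have pv : p != v by rewrite ord_eqE Ev; clear; lia.
have qv : q != v by rewrite ord_eqE Ev Eq; clear; lia.
have pw : p != v + 1 by rewrite ord_eqE Ew; clear; lia.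
have qw : q != v + 1 by rewrite ord_eqE Ew Eq; clear; lia.
have Em : nat_of_ord (p - 1) = p.-1 by apply: ord_subS_val => //; clear -p4; lia.
have Ep : nat_of_ord (q + 1) = q.+1 by apply: ord_addS_val => //; clear -qm; lia.
have vP : v \notin [:: 0; p; q] by rewrite !inE !negb_or v0 eq_sym pv eq_sym qv.
have wP : v + 1 \notin [:: 0; p; q] by rewrite !inE !negb_or w0 eq_sym pw eq_sym qw.
have wf' : three_wf true (stretch v p) (stretch v q).
  rewrite /three_wf !ord_stretch Ev Eq; move: pq qm; rewrite Eq; clear -p4; lia.
have flipD x : x != v -> x != v + 1 -> flip v x = stretch v x.
  by move=> h1 h2; rewrite /flip tpermD // eq_sym.
have fl : flip v v = stretch v (v + 1) by rewrite /flip tpermL.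
have fr : flip v (v + 1) = stretch v v by rewrite /flip tpermR.
split=> //; apply: ring_twist => //.
- exact: stretch_uniq wf.
- exact: gap_not_break.
- by move=> x xP _ _; rewrite stretch_breaks.
- move=> x y xyM; apply: ring_adjM.
    by rewrite (inj_eq (inj_comp (@stretch_inj _ v) (@perm_inj _ _))) (three_chord_neq wf).
  move: xyM; rewrite !inE => /or3P[]/eqP[-> ->].
  + rewrite !flipD ?stretchS ?stretchB1 ?eqxx // ord_eqE ?Em ?Ep ?Ev ?Ew ?Eq; clear -p4; lia.
  + rewrite -vE fl flipD ?stretch1 //.
    * have -> : stretch v q - 1 = stretch v (v + 1) by rewrite -vq' stretchS ?addrK // ord_eqE Ev Ew; clear; lia.
      by rewrite eqxx orbT.
    * by rewrite ord_eqE Ev ord_1; clear -p4; lia.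
    * by rewrite ord_eqE Ew ord_1; clear -p4; lia.
  + rewrite -vq' addrK fr flipD ?stretchN1 //.
    * have -> : stretch v v = stretch v p + 1 by rewrite -stretchS // -vE.
      by rewrite eqxx !orbT.
    * by rewrite ord_eqE Ev ord_N1; move: qm; rewrite Eq; clear; lia.
    * by rewrite ord_eqE Ew ord_N1; move: qm; rewrite Eq; clear; lia.
- by rewrite vp !inE eqxx orbT.
- by rewrite vq !inE eqxx !orbT.
Qed.

End TwoMoves.

(** * From two zigzags to three *)

Section TwoTwist.
Variable m : nat.
Local Notation V := 'I_m.+2.
Implicit Types (x y z v w e p q r : V).

Lemma two_chord_neq p x y : two_wf p -> (x, y) \in [:: (1, p + 1); (p - 1, -1)] -> x != y.
Proof.
move=> /andP[p4 pm].
have Ep : nat_of_ord (p + 1) = p.+1 by apply: ord_addS_val => //; clear -pm; lia.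
have Em : nat_of_ord (p - 1) = p.-1 by apply: ord_subS_val => //; clear -p4; lia.
rewrite ord_eqE !inE => /orP[]/eqP[-> ->]; rewrite ?Ep ?Em ?ord_1 ?ord_N1; clear -p4 pm; lia.
Qed.

(** The zigzag from 0 to [p] is cut into a zigzag of three triangles from 0 to
    4 and one with [p-4] triangles, possibly none. *)
Lemma two_twist_start p : two_wf p -> regular 4 (two_zigzags p) ->
  three_wf false (4%:R : 'I_m.+3) (stretch 1 p) /\
  isomorphic (dte (two_zigzags p) 0 (1 + 1) 1 (1 + 1 *+ 2)) (three_zigzags false (4%:R : 'I_m.+3) (stretch 1 p)).
Proof.
move=> wf rG; have m4 := two_size wf; have /andP[p4 pm] := wf.
have E1 : nat_of_ord (1 : V) = 1%N by rewrite ord_1.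
have E2 : nat_of_ord (1 + 1 : V) = 2%N by apply: ord_addS_val => //; lia.
have E3 : nat_of_ord (1 + 2%:R : V) = 3%N by rewrite -addrSS; apply: ord_addS_val => //; lia.
have E4 : nat_of_ord (1 + 3%:R : V) = 4%N by rewrite -(natrD _ 1 3) natr_ord //; lia.
have F4 : nat_of_ord (4%:R : 'I_m.+3) = 4%N by rewrite natr_ord //; lia.
have F5 : nat_of_ord (4%:R + 1 : 'I_m.+3) = 5%N by apply: ord_addS_val => //; lia.
have F3 : nat_of_ord (4%:R - 1 : 'I_m.+3) = 3%N by apply: (ord_subS_val F4).
have Ep : nat_of_ord (p + 1) = p.+1 by apply: ord_addS_val => //; clear -pm; lia.
have Em : nat_of_ord (p - 1) = p.-1 by apply: ord_subS_val => //; clear -p4; lia.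
have Sp : nat_of_ord (stretch 1 p) = p.+1 by rewrite ord_stretch E1; clear -p4; lia.
have wf' : three_wf false (4%:R : 'I_m.+3) (stretch 1 p).
  by rewrite /three_wf Sp F4; clear -p4 pm; lia.
have flipD x : x != 1 -> x != 1 + 1 -> flip 1 x = stretch 1 x.
  by move=> h1 h2; rewrite /flip tpermD // eq_sym.
have fl : flip 1 (1 : V) = stretch 1 (1 + 1) by rewrite /flip tpermL.
have S2 : stretch 1 (1 + 1 : V) = 4%:R - 1.
  by apply: ord_inj; rewrite ord_stretch E1 E2 F3.
have S4 : stretch 1 (1 + 3%:R : V) = 4%:R + 1.
  by apply: ord_inj; rewrite ord_stretch E1 E4 F5.
have S1 : stretch 1 (1 : V) = 1 by apply: ord_inj; rewrite ord_stretch E1 ord_1.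
split=> //; rewrite -[X in dte _ X](subrr 1).
apply: ring_twist => //.
- exact: three_uniq wf'.
- by rewrite !inE !ord_eqE F4 Sp ord_gap E1 /=; clear -p4; lia.
- by rewrite !inE !ord_eqE E1 /=; clear -p4; lia.
- by rewrite !inE !ord_eqE E2 /=; clear -p4; lia.
- move=> x; rewrite !inE !ord_eqE F4 Sp E3 subrr ord_stretch E1 /=.
  by clear -p4; lia.
- move=> x y xyM; apply: ring_adjM.
    by rewrite (inj_eq (inj_comp (@stretch_inj _ 1) (@perm_inj _ _))) (two_chord_neq wf).
  move: xyM; rewrite !inE => /orP[]/eqP[-> ->].
  + rewrite fl flipD ?S2 ?stretchS ?eqxx // ord_eqE ?Ep ?E1 ?E2 /=; clear -p4; lia.
  + rewrite !flipD ?stretchN1 ?stretchB1 ?eqxx ?orbT // ord_eqE ?Em ?E1 ?E2 ?ord_N1 /=; clear -p4 m4; lia.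
- by rewrite subrr inE eqxx.
- move=> _; apply: ring_adjM; first by rewrite (inj_eq (@stretch_inj _ 1)) ord_eqE E1 E4.
  by rewrite S1 S4 !inE eqxx orbT.
Qed.

Lemma two_wf_opp p : two_wf p -> two_wf (- p).
Proof.
case/andP=> p4 pm; rewrite /two_wf ord_opp; first by clear -p4 pm; lia.
by rewrite ord_eqE -lt0n (leq_trans _ p4).
Qed.

(** The condition on breaks in [affine_adj], through the inverse map. *)
Lemma break_affine e r (P P' : seq V) : unit_step e ->
  (forall y, y \in P' -> e * (y - r) \in P) -> forall x, x \notin P -> e * x + r \notin P'.
Proof.
move=> he h x; apply: contra => /h; rewrite addrK mulrA.
by case/orP: he => /eqP->; rewrite ?mul1r // mulrNN !mul1r.
Qed.

Lemma two_shift p : two_wf p -> regular 4 (two_zigzags p) ->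
  forall x y, adj (two_zigzags (- p)) (1 * x - p) (1 * y - p) = adj (two_zigzags p) x y.
Proof.
move=> wf rG; have m4 := two_size wf.
apply: (affine_adj m4 (unit_step1 m) rG (two_uniq (two_wf_opp wf))) => //.
  apply: break_affine (unit_step1 m) _ => y; rewrite opprK mul1r !inE => /orP[]/eqP->.
    by rewrite add0r eqxx orbT.
  by rewrite addNr eqxx.
move=> x y; rewrite !inE => /orP[]/eqP[-> ->].
  rewrite adj_sym; apply: ring_adjM.
    rewrite !mul1r (inj_eq (addIr _)) eq_sym; apply: (two_chord_neq wf).
    by rewrite inE eqxx.
  rewrite !mul1r [p + 1]addrC addrK [1 - p]addrC inE.
  by rewrite eqxx.
rewrite adj_sym; apply: ring_adjM.
  rewrite !mul1r (inj_eq (addIr _)) eq_sym; apply: (two_chord_neq wf).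
  by rewrite !inE eqxx orbT.
by rewrite !mul1r [p - 1]addrC addrK [-1 - p]addrC !inE eqxx orbT.
Qed.

Lemma two_reflect p : two_wf p -> regular 4 (two_zigzags p) ->
  forall x y, adj (two_zigzags (- p)) (-1 * x + 0) (-1 * y + 0) = adj (two_zigzags p) x y.
Proof.
move=> wf rG; have m4 := two_size wf.
apply: (affine_adj m4 (unit_stepN1 m) rG (two_uniq (two_wf_opp wf))) => //.
  apply: break_affine (unit_stepN1 m) _ => y; rewrite subr0 mulN1r !inE => /orP[]/eqP->.
    by rewrite oppr0 eqxx.
  by rewrite opprK eqxx orbT.
move=> x y xyM; have xy := two_chord_neq wf xyM.
rewrite adj_sym; apply: ring_adjM.
  by rewrite !addr0 !mulN1r (inj_eq oppr_inj) eq_sym.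
move: xyM; rewrite !addr0 !mulN1r !inE => /orP[]/eqP[-> ->].
  by rewrite opprD eqxx orbT.
by rewrite opprK opprB addrC eqxx.
Qed.

Lemma two_flip p : two_wf p -> regular 4 (two_zigzags p) ->
  forall x y, adj (two_zigzags p) (-1 * x + p) (-1 * y + p) = adj (two_zigzags p) x y.
Proof.
move=> wf rG; have m4 := two_size wf.
apply: (affine_adj m4 (unit_stepN1 m) rG (two_uniq wf)) => //.
  apply: break_affine (unit_stepN1 m) _ => y; rewrite mulN1r opprB !inE => /orP[]/eqP->.
    by rewrite subr0 eqxx orbT.
  by rewrite subrr eqxx.
move=> x y xyM; have xy := two_chord_neq wf xyM.
have xy' : -1 * x + p != -1 * y + p.
  by rewrite !mulN1r (inj_eq (addIr _)) (inj_eq oppr_inj).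
apply: ring_adjM => //.
move: xyM; rewrite !mulN1r !inE => /orP[]/eqP[-> ->].
  by rewrite opprD addrAC addNr add0r [-1 + p]addrC eqxx orbT.
by rewrite opprK opprB subrK [1 + p]addrC eqxx.
Qed.

(** The twisted path starts or ends at one of the two breaks, and the rotation
    and the reflections of the graph move it to the path 0, 1, 2, 3. *)
Lemma two_twist p v : two_wf p -> regular 4 (two_zigzags p) ->
  v \notin [:: 0; p] -> v + 1 \notin [:: 0; p] ->
  (v - 1 \in [:: 0; p]) || (v + 2%:R \in [:: 0; p]) ->
  exists p' q' : 'I_m.+3, three_wf false p' q' /\
    isomorphic (dte (two_zigzags p) (v - 1) (v + 1) v (v + 1 *+ 2)) (three_zigzags false p' q').
Proof.
move=> wf rG vP v1P.
have wfN := two_wf_opp wf.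
have sh := two_shift wf rG; have re := two_reflect wf rG; have fl := two_flip wf rG.
have rGN : regular 4 (two_zigzags (- p)).
  by apply: regular_iso rG; exists (fun x => 1 * x - p); first exact: affine_bij (unit_step1 m).
have [w1 i1] := two_twist_start wf rG; have [w2 i2] := two_twist_start wfN rGN.
rewrite !inE -!orbA => /or4P[]/eqP vE.
- exists 4%:R, (stretch 1 p); split => //.
  by move: i1; rewrite (_ : v = 1) ?subrr //; apply/eqP; rewrite -subr_eq0 vE.
- exists 4%:R, (stretch 1 (- p)); split => //.
  have vE' : v = p + 1 by rewrite -vE subrK.
  apply: isomorphic_trans (dte_iso _ _ _ _ (affine_bij (- p) (unit_step1 m)) sh) _.
  have -> : 1 * (v - 1) - p = 0 by rewrite vE; ring.
  have -> : 1 * (v + 1) - p = 1 + 1 by rewrite vE'; ring.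
  have -> : 1 * v - p = 1 by rewrite vE'; ring.
  by have -> : 1 * (v + 1 *+ 2) - p = 1 + 1 *+ 2 by rewrite vE'; ring.
- exists 4%:R, (stretch 1 (- p)); split => //.
  apply: isomorphic_trans (dte_iso _ _ _ _ (affine_bij 0 (unit_stepN1 m)) re) _.
  apply: isomorphic_trans (dte_rev _ _ _ _ _) _.
  have vE' : v = - 2%:R by rewrite -[v]addr0 -(subrr 2%:R) addrA vE add0r.
  have -> : -1 * (v + 1 *+ 2) + 0 = 0 :> V by rewrite vE'; ring.
  have -> : -1 * v + 0 = 1 + 1 :> V by rewrite vE'; ring.
  have -> : -1 * (v + 1) + 0 = 1 :> V by rewrite vE'; ring.
  by have -> : -1 * (v - 1) + 0 = 1 + 1 *+ 2 :> V by rewrite vE'; ring.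
- exists 4%:R, (stretch 1 p); split => //.
  apply: isomorphic_trans (dte_iso _ _ _ _ (affine_bij p (unit_stepN1 m)) fl) _.
  apply: isomorphic_trans (dte_rev _ _ _ _ _) _.
  have vE' : v = p - 2%:R by rewrite -vE addrK.
  have -> : -1 * (v + 1 *+ 2) + p = 0 :> V by rewrite vE'; ring.
  have -> : -1 * v + p = 1 + 1 :> V by rewrite vE'; ring.
  have -> : -1 * (v + 1) + p = 1 :> V by rewrite vE'; ring.
  by have -> : -1 * (v - 1) + p = 1 + 1 *+ 2 :> V by rewrite vE'; ring.
Qed.

End TwoTwist.

(** * Five and six vertices *)

Lemma circulant_insert_start m : regular 4 (circulant m) ->
  dte_site (circulant m) (1 - 1) 1 (1 + 1) (1 + 1 *+ 2) ->
  isomorphic (dte (circulant m) (1 - 1) 1 (1 + 1) (1 + 1 *+ 2)) (circulant m.+1).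
Proof.
move=> rG site; apply: ring_insert => //.
by rewrite stretch_over2 adj_sym; apply: ring_adjSS.
Qed.

Lemma insert_moved_to_start m (v1 v2 v3 v4 : 'I_m.+2) (f : 'I_m.+2 -> 'I_m.+2) :
  regular 4 (circulant m) -> dte_site (circulant m) v1 v2 v3 v4 -> injective f ->
  (forall x y, adj (circulant m) (f x) (f y) = adj (circulant m) x y) ->
  f v1 = 1 - 1 -> f v2 = 1 -> f v3 = 1 + 1 -> f v4 = 1 + 1 *+ 2 ->
  isomorphic (dte (circulant m) v1 v2 v3 v4) (circulant m.+1).
Proof.
move=> rG site f_inj fP E1 E2 E3 E4.
have bf : bijective f by exact: inj_card_bij.
apply: isomorphic_trans (dte_iso _ _ _ _ bf fP) _.
rewrite E1 E2 E3 E4; apply: circulant_insert_start => //.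
by rewrite -E1 -E4 -E3 -E2 (site_iso _ _ _ _ bf fP).
Qed.

Lemma adj_circulant5 (x y : 'I_5) : adj (circulant 3) x y = (x != y).
Proof.
rewrite adj_sgraph_of; case xy: (x == y) => //=; move: xy; rewrite !ord_eqE !in_nil.
by case: x => [[|[|[|[|[|//]]]]] hx]; case: y => [[|[|[|[|[|//]]]]] hy].
Qed.

(** The octahedron: the only vertex not adjacent to [x] is its antipode. *)
Lemma adj_circulant6 (x y : 'I_6) : adj (circulant 4) x y = (x != y) && (y != x + 3%:R).
Proof.
rewrite adj_sgraph_of; case xy: (x == y) => //=; move: xy; rewrite !ord_eqE !in_nil.
by case: x => [[|[|[|[|[|[|//]]]]]] hx]; case: y => [[|[|[|[|[|[|//]]]]]] hy].
Qed.

(** Every permutation is an automorphism of the complete graph. *)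
Lemma dte_circulant5 v1 v2 v3 v4 : regular 4 (circulant 3) -> dte_site (circulant 3) v1 v2 v3 v4 ->
  isomorphic (dte (circulant 3) v1 v2 v3 v4) (circulant 4).
Proof.
move=> rG site; have us : uniq [:: v1; v2; v3; v4] by case/and5P: site.
have [_ [n12 n13 n14 [n23 n24 n34]]] := siteP site.
pose s := [:: v1; v2; v3; v4]; pose f x : 'I_5 := inord (index x s).
have fE x : f x = index x s :> nat.
  by rewrite inordK // ltnS -[4%N]/(size s) index_size.
have f_inj : injective f.
  move=> x y /(congr1 (@nat_of_ord _)); rewrite !fE => E.
  have [xs|xs] := boolP (x \in s).
    have ys : y \in s by rewrite -index_mem -E index_mem.
    by rewrite -(nth_index x xs) E nth_index.
  have ys : y \notin s by rewrite -index_mem -E index_mem.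
  apply/eqP/negPn/negP => xy.
  have u : uniq [:: x, y & s] by apply/and3P; split=> //; rewrite in_cons negb_or xy.
  by have := max_card (mem [:: x, y & s]); rewrite (card_uniqP u) card_ord.
apply: (insert_moved_to_start (f := f)) => //.
- by move=> x y; rewrite !adj_circulant5 (inj_eq f_inj).
- by apply: ord_inj; rewrite fE /= eqxx.
- by apply: ord_inj; rewrite fE /= eqxx (negbTE n12).
- by apply: ord_inj; rewrite fE /= eqxx (negbTE n13) (negbTE n23).
- by apply: ord_inj; rewrite fE /= eqxx (negbTE n14) (negbTE n24) (negbTE n34).
Qed.

(** A triangle of the octahedron and its antipodal triangle exhaust the
    vertices, so an automorphism takes any triangle to any other, with any
    order of the vertices.  By [dte_swap] the fourth vertex may be taken
    antipodal to the first. *)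
Lemma dte_circulant6 v1 v2 v3 v4 : regular 4 (circulant 4) -> dte_site (circulant 4) v1 v2 v3 v4 ->
  isomorphic (dte (circulant 4) v1 v2 v3 v4) (circulant 5).
Proof.
move=> rG site.
have [[a12 a23 a13 a24] [n12 n13 n14 [n23 n24 n34]]] := siteP site.
have h33 (x : 'I_6) : x + 3%:R + 3%:R = x.
  by rewrite -addrA (_ : 3%:R + 3%:R = 0 :> 'I_6) ?addr0 //; apply: ord_inj.
have s3 (x y : 'I_6) : (x + 3%:R == y) = (x == y + 3%:R).
  by apply/eqP/eqP => [<-|->]; rewrite h33.
have h0 (x : 'I_6) : x != x + 3%:R by rewrite eq_sym addr_neq.
have [b12 b23 b13] : [/\ v2 != v1 + 3%:R, v3 != v2 + 3%:R & v3 != v1 + 3%:R].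
  by move: a12 a23 a13; rewrite !adj_circulant6 => /andP[_ ->] /andP[_ ->] /andP[_ ->].
have site' : dte_site (circulant 4) v1 v2 v3 (v1 + 3%:R).
  rewrite /dte_site a12 a23 a13 /= !inE !negb_or n12 n13 n23 h0 b12 b13 /=.
  by rewrite adj_circulant6 b12 (inj_eq (addIr _)) n12.
apply: isomorphic_trans (dte_swap rG site site') _.
pose s := [:: v1; v2; v3; v1 + 3%:R; v2 + 3%:R; v3 + 3%:R].
have us : uniq s.
  rewrite /= !inE !negb_or !(inj_eq (addIr _)) n12 n13 n23 !h0 b12 b23 b13 /=.
  by rewrite ![v1 == _ + _]eq_sym ![v2 == v3 + _]eq_sym !s3 b12 b13 b23.
have cov x : x \in s.
  apply: contraTT isT => xs; have u : uniq (x :: s) by apply/andP.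
  by have := max_card (mem (x :: s)); rewrite (card_uniqP u) card_ord.
pose f x : 'I_6 := inord (index x s).
have fE x : f x = index x s :> nat by rewrite inordK // -[6%N]/(size s) index_mem cov.
have f_inj : injective f.
  move=> x y /(congr1 (@nat_of_ord _)); rewrite !fE => E.
  by rewrite -(nth_index x (cov x)) E nth_index.
have fnth k : (k < 6)%N -> f (nth 0 s k) = k :> nat.
  by move=> k6; rewrite fE index_uniq.
have f3 x : f (x + 3%:R) = f x + 3%:R.
  have := cov x; rewrite !inE.
  move=> /or4P[|||/or3P[]] /eqP->; rewrite ?h33; apply: ord_inj.
  - by rewrite (fnth 3%N) // (_ : f v1 = 0) //; apply: ord_inj; rewrite (fnth 0%N).
  - by rewrite (fnth 4%N) // (_ : f v2 = 1) //; apply: ord_inj; rewrite (fnth 1%N).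
  - by rewrite (fnth 5%N) // (_ : f v3 = 2%:R) //; apply: ord_inj; rewrite (fnth 2%N).
  - by rewrite (fnth 0%N) // (_ : f _ = 3%:R) //; apply: ord_inj; rewrite (fnth 3%N).
  - by rewrite (fnth 1%N) // (_ : f _ = 4%:R) //; apply: ord_inj; rewrite (fnth 4%N).
  - by rewrite (fnth 2%N) // (_ : f _ = 5%:R) //; apply: ord_inj; rewrite (fnth 5%N).
apply: (insert_moved_to_start (f := f)) => //.
- by move=> x y; rewrite !adj_circulant6 -f3 !(inj_eq f_inj).
- by apply: ord_inj; rewrite (fnth 0%N).
- by apply: ord_inj; rewrite (fnth 1%N).
- by apply: ord_inj; rewrite (fnth 2%N).
- by apply: ord_inj; rewrite (fnth 3%N).
Qed.

(** * Expansions of low level *)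

(** The invariant of the descendants.  The circulants include [K5] and the
    octahedron. *)
Definition low_level (V : finType) (G : sgraph V) : Prop :=
  [\/ exists2 m, (2 < m)%N & isomorphic G (circulant m),
      exists m, exists2 p : 'I_m.+2, two_wf p & isomorphic G (two_zigzags p),
      exists m c, exists p q : 'I_m.+2, three_wf c p q /\ isomorphic G (three_zigzags c p q)
    | 4 <= level G].

Lemma low_level_iso (V W : finType) (G : sgraph V) (H : sgraph W) :
  isomorphic G H -> low_level H -> low_level G.
Proof.
move=> GH [[m m2 h]|[m [p wf h]]|[m [c [p [q [wf h]]]]]|h].
- by constructor 1; exists m => //; apply: isomorphic_trans GH h.
- by constructor 2; exists m, p => //; apply: isomorphic_trans GH h.
- by constructor 3; exists m, c, p, q; split => //; apply: isomorphic_trans GH h.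
- by constructor 4; rewrite (level_iso GH).
Qed.

Lemma level_dte_mono (V : finType) (G : sgraph V) v1 v2 v3 v4 :
  dte_site G v1 v2 v3 v4 -> level G <= level (dte G v1 v2 v3 v4).
Proof. by move=> site; have := @level_dte_ge _ _ _ _ _ _ site [::] [::]; rewrite addr0; apply. Qed.

Section Steps.
Variable m : nat.
Local Notation V := 'I_m.+2.
Implicit Types (x y z v w e p q r : V).

Lemma circulant_low_level v1 v2 v3 v4 : (2 < m)%N -> regular 4 (circulant m) ->
  dte_site (circulant m) v1 v2 v3 v4 -> low_level (dte (circulant m) v1 v2 v3 v4).
Proof.
move=> m2 rG site; have [m5|m4] := ltnP m 5; last first.
  case: (ring_siteP m4 rG (circulant_triangles m4) site) => [v _ _ h|v _ //|v _ _ h|//].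
  - constructor 1; exists m.+1; first by lia.
    by apply: isomorphic_trans h _; exact: circulant_insert.
  - constructor 2; exists m.+1, 4%:R; last by apply: isomorphic_trans h _; exact: circulant_twist.
    by rewrite /two_wf natr_ord; clear -m4; lia.
have [m3|m4] : m = 3%N \/ m = 4%N by clear -m2 m5; lia.
  constructor 1; exists 4%N => //; clear m2 m5; subst m; exact: dte_circulant5.
constructor 1; exists 5%N => //; clear m2 m5; subst m; exact: dte_circulant6.
Qed.

Lemma step_sep x y e k (P : seq V) : (forall x y j, (0 < j < 4)%N -> x \in P -> y \in P -> x != y + j%:R) ->
  unit_step e -> (0 < k < 4)%N -> x \in P -> y \in P -> x != y + e *+ k.
Proof.
move=> h he k4 xP yP; case/orP: he => /eqP->; first exact: h.
apply/negP => /eqP E; have := h y x k k4 yP xP.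
by rewrite E mulNrn subrK eqxx.
Qed.

Lemma two_sep p x y k : two_wf p -> (0 < k < 4)%N -> x \in [:: 0; p] -> y \in [:: 0; p] ->
  x != y + k%:R.
Proof.
case/andP=> p4 pm /andP[k0 k4].
have Ek : nat_of_ord (k%:R : V) = k by apply: natr_ord; clear -p4 pm k4; lia.
have Ep : nat_of_ord (p + k%:R) = (p + k)%N.
  have -> : nat_of_ord (p + k%:R) = ((p + nat_of_ord (k%:R : V)) %% m.+2)%N by [].
  by rewrite Ek modn_small //; clear -p4 pm k4; lia.
have s z : z != z + k%:R by rewrite eq_sym addr_neq // k0; clear -p4 pm k4; lia.
rewrite !inE => /orP[]/eqP-> /orP[]/eqP->; rewrite ?s // ord_eqE ?Ep ?add0r ?Ek /=;
  clear -p4 k4 k0; lia.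
Qed.

(** Two breaks are too far apart for a twist to create fewer than one new
    break; it creates just one at the ends of the zigzags, and then the result
    has level 3. *)
Lemma two_low_level p v1 v2 v3 v4 : two_wf p -> regular 4 (two_zigzags p) ->
  dte_site (two_zigzags p) v1 v2 v3 v4 -> low_level (dte (two_zigzags p) v1 v2 v3 v4).
Proof.
move=> wf rG site; have m4 := two_size wf; have sep := fun x y k => @two_sep p x y k wf.
case: (ring_siteP m4 rG (two_triangles wf) site) => [v vP wP h|v _ lP rP|v vP wP h|e b he bP beP lv].
- have [wf' i] := two_insert wf rG vP wP.
  by constructor 2; exists m.+1, (stretch v p) => //; apply: isomorphic_trans h i.
- by have /negP[] := sep _ _ 2%N isT rP lP; apply/eqP; ring.
- have [P1|P1] := boolP ((v - 1 \in [:: 0; p]) || (v + 2%:R \in [:: 0; p])).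
    have [p' [q' [wf' i]]] := two_twist wf rG vP wP P1.
    by constructor 3; exists m.+1, false, p', q'; split=> //; apply: isomorphic_trans h i.
  constructor 4; rewrite (level_iso h); apply: le_trans (twist_level m4 _ (unit_step1 m) vP wP).
  move: P1; rewrite negb_or => /andP[-> P2].
  have -> : v + 1 *+ 2 \notin [:: 0; p] by [].
  by rewrite level_two.
- constructor 4; apply: le_trans lv; rewrite level_two //.
  have -> : b + e *+ 2 \notin [:: 0; p].
    apply/negP => h; have /negP[] := step_sep sep he (isT : 0 < 2 < 4)%N h bP.
    by rewrite eqxx.
  have -> // : b - e \notin [:: 0; p].
  apply/negP => h; have /negP[] := step_sep sep he (isT : 0 < 1 < 4)%N bP h.
  by rewrite subrK.
Qed.

Lemma three_sep c p q x y k : three_wf c p q -> (0 < k < 4)%N ->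
  x \in [:: 0; p; q] -> y \in [:: 0; p; q] -> x = y + k%:R ->
  [/\ y = p, x = q, q = p + k%:R & c = false].
Proof.
case/and4P=> p4 pq qm cc /andP[k0 k4].
have Ek : nat_of_ord (k%:R : V) = k by apply: natr_ord; clear -p4 pq qm k4; lia.
have E z : (z + k < m.+2)%N -> nat_of_ord (z + k%:R) = (z + k)%N.
  move=> h; have -> : nat_of_ord (z + k%:R) = ((z + nat_of_ord (k%:R : V)) %% m.+2)%N by [].
  by rewrite Ek modn_small.
have Ep : nat_of_ord (p + k%:R) = (p + k)%N by apply: E; clear -p4 pq qm k4; lia.
have Eq : nat_of_ord (q + k%:R) = (q + k)%N by apply: E; clear -p4 pq qm k4; lia.
have s z : z = z + k%:R -> False.
  by apply/eqP; rewrite eq_sym addr_neq // k0; clear -p4 pq qm k4; lia.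
rewrite !inE => /or3P[]/eqP-> /or3P[]/eqP-> h; try by [exfalso; exact: s h];
  move/(congr1 (@nat_of_ord _)): (h); rewrite ?add0r ?Ek ?Ep ?Eq /= => h'; try (exfalso; clear -p4 pq qm k4 k0 h'; lia).
by split => //; case: c cc => // cc; exfalso; move: cc; clear -p4 pq qm k4 k0 h'; lia.
Qed.

(** The level is kept only by insertions and by the twist of a zigzag of two
    triangles. *)
Lemma three_low_level c p q v1 v2 v3 v4 : three_wf c p q -> regular 4 (three_zigzags c p q) ->
  dte_site (three_zigzags c p q) v1 v2 v3 v4 -> low_level (dte (three_zigzags c p q) v1 v2 v3 v4).
Proof.
move=> wf rG site; have m4 := three_size wf.
have sep := fun x y k => @three_sep c p q x y k wf.
have /and4P[p4 pq qm _] := wf.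
have pq' : p <> q by move=> E; move: pq; rewrite E ltnn.
case: (ring_siteP m4 rG (three_triangles wf) site) => [v vP wP h|v vP lP rP h|v vP wP h|e b he bP beP lv].
- have [wf' i] := three_insert wf rG vP wP.
  by constructor 3; exists m.+1, c, (stretch v p), (stretch v q); split=> //; apply: isomorphic_trans h i.
- have E : v + 1 = v - 1 + 2%:R by ring.
  have [vp vq qE cE] := sep _ _ 2%N isT rP lP E; subst c.
  have vE : v = p + 1 by rewrite -vp subrK.
  have [wf' i] := three_short qE wf rG vE.
  constructor 3; exists m.+1, false, (stretch v p), (stretch v q); split=> //.
  apply: isomorphic_trans (h (-1) _ _ _) i.
  + by rewrite vp ord_eqE ord_N1; clear -p4 pq qm; lia.
  + by rewrite vq ord_eqE ord_N1; clear -p4 pq qm; lia.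
  + rewrite (_ : v = q - 1); last by rewrite -vq addrK.
    apply: ring_adjM; last by rewrite !inE eqxx !orbT.
    rewrite ord_eqE ord_N1; have -> : nat_of_ord (q - 1) = q.-1.
      by apply: ord_subS_val => //; clear -pq; lia.
    by clear -p4 pq qm; lia.
- have [P1|P1] := boolP ((v - 1 \in [:: 0; p; q]) && (v + 2%:R \in [:: 0; p; q])).
    case/andP: P1 => P1 P2; have E : v + 2%:R = v - 1 + 3%:R by ring.
    have [vp vq qE cE] := sep _ _ 3%N isT P2 P1 E; subst c.
    have vE : v = p + 1 by rewrite -vp subrK.
    have [wf' i] := three_twist qE wf rG vE.
    constructor 3; exists m.+1, true, (stretch v p), (stretch v q); split=> //.
    exact: isomorphic_trans h i.
  constructor 4; rewrite (level_iso h); apply: le_trans (twist_level m4 _ (unit_step1 m) vP wP).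
  move: P1; rewrite level_three // negb_and.
  have -> : v + 1 *+ 2 = v + 2%:R by [].
  by case/orP=> ->; rewrite ?addn1; case: (_ \notin _).
- constructor 4; apply: le_trans lv; rewrite level_three //.
  have : (b + e *+ 2 \notin [:: 0; p; q]) || (b - e \notin [:: 0; p; q]).
    rewrite -negb_and; apply/negP => /andP[P1 P2].
    case/orP: he => /eqP eE; subst e.
      have [h1 h2 _ _] := sep b (b - 1) 1%N isT bP P2 (esym (subrK _ _)).
      have [h3 h4 _ _] := sep _ _ 2%N isT P1 bP erefl.
      by apply: pq'; rewrite -h3 h2.
    rewrite opprK mulNrn in P1 P2.
    have [h1 h2 _ _] := sep _ _ 1%N isT P2 bP erefl.
    have [h3 h4 _ _] := sep _ _ 2%N isT bP P1 (esym (subrK _ _)).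
    by apply: pq'; rewrite -h1 h4.
  by case/orP=> ->; rewrite ?addn1; case: (_ \notin _).
Qed.

End Steps.

(** * Classification and existence of descendants *)

Lemma complete_circulant : isomorphic (complete_graph 'I_5) (circulant 3).
Proof.
exists id; first by exists id.
by move=> x y; rewrite adj_circulant5 adj_sgraph_of andbT.
Qed.

Lemma dte_transport (V W : finType) (G : sgraph V) (H : sgraph W) v1 v2 v3 v4 :
  regular 4 G -> dte_site G v1 v2 v3 v4 -> isomorphic G H ->
  (forall w1 w2 w3 w4, regular 4 H -> dte_site H w1 w2 w3 w4 -> low_level (dte H w1 w2 w3 w4)) ->
  low_level (dte G v1 v2 v3 v4).
Proof.
move=> rG site GH step; have rH := regular_iso GH rG.
case: GH => f bf fP; apply: low_level_iso (dte_iso _ _ _ _ bf fP) _.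
by apply: step => //; rewrite (site_iso _ _ _ _ bf fP).
Qed.

Lemma K5_descendant_low_level (V : finType) (G : sgraph V) : K5_descendant G -> low_level G.
Proof.
elim=> {V G} [|V G v1 v2 v3 v4 _ IH rG site|V W G H _ IH GH].
- by constructor 1; exists 3%N; last exact: complete_circulant.
- case: IH => [[m m2 h]|[m [p wf h]]|[m [c [p [q [wf h]]]]]|h].
  + by apply: (dte_transport rG site h) => *; exact: circulant_low_level.
  + by apply: (dte_transport rG site h) => *; exact: two_low_level.
  + by apply: (dte_transport rG site h) => *; exact: three_low_level.
  + by constructor 4; apply: le_trans h (level_dte_mono site).
- exact: low_level_iso (isomorphic_sym GH) IH.
Qed.

(** Descendants are 4-regular by construction; this is the hypothesis under
    which the isomorphisms above are available. *)
Lemma K5_descendant_regular (V : finType) (G : sgraph V) : K5_descendant G -> regular 4 G.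
Proof.
elim=> {V G} [|V G v1 v2 v3 v4 _ _ rG site|V W G H _ rG GH].
- apply/forallP=> x; rewrite (_ : [set y | _] = [set~ x]); first by rewrite cardsC1 card_ord.
  by apply/setP=> y; rewrite !inE adj_sgraph_of andbT eq_sym.
- exact: regular_dte.
- exact: regular_iso GH rG.
Qed.

Lemma K5_descendant_step (V W : finType) (G : sgraph V) (H : sgraph W) v1 v2 v3 v4 :
  K5_descendant G -> dte_site G v1 v2 v3 v4 -> isomorphic (dte G v1 v2 v3 v4) H -> K5_descendant H.
Proof.
move=> dG site; apply: K5_descendant_iso; apply: K5_descendant_dte => //.
exact: K5_descendant_regular.
Qed.

Lemma circulant_descendant m : (2 < m)%N -> K5_descendant (circulant m).
Proof.
elim: m => // m IH; rewrite ltnS leq_eqVlt => /predU1P[<-|m2].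
  exact: K5_descendant_iso K5_descendant_base complete_circulant.
have {IH} dG := IH m2; have rG := K5_descendant_regular dG.
have [m5|m4] := ltnP m 5; last first.
  by apply: K5_descendant_step (circulant_insert m4 rG 0) => //; exact: (insert_site m4 _ (unit_step1 m)).
have [m3|m4] : m = 3%N \/ m = 4%N by clear -m2 m5; lia.
  clear m2 m5; subst m.
  have site : dte_site (circulant 3) 0 1 2%:R 3%:R by rewrite /dte_site !adj_circulant5.
  exact: K5_descendant_step dG site (dte_circulant5 rG site).
clear m2 m5; subst m.
have site : dte_site (circulant 4) 0 1 2%:R 3%:R by rewrite /dte_site !adj_circulant6.
exact: K5_descendant_step dG site (dte_circulant6 rG site).
Qed.

(** A zigzag with [p > 4] comes from an insertion at 1, a zigzag from 0 to 4
    from a twist of a circulant. *)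
Lemma two_descendant m (p : 'I_m.+2) : two_wf p -> K5_descendant (two_zigzags p).
Proof.
elim: m p => [|m IH] p wf; have /andP[p4 pm] := wf; first by clear -p4 pm; lia.
have [pE|pne] := eqVneq p 4%:R.
  have m4 : (4 < m)%N by clear -p4 pm; lia.
  have dG : K5_descendant (circulant m) by apply: circulant_descendant; clear -m4; lia.
  rewrite pE; apply: K5_descendant_step (circulant_twist m4 (K5_descendant_regular dG) 0) => //.
  by apply: (twist_site m4 _ (unit_step1 m)).
have {pne} p5 : (4 < p)%N.
  rewrite ltn_neqAle p4 andbT; apply: contraNneq pne => E; apply/eqP/ord_inj.
  by rewrite natr_ord //; clear -p4 pm; lia.
pose p0 : 'I_m.+2 := inord p.-1.
have Ep : nat_of_ord p0 = p.-1 by rewrite inordK //; have := ltn_ord p; clear -p5; lia.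
have wf0 : two_wf p0 by rewrite /two_wf Ep; clear -p5 pm; lia.
have dG := IH _ wf0; have rG := K5_descendant_regular dG; have m4 := two_size wf0.
have E2 : nat_of_ord (1 + 1 : 'I_m.+2) = 2%N.
  by apply: ord_addS_val; [exact: ord_1 | clear -m4; lia].
have P1 : 1 \notin [:: 0; p0] by rewrite !inE !ord_eqE ord_1 Ep /=; clear -p5; lia.
have P2 : 1 + 1 \notin [:: 0; p0] by rewrite !inE !ord_eqE E2 Ep /=; clear -p5; lia.
have [_ i] := two_insert wf0 rG P1 P2.
have -> : p = stretch 1 p0 by apply: ord_inj; rewrite ord_stretch ord_1 Ep; clear -p5; lia.
by apply: K5_descendant_step i => //; exact: insert_site (unit_step1 m) _ _.
Qed.

(** The zigzag from 0 to [p] has three triangles and comes from a twist at the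
    start of one of two zigzags, or is longer and comes from an insertion. *)
Lemma three_descendant_false m (p q : 'I_m.+2) : three_wf false p q -> K5_descendant (three_zigzags false p q).
Proof.
elim: m p q => [|m IH] p q wf; have /and4P[p4 pq qm _] := wf; first by clear -p4 pq qm; lia.
pose q0 : 'I_m.+2 := inord q.-1.
have Eq : nat_of_ord q0 = q.-1 by rewrite inordK //; have := ltn_ord q; clear -p4 pq; lia.
have qE : q = stretch 1 q0 by apply: ord_inj; rewrite ord_stretch ord_1 Eq; clear -p4 pq; lia.
have [pE|pne] := eqVneq p 4%:R.
  have wf0 : two_wf q0 by rewrite /two_wf Eq; clear -p4 pq qm; lia.
  have dG := two_descendant wf0; have rG := K5_descendant_regular dG; have m4 := two_size wf0.
  have [_ i] := two_twist_start wf0 rG.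
  have E2 : nat_of_ord (1 + 1 : 'I_m.+2) = 2%N.
    by apply: ord_addS_val; [exact: ord_1 | clear -m4; lia].
  have P1 : 1 \notin [:: 0; q0] by rewrite !inE !ord_eqE ord_1 Eq /=; clear -p4 pq; lia.
  have P2 : 1 + 1 \notin [:: 0; q0] by rewrite !inE !ord_eqE E2 Eq /=; clear -p4 pq; lia.
  rewrite pE qE; apply: K5_descendant_step i => //.
  by have := twist_site m4 [:: (1, q0 + 1); (q0 - 1, -1)] (unit_step1 m) P1 P2; rewrite subrr.
have {pne} p5 : (4 < p)%N.
  rewrite ltn_neqAle p4 andbT; apply: contraNneq pne => E; apply/eqP/ord_inj.
  by rewrite natr_ord //; clear -p4 pq qm; lia.
pose p0 : 'I_m.+2 := inord p.-1.
have Ep : nat_of_ord p0 = p.-1 by rewrite inordK //; have := ltn_ord p; clear -p5; lia.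
have wf0 : three_wf false p0 q0 by rewrite /three_wf Ep Eq; clear -p5 pq qm; lia.
have dG := IH _ _ wf0; have rG := K5_descendant_regular dG; have m4 := three_size wf0.
have E2 : nat_of_ord (1 + 1 : 'I_m.+2) = 2%N.
  by apply: ord_addS_val; [exact: ord_1 | clear -m4; lia].
have P1 : 1 \notin [:: 0; p0; q0] by rewrite !inE !ord_eqE ord_1 Ep Eq /=; clear -p5 pq; lia.
have P2 : 1 + 1 \notin [:: 0; p0; q0] by rewrite !inE !ord_eqE E2 Ep Eq /=; clear -p5 pq; lia.
have [_ i] := three_insert wf0 rG P1 P2.
have -> : p = stretch 1 p0 by apply: ord_inj; rewrite ord_stretch ord_1 Ep; clear -p5; lia.
by rewrite qE; apply: K5_descendant_step i => //; exact: insert_site (unit_step1 m) _ _.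
Qed.

(** The zigzag from [p] to [q] has three triangles and comes from a twist of
    two triangles, or is longer and comes from an insertion. *)
Lemma three_descendant_true m (p q : 'I_m.+2) : three_wf true p q -> K5_descendant (three_zigzags true p q).
Proof.
elim: m p q => [|m IH] p q wf; have /and4P[p4 pq qm s3] := wf; first by clear -p4 pq qm; lia.
move: s3 => /= s3.
pose q0 : 'I_m.+2 := inord q.-1; pose p0 : 'I_m.+2 := inord p.
have Eq : nat_of_ord q0 = q.-1 by rewrite inordK //; have := ltn_ord q; clear -p4 pq; lia.
have Ep : nat_of_ord p0 = p by rewrite inordK //; clear -p4 pq qm; lia.
pose v := p0 + 1.
have Ev : nat_of_ord v = p.+1 by apply: ord_addS_val => //; clear -pq qm; lia.
have Ew : nat_of_ord (v + 1) = p.+2 by apply: ord_addS_val => //; clear -s3 pq qm; lia.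
have pE : p = stretch v p0 by apply: ord_inj; rewrite ord_stretch Ev Ep; clear; lia.
have qE : q = stretch v q0 by apply: ord_inj; rewrite ord_stretch Ev Eq; clear -s3; lia.
have P1 : v \notin [:: 0; p0; q0] by rewrite !inE !ord_eqE Ev Ep Eq /=; clear -s3; lia.
have P2 : v + 1 \notin [:: 0; p0; q0] by rewrite !inE !ord_eqE Ew Ep Eq /=; clear -s3; lia.
have [qE'|qne] := eqVneq (nat_of_ord q) (p + 4)%N.
  have wf0 : three_wf false p0 q0 by rewrite /three_wf Ep Eq; clear -p4 qE' qm; lia.
  have dG := three_descendant_false wf0; have rG := K5_descendant_regular dG.
  have m4 := three_size wf0.
  have h : q0 = p0 + 3%:R.
    rewrite (_ : p0 + 3%:R = v + 1 + 1); last by rewrite /v; ring.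
    by apply: ord_inj; rewrite (ord_addS_val Ew) ?Eq; clear -qE' qm; lia.
  have [_ i] := three_twist h wf0 rG (erefl v).
  by rewrite pE qE; apply: K5_descendant_step i => //; exact: twist_site (unit_step1 m) _ _.
have wf0 : three_wf true p0 q0.
  by rewrite /three_wf Ep Eq; move/eqP: qne; clear -p4 pq qm s3; lia.
have dG := IH _ _ wf0; have rG := K5_descendant_regular dG; have m4 := three_size wf0.
have [_ i] := three_insert wf0 rG P1 P2.
by rewrite pE qE; apply: K5_descendant_step i => //; exact: insert_site (unit_step1 m) _ _.
Qed.

Lemma three_descendant m c (p q : 'I_m.+2) : three_wf c p q -> K5_descendant (three_zigzags c p q).
Proof. by case: c; [exact: three_descendant_true | exact: three_descendant_false]. Qed.

(** [K5] and the octahedron have many more triangles than vertices; here it is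
    enough that expansions lead from them to the circulant on seven vertices. *)
Lemma level_circulant_le0 m : (2 < m)%N -> level (circulant m) <= 0.
Proof.
move=> m2; have rG := K5_descendant_regular (circulant_descendant m2).
have [m5|m4] := ltnP m 5; last by rewrite level_circulant.
have l4 : level (circulant 4) <= 0.
  have rG4 := K5_descendant_regular (circulant_descendant (isT : 2 < 4)%N).
  have site : dte_site (circulant 4) 0 1 2%:R 3%:R by rewrite /dte_site !adj_circulant6.
  by rewrite -(@level_circulant 5) // -(level_iso (dte_circulant6 rG4 site)) level_dte_mono.
have [m3|m4] : m = 3%N \/ m = 4%N by clear -m2 m5; lia.
  clear m2 m5; subst m.
  have site : dte_site (circulant 3) 0 1 2%:R 3%:R by rewrite /dte_site !adj_circulant5.
  apply: le_trans l4; rewrite -(level_iso (dte_circulant5 rG site)); exact: level_dte_mono.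
by clear m2 m5; subst m.
Qed.

Lemma level3_classification (V : finType) (G : sgraph V) : K5_descendant G -> level G = 3 ->
  exists m c, exists p q : 'I_m.+2, three_wf c p q /\ isomorphic G (three_zigzags c p q).
Proof.
move=> dG lG; case: (K5_descendant_low_level dG) => [[m m2 h]|[m [p wf h]]|//|h].
- by have := level_circulant_le0 m2; rewrite -(level_iso h) lG.
- by move: lG; rewrite (level_iso h) level_two.
- by move: h; rewrite lG.
Qed.

(** * Zigzags as chains of triangles *)

Section Strips.
Variables (V : finType) (G : sgraph V).

(** A zigzag with [k >= 3] triangles [u j, u (j+1), u (j+2)] that cannot be
    extended: its first and last edges lie in no other triangle.  The
    condition on [u (j+3)] prevents the chain from turning back.  With fewer
    than three triangles the order of the vertices would not be determined. *)
Definition strip k (u : nat -> V) : Prop :=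
  [/\ (2 < k)%N,
      forall j, (j < k)%N -> [/\ adj G (u j) (u j.+1), adj G (u j.+1) (u j.+2) & adj G (u j) (u j.+2)],
      forall j, (j.+1 < k)%N -> u j.+3 <> u j,
      forall t, adj G t (u 0%N) -> adj G t (u 1%N) -> t = u 2%N
    & forall t, adj G t (u k) -> adj G t (u k.+1) -> t = u k.-1].

(** The vertices [u k] and [v l] are the last but one of their strips, where
    chords end. *)
Definition fork x k l : Prop :=
  exists u v, [/\ strip k u, strip l v, u 0%N = x /\ v 0%N = x, u 1%N <> v 1%N & adj G (u k) (v l)].

End Strips.

Lemma strip_iso (V W : finType) (G : sgraph V) (H : sgraph W) (f : V -> W) k u :
  bijective f -> (forall x y, adj H (f x) (f y) = adj G x y) -> strip G k u -> strip H k (f \o u).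
Proof.
move=> bf fP [k2 h1 h2 h3 h4]; have [g fK gK] := bf; split=> //=.
- by move=> j jk; rewrite !fP; exact: h1.
- by move=> j jk /(bij_inj bf); exact: h2.
- by move=> t; rewrite -(gK t) !fP => t1 t2; rewrite (h3 _ t1 t2).
- by move=> t; rewrite -(gK t) !fP => t1 t2; rewrite (h4 _ t1 t2).
Qed.

Lemma fork_iso (V W : finType) (G : sgraph V) (H : sgraph W) (f : V -> W) x k l :
  bijective f -> (forall x y, adj H (f x) (f y) = adj G x y) -> fork G x k l -> fork H (f x) k l.
Proof.
move=> bf fP [u [v [su sv [h1 h2] h3 h4]]]; exists (f \o u), (f \o v); split=> /=.
- exact: strip_iso su.
- exact: strip_iso sv.
- by rewrite h1 h2.
- by move/(bij_inj bf).
- by rewrite fP.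
Qed.

Section RingStrips.
Variables (m : nat) (P : seq 'I_m.+2) (M : seq ('I_m.+2 * 'I_m.+2)).
Local Notation V := 'I_m.+2.
Local Notation G := (ring_graph P M).
Hypotheses (m4 : (4 < m)%N) (tP : triangles_consecutive P M).
Implicit Types (x y z t v w e a : V).

Lemma unit_stepN e : unit_step e -> unit_step (- e).
Proof. by rewrite /unit_step !eqr_oppLR opprK orbC. Qed.

(** A triangle on an edge of length one is centred at one of its two ends. *)
Lemma step_triangle e a t : unit_step e -> adj G a (a + e) -> adj G (a + e) t -> adj G a t ->
  (t = a + e *+ 2 /\ a + e \notin P) \/ (t = a - e /\ a \notin P).
Proof.
move=> he h1 h2 h3; have [v vP /consecutiveP con] := tP h1 h2 h3.
case: con => -[vE [[E2 E3]|[E2 E3]]].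
- have eE : e = -1 by move: E2; rewrite -vE => /addrI.
  by right; rewrite E3 vE eE opprK.
- have eE : e = 1 by move: E2; rewrite -vE => /addrI.
  by right; rewrite E3 vE eE.
- have eE : e = 1 by apply/(addrI a); rewrite vE E2 subrK.
  by left; rewrite E3 vE E2 eE; split=> //; ring.
- have eE : e = -1 by apply/(addrI a); rewrite vE E2 addrK.
  by left; rewrite E3 vE E2 eE; split=> //; ring.
- have eE : e = 1 *+ 2 by apply/(addrI a); rewrite E3 E2; ring.
  exfalso; move: (step_neq m4 he (isT : (0 < 1 < 7)%N) (erefl (0 + e *+ 1))).
  case/orP: he => /eqP h; rewrite h in eE.
    have /negP[] := step_neq m4 (unit_step1 m) (isT : (0 < 1 < 7)%N) (erefl ((0 : V) + 1 *+ 1)).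
    by rewrite add0r -(inj_eq (addrI 1)) addr0 -mulr2n -eE.
  have /negP[] := step_neq m4 (unit_step1 m) (isT : (0 < 3 < 7)%N) (erefl ((0 : V) + 1 *+ 3)).
  by rewrite add0r mulrSr -eE addNr.
- have eE : e = - (1 *+ 2) by apply/(addrI a); rewrite E3 E2; ring.
  exfalso; case/orP: he => /eqP h; rewrite h in eE.
    have /negP[] := step_neq m4 (unit_step1 m) (isT : (0 < 3 < 7)%N) (erefl ((0 : V) + 1 *+ 3)).
    by rewrite add0r mulrSr [X in _ + X]eE subrr.
  have /negP[] := step_neq m4 (unit_step1 m) (isT : (0 < 1 < 7)%N) (erefl ((0 : V) + 1 *+ 1)).
  by rewrite add0r -(inj_eq (addrI 1)) addr0 -mulr2n -(inj_eq oppr_inj) eE.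
Qed.

Lemma small_natr_neq0 k : (0 < k < 7)%N -> (k%:R : V) <> 0.
Proof. by move=> h; apply/eqP; apply: natr_eq0; clear -m4 h; lia. Qed.

Lemma two_steps e s : unit_step e -> unit_step s -> e *+ 2 <> s.
Proof.
move=> he hs; case/orP: he => /eqP->; case/orP: hs => /eqP-> E.
- by apply: (@small_natr_neq0 1); rewrite // -[RHS](subrr 1) -[X in _ = X - _]E; ring.
- by apply: (@small_natr_neq0 3); rewrite // -[RHS](subrr (-1)) -[X in _ = X - _]E; ring.
- by apply: (@small_natr_neq0 3); rewrite // -[RHS](subrr 1) -[X in _ = _ - X]E; ring.
- by apply: (@small_natr_neq0 1); rewrite // -[RHS](subrr (-1)) -[X in _ = _ - X]E; ring.
Qed.

(** An edge of length two lies over the centre of its only triangle. *)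
Lemma step2_triangle e a t : unit_step e -> adj G a (a + e *+ 2) -> adj G (a + e *+ 2) t -> adj G a t ->
  t = a + e.
Proof.
move=> he h1 h2 h3; have [v vP /consecutiveP con] := tP h1 h2 h3.
have s1 := unit_step1 m; have sN := unit_stepN1 m.
case: con => -[vE [[E2 E3]|[E2 E3]]].
- by case: (two_steps he sN); apply/(addrI a); rewrite E2 vE.
- by case: (two_steps he s1); apply/(addrI a); rewrite E2 vE.
- by case: (two_steps he s1); apply/(addrI a); rewrite vE E2; ring.
- by case: (two_steps he sN); apply/(addrI a); rewrite vE E2; ring.
- have E : e *+ 2 = 1 *+ 2 by apply/(addrI a); rewrite E3 E2; ring.
  case/orP: he => /eqP eE; rewrite eE in E *; first by rewrite E2 vE; ring.
  by case: (@small_natr_neq0 4) => //; rewrite -[RHS](subrr (1 *+ 2)) -[X in _ = _ - X]E; ring.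
- have E : e *+ 2 = - 1 *+ 2 by apply/(addrI a); rewrite E3 E2; ring.
  case/orP: he => /eqP eE; rewrite eE in E *; last by rewrite E2 vE; ring.
  by case: (@small_natr_neq0 4) => //; rewrite -[RHS](subrr (1 *+ 2)) -[X in _ = _ - X]opprK -mulNrn -E; ring.
Qed.

(** The first triangle of the strip shares the edge [u 1, u 2] with the second
    one, and the second shares [u 2, u 3] with the third.  This forces [u 1]
    to be the centre of the first triangle; from there on the strip can only
    go straight ahead, and it stops at the first break because its last edge
    lies in a single triangle. *)
Lemma ring_strip k u : strip G k u ->
  exists e, unit_step e /\ [/\ forall j, (j < k.+2)%N -> u j = u 0%N + e *+ j,
    u 0%N \in P, u k.+1 \in P & forall j, (0 < j < k.+1)%N -> u j \notin P].
Proof.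
move=> [k3 tri nb first last].
have k0 : (0 < k)%N by exact: leq_trans k3. have k1 : (1 < k)%N by exact: leq_trans k3.
have [a01 a12 a02] := tri 0%N k0; have [_ a23 a13] := tri 1%N k1; have [_ a34 a24] := tri 2%N k3.
have nb0 := nb 0%N k1; have nb1 := nb 1%N k3.
have [e [he [E1 E2]]] : exists e, unit_step e /\ (u 1%N = u 0%N + e /\ u 2%N = u 0%N + e *+ 2).
  have [c cP /consecutiveP con] := tP a01 a12 a02.
  have s1 := unit_step1 m; have sN := unit_stepN1 m.
  (* If the centre were [u 0], then [u 3 = u 0]. *)
  have far e : unit_step e -> u 2%N = u 1%N + e *+ 2 -> u 0%N = u 1%N + e -> False.
    move=> he E E'; rewrite E in a12 a23.
    by apply: nb0; rewrite (step2_triangle he a12 a23 a13).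
  (* If the centre were [u 2], then [u 4 = u 1]. *)
  have back e : unit_step e -> u 2%N = u 1%N + e -> u 0%N = u 1%N + e *+ 2 -> False.
    move=> he E E'; move: (a12) (a23); rewrite E => b12 b23.
    case: (step_triangle he b12 b23 a13) => -[E3 _]; first by apply: nb0; rewrite E3.
    apply: nb1; have E4 : u 2%N = u 3%N + e *+ 2 by rewrite E E3; ring.
    have := @step2_triangle e (u 3%N) (u 4%N) he; rewrite -E4 [adj G (u 3%N) _]adj_sym.
    by move=> /(_ a23 a24 a34) ->; rewrite E3 subrK.
  case: con => -[cE [[E2 E3]|[E2 E3]]].
  - by exfalso; apply: (far 1) => //; rewrite ?E3 ?cE ?E2; ring.
  - by exfalso; apply: (far (-1)) => //; rewrite ?E3 ?cE ?E2; ring.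
  - by exists 1; rewrite cE E2 E3; split=> //; split; ring.
  - by exists (-1); rewrite cE E2 E3; split=> //; split; ring.
  - by exfalso; apply: (back (-1)) => //; rewrite ?cE ?E2 ?E3; ring.
  - by exfalso; apply: (back 1) => //; rewrite ?cE ?E2 ?E3; ring.
have run j : (j < k)%N -> u j = u 0%N + e *+ j /\ u j.+1 = u 0%N + e *+ j.+1 /\ u j.+2 = u 0%N + e *+ j.+2.
  elim: j => [|j IH] jk; first by rewrite mulr0n addr0.
  have [_ [F1 F2]] := IH (ltnW jk); split=> //; split=> //.
  have [b01 b12 b02] := tri j.+1 jk.
  have E : u j.+2 = u j.+1 + e by rewrite F2 F1 mulrSr addrA.
  rewrite E in b01 b12.
  case: (step_triangle he b01 b12 b02) => [[-> _]|[h _]]; first by rewrite F1 -addrA -mulrnDr addn2.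
  have := nb j jk; rewrite h F1; have [F0 _] := IH (ltnW jk).
  by rewrite F0 mulrSr addrA addrK.
exists e; split=> //.
have uE j : (j < k.+2)%N -> u j = u 0%N + e *+ j.
  case: j => [|[|j]] jk; [by rewrite mulr0n addr0|by have [_ [-> _]] := run 0%N k0|].
  by have [_ [_ ->]] := run j jk.
split=> //.
- apply/negPn/negP => h0.
  have /(step_neq m4 he (isT : 0 < 3 < 7)%N)/eqP[] : u 2%N = u 0%N - e + e *+ 3 by rewrite E2; ring.
  apply: (first); first by rewrite (adj_step1 P M he) // subrK.
  by apply: (adj_step2 m4 M he h0); rewrite ?subrK // E1; ring.
- apply/negPn/negP => h0.
  have E3 : u k.-1 = u 0%N + e *+ k.-1 by rewrite uE //; clear -k3; lia.
  have E4 : u k.+1 = u 0%N + e *+ k.+1 by rewrite uE.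
  have E5 : u k = u 0%N + e *+ k by rewrite uE.
  have kE : k = k.-1.+1 by rewrite prednK.
  have /(step_neq m4 he (isT : 0 < 3 < 7)%N)/eqP[] : u k.+1 + e = u k.-1 + e *+ 3.
    by rewrite E3 E4 kE /= -[in RHS]addrA -mulrnDr -addrA -mulrSr addn3.
  apply/esym/last; last by rewrite adj_sym; exact: step_adj.
  rewrite adj_sym; apply: (adj_step2 m4 M he h0).
    by rewrite E5 E4 mulrSr addrA.
  by rewrite E5 E4 mulrSr mulr2n !addrA.
- move=> j /andP[j0 jk]; case: j j0 jk => // j _ jk.
  have [b01 b12 b02] := tri j jk.
  have E0 : u j = u 0%N + e *+ j by apply: uE; clear -jk; lia.
  have E3 : u j.+1 = u j + e by rewrite uE ?E0 ?mulrSr ?addrA //; clear -jk; lia.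
  have E4 : u j.+2 = u j + e *+ 2 by rewrite uE ?E0 // -addrA -mulrnDr addn2.
  rewrite E3 in b01 b12 *; case: (step_triangle he b01 b12 b02) => -[] // h _.
  by have /(step_neq m4 he (isT : 0 < 3 < 7)%N)/eqP[] : u j.+2 = u j - e + e *+ 3 by rewrite E4; ring.
Qed.

Lemma strip_ring k e x : (2 < k)%N -> unit_step e -> x \in P -> x + e *+ k.+1 \in P ->
  (forall j, (0 < j < k.+1)%N -> x + e *+ j \notin P) -> strip G k (fun j => x + e *+ j).
Proof.
move=> k3 he xP yP hP; have k0 : (0 < k)%N by exact: leq_trans k3.
have S j : x + e *+ j + e = x + e *+ j.+1 by rewrite mulrSr addrA.
have SS j : x + e *+ j + e *+ 2 = x + e *+ j.+2 by rewrite mulr2n addrA !S.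
have P1 : x + e \notin P by have := hP 1%N; rewrite mulr1n; apply.
split=> //.
- move=> j jk; have h : x + e *+ j + e \notin P by rewrite S; apply: hP.
  by split; [rewrite -S | rewrite -[X in adj _ _ X]S | rewrite -SS]; [exact: step_adj..|exact: step_adj2].
- by move=> j jk; apply/eqP; rewrite eq_sym; apply: (step_neq m4 he (isT : 0 < 3 < 7)%N); rewrite -addrA -mulrnDr addn3.
- move=> t; rewrite mulr0n addr0 mulr1n => t0 t1.
  rewrite adj_sym in t0; rewrite adj_sym in t1.
  by case: (step_triangle he (step_adj P M _ he) t1 t0) => -[// _ /negP[]].
- move=> t t0 t1; have heN := unit_stepN he.
  have E : x + e *+ k = x + e *+ k.+1 - e by rewrite -S addrK.
  rewrite adj_sym in t1; rewrite adj_sym E in t0.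
  case: (step_triangle heN (step_adj P M _ heN) t0 t1) => -[E' h]; last by case/negP: h.
  rewrite E' mulNrn -(prednK k0) /= -SS addrK; congr (_ + _ *+ _).
Qed.

End RingStrips.

(** * Pairs of zigzags with a common end *)

Section RingForks.
Variables (m : nat) (P : seq 'I_m.+2) (M : seq ('I_m.+2 * 'I_m.+2)).
Local Notation V := 'I_m.+2.
Local Notation G := (ring_graph P M).
Hypotheses (m4 : (4 < m)%N) (tP : triangles_consecutive P M).
Implicit Types (x y z t v w e a : V).

(** The break [y] is the first one after [x], at distance [d]. *)
Definition next_break x d y : Prop :=
  [/\ (0 < d)%N, x \in P, y \in P, y = x + 1 *+ d & forall j, (0 < j < d)%N -> x + 1 *+ j \notin P].

Lemma next_break_uniq x d y d' y' : next_break x d y -> next_break x d' y' -> d = d' /\ y = y'.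
Proof.
move=> [d0 _ yP yE h] [d0' _ yP' yE' h'].
suff E : d = d' by split=> //; rewrite yE yE' E.
case: (ltngtP d d') => // lt; first by have := h' d; rewrite d0 lt -yE yP => /(_ isT).
by have := h d'; rewrite d0' lt -yE' yP' => /(_ isT).
Qed.

Lemma prev_break_uniq x d y d' y' : next_break y d x -> next_break y' d' x -> d = d' /\ y = y'.
Proof.
move=> [d0 yP _ yE h] [d0' yP' _ yE' h'].
suff E : d = d' by split=> //; apply: (addIr (1 *+ d)); rewrite -yE yE' E.
have aux (a b : nat) (z z' : V) : (a < b)%N -> x = z + 1 *+ a -> x = z' + 1 *+ b -> z = z' + 1 *+ (b - a).
  move=> ab E1 E2; apply: (addIr (1 *+ a)); rewrite -E1 E2 -addrA -mulrnDr subnK //; exact: ltnW.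
case: (ltngtP d d') => // lt.
  have := h' (d' - d)%N; rewrite -(aux _ _ _ _ lt yE yE') yP => /(_ _)/negP; case=> //.
  by clear -lt d0; lia.
have := h (d - d')%N; rewrite -(aux _ _ _ _ lt yE' yE) yP' => /(_ _)/negP; case=> //.
by clear -lt d0'; lia.
Qed.

(** The two strips of a fork leave [x] in opposite directions, each up to the
    nearest break. *)
Lemma fork_breaks x k l : fork G x k l -> exists k' l' y z,
  [/\ (k' = k /\ l' = l) \/ (k' = l /\ l' = k), (2 < k')%N /\ (2 < l')%N,
      next_break x k'.+1 y, next_break z l'.+1 x & adj G (y - 1) (z + 1)].
Proof.
move=> [u [v [su sv [u0 v0] uv auv]]].
have k2 : (2 < k)%N by case: su. have l2 : (2 < l)%N by case: sv.
have [e [he [uE uP ukP uiP]]] := ring_strip m4 tP su.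
have [e' [he' [vE vP vlP viP]]] := ring_strip m4 tP sv.
have main k1 l1 (w w' : nat -> V) : (2 < k1)%N -> (2 < l1)%N ->
  (forall j, (j < k1.+2)%N -> w j = x + 1 *+ j) -> (forall j, (j < l1.+2)%N -> w' j = x + (-1) *+ j) ->
  w k1.+1 \in P -> (forall j, (0 < j < k1.+1)%N -> w j \notin P) ->
  w' l1.+1 \in P -> (forall j, (0 < j < l1.+1)%N -> w' j \notin P) -> x \in P -> adj G (w k1) (w' l1) ->
  exists y z, [/\ next_break x k1.+1 y, next_break z l1.+1 x & adj G (y - 1) (z + 1)].
  move=> k12 l12 wE wE' h1 h2 h3 h4 xP ww; exists (w k1.+1), (w' l1.+1); split.
  - split=> //; first exact: wE.
    by move=> j /andP[j0 jk]; rewrite -wE ?h2 ?j0 //; exact: leqW.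
  - split=> //; first by rewrite wE' // mulNrn subrK.
    move=> j /andP[j0 jl]; have -> : w' l1.+1 + 1 *+ j = w' (l1.+1 - j)%N.
      rewrite !wE' //; last by clear -jl; lia.
      by rewrite -{1}(subnK (ltnW jl)) mulrnDr [_ *+ j]mulNrn -addrA addrNK.
    by apply: h4; clear -j0 jl; lia.
  - have -> : w k1.+1 - 1 = w k1 by rewrite !wE // mulrSr addrA addrK.
    have -> // : w' l1.+1 + 1 = w' l1 by rewrite !wE' // mulrSr addrA subrK.
rewrite u0 in uE uP; rewrite v0 in vE.
case/orP: he => /eqP eE; case/orP: he' => /eqP eE'; subst e e'.
- by case: uv; rewrite uE // vE.
- have [y [z [h1 h2 h3]]] := main k l u v k2 l2 uE vE ukP uiP vlP viP uP auv.
  by exists k, l, y, z; split=> //; left.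
- rewrite adj_sym in auv.
  have [y [z [h1 h2 h3]]] := main l k v u l2 k2 vE uE vlP viP ukP uiP uP auv.
  by exists l, k, y, z; split=> //; right.
- by case: uv; rewrite uE // vE.
Qed.

Lemma breaks_fork x k l y z : (2 < k)%N -> (2 < l)%N ->
  next_break x k.+1 y -> next_break z l.+1 x -> adj G (y - 1) (z + 1) -> fork G x k l.
Proof.
move=> k2 l2 [_ xP yP yE h] [_ zP _ xE h'] yz.
exists (fun j => x + 1 *+ j), (fun j => x + (-1) *+ j); split.
- by apply: strip_ring => //; rewrite -yE.
- apply: (strip_ring m4 tP l2 (unit_stepN1 m) xP).
    by rewrite xE mulNrn addrK.
  move=> j /andP[j0 jl]; have -> : x + (-1) *+ j = z + 1 *+ (l.+1 - j).
    rewrite xE mulNrn -{1}(subnK (ltnW jl)) mulrnDr addrA addrK //.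
  by apply: h'; clear -j0 jl; lia.
- by rewrite !mulr0n addr0.
- move/addrI; rewrite !mulr1n => E; apply: (@small_natr_neq0 _ m4 2%N) => //.
  by rewrite mulr2n {1}E addNr.
- have -> : x + 1 *+ k = y - 1 by rewrite yE mulrSr addrA addrK.
  by have -> // : x + (-1) *+ l = z + 1; rewrite xE mulNrn mulrS addrA addrK.
Qed.

End RingForks.

(** * Isomorphisms between graphs with three zigzags *)

Section ThreeForks.
Variable m : nat.
Local Notation V := 'I_m.+2.
Implicit Types (p q x y z : V).

Lemma three_next c p q : three_wf c p q ->
  [/\ next_break [:: 0; p; q] 0 p p, next_break [:: 0; p; q] p (q - p)%N q
    & next_break [:: 0; p; q] q (m.+2 - q)%N 0].
Proof.
case/and4P=> p4 pq qm _.
have A x k : (x + k < m.+2)%N -> nat_of_ord (x + k%:R) = (x + k)%N.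
  move=> h; have Ek : nat_of_ord (k%:R : V) = k by apply: natr_ord; clear -h; lia.
  have -> : nat_of_ord (x + k%:R) = ((x + nat_of_ord (k%:R : V)) %% m.+2)%N by [].
  by rewrite Ek modn_small.
split; split; rewrite ?inE ?eqxx ?orbT //.
- by clear -p4; lia.
- by apply: ord_inj; rewrite add0r natr_ord.
- by move=> j /andP[j0 jp]; rewrite !inE !ord_eqE A //=; clear -j0 jp pq qm; lia.
- by clear -pq; lia.
- by apply: ord_inj; rewrite A //; clear -pq qm; lia.
- by move=> j /andP[j0 jp]; rewrite !inE !ord_eqE A //=; clear -j0 jp p4 pq qm; lia.
- by clear -qm; lia.
- apply: ord_inj; have -> : nat_of_ord (q + 1 *+ (m.+2 - q)) = ((q + nat_of_ord ((m.+2 - q)%:R : V)) %% m.+2)%N by [].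
  rewrite natr_ord; last by clear -p4 pq qm; lia.
  by rewrite subnKC ?modnn //; clear -qm; lia.
- by move=> j /andP[j0 jp]; rewrite !inE !ord_eqE A //=; clear -j0 jp p4 pq qm; lia.
Qed.

Definition same_pair (k l a b : nat) := (k = a /\ l = b) \/ (k = b /\ l = a).

(** The vertices at which a fork occurs, with the lengths of its two strips. *)
Definition gaps (c : bool) p q x k l : Prop :=
  [\/ x = 0 /\ same_pair k l p.-1 (m.+1 - q), c /\ (x = p /\ same_pair k l (q - p).-1 p.-1)
    | c /\ (x = q /\ same_pair k l (m.+1 - q) (q - p).-1)].

(** At a break, the last but one vertices of the two adjacent zigzags are
    [p-1] and [q+1], [q-1] and 1, or [-1] and [p+1].  The first pair is always
    joined by a chord, the other two only when [c] is set. *)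
Lemma three_fork_gaps c p q x k l : three_wf c p q ->
  fork (three_zigzags c p q) x k l -> gaps c p q x k l.
Proof.
move=> wf; have m4 := three_size wf; have tP := three_triangles wf.
have [n0 np nq] := three_next wf; have /and4P[p4 pq qm cc] := wf.
have Ep : nat_of_ord (p + 1) = p.+1 by apply: ord_addS_val => //; clear -pq qm; lia.
have Fm : nat_of_ord (q - 1) = q.-1 by apply: ord_subS_val => //; clear -p4 pq; lia.
case/(fork_breaks m4 tP) => k' [l' [y [z [kl [k2 l2] h1 h2 yz]]]].
have : x \in [:: 0; p; q] by case: h1.
rewrite !inE => /or3P[] /eqP xE; subst x.
- have [E1 yE] := next_break_uniq h1 n0; have [E2 zE] := prev_break_uniq h2 nq.
  constructor 1; split=> //; rewrite /same_pair.
  by clear -E1 E2 kl qm; lia.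
- have [E1 yE] := next_break_uniq h1 np; have [E2 zE] := prev_break_uniq h2 n0.
  case: c cc wf yz {tP} => cc wf yz.
    by constructor 2; split=> //; split=> //; rewrite /same_pair; clear -E1 E2 kl; lia.
  exfalso; move: yz; rewrite yE zE add0r adj_sym => yz.
  have lt : (nat_of_ord (1%R : V) < nat_of_ord (q - 1)%R)%N by rewrite ord_1 Fm; clear -p4 pq; lia.
  have := three_edge_nat wf lt yz; rewrite /three_edge ord_1 Fm.
  by clear -p4 pq qm E1 E2 k2 l2; lia.
- have [E1 yE] := next_break_uniq h1 nq; have [E2 zE] := prev_break_uniq h2 np.
  case: c cc wf yz {tP} => cc wf yz.
    constructor 3; split=> //; split=> //; rewrite /same_pair.
    by clear -E1 E2 kl qm; lia.
  exfalso; move: yz; rewrite yE zE add0r adj_sym => yz.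
  have lt : (nat_of_ord (p + 1)%R < nat_of_ord (-1 : V)%R)%N by rewrite ord_N1 Ep; clear -pq qm; lia.
  have := three_edge_nat wf lt yz; rewrite /three_edge ord_N1 Ep.
  by clear -p4 pq qm E1 E2 k2 l2; lia.
Qed.

Lemma three_fork0 c p q : three_wf c p q -> fork (three_zigzags c p q) 0 p.-1 (m.+1 - q).
Proof.
move=> wf; have m4 := three_size wf; have tP := three_triangles wf.
have [n0 np nq] := three_next wf; have /and4P[p4 pq qm cc] := wf.
apply: (breaks_fork m4 tP (y := p) (z := q)).
- by clear -p4; lia.
- by clear -qm; lia.
- by rewrite prednK //; clear -p4; lia.
- by rewrite -subSn //; clear -qm; lia.
- by apply: ring_adjM; rewrite ?(three_chord_neq wf) // inE eqxx.
Qed.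

(** With [three_fork0], forks occur at two different vertices when [c] is set. *)
Lemma three_fork_true p q : three_wf true p q -> fork (three_zigzags true p q) p (q - p).-1 p.-1.
Proof.
move=> wf; have m4 := three_size wf; have tP := three_triangles wf.
have [n0 np nq] := three_next wf; have /and4P[p4 pq qm /= cc] := wf.
apply: (breaks_fork m4 tP (y := q) (z := 0)).
- by clear -cc; lia.
- by clear -p4; lia.
- by rewrite prednK //; clear -pq; lia.
- by rewrite prednK //; clear -p4; lia.
- rewrite add0r adj_sym; apply: ring_adjM; rewrite ?(three_chord_neq wf) //;
  by rewrite !inE eqxx ?orbT.
Qed.

(** One representative for each isomorphism class: with [c] set, the three
    lengths increase; otherwise the lengths of the two zigzags that end at 0
    do. *)
Definition sorted_gaps (c : bool) p q :=
  if c then (p + p <= q)%N && (q - p <= m.+2 - q)%N else (p + q <= m.+2)%N.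

(** The number of vertices at which forks occur determines [c].  One fork then
    determines two of the lengths, and the number of vertices the third one. *)
Lemma three_iso_eq c p q c' p' q' : three_wf c p q -> three_wf c' p' q' ->
  sorted_gaps c p q -> sorted_gaps c' p' q' ->
  isomorphic (three_zigzags c p q) (three_zigzags c' p' q') -> [/\ c = c', p = p' & q = q'].
Proof.
move=> wf wf' can can' [f bf fP].
have fk x k l : fork (three_zigzags c p q) x k l -> gaps c' p' q' (f x) k l.
  by move/(fork_iso bf fP); apply: three_fork_gaps.
have [g fK gK] := bf.
have gP x y : adj (three_zigzags c p q) (g x) (g y) = adj (three_zigzags c' p' q') x y by rewrite -fP !gK.
have bg : bijective g by exists f.
have gk x k l : fork (three_zigzags c' p' q') x k l -> gaps c p q (g x) k l.
  by move/(fork_iso bg gP); apply: three_fork_gaps.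
have cc : c = c'.
  case: c wf can fk gk {fP gP} => wf can fk gk; case: c' wf' can' fk gk => wf' can' fk gk //; exfalso.
    have p0 : p <> 0 by move=> E; case/and4P: wf => + _ _ _; rewrite E.
    case: (fk _ _ _ (three_fork0 wf)) => [[E1 _]|[]|[]] //.
    case: (fk _ _ _ (three_fork_true wf)) => [[E2 _]|[]|[]] //.
    by apply: p0; apply: (bij_inj bf); rewrite E1 E2.
  have p0 : p' <> 0 by move=> E; case/and4P: wf' => + _ _ _; rewrite E.
  case: (gk _ _ _ (three_fork0 wf')) => [[E1 _]|[]|[]] //.
  case: (gk _ _ _ (three_fork_true wf')) => [[E2 _]|[]|[]] //.
  by apply: p0; apply: (bij_inj bg); rewrite E1 E2.
subst c'.
have G0 := fk _ _ _ (three_fork0 wf).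
have /and4P[p4 pq qm c3] := wf; have /and4P[p4' pq' qm' c3'] := wf'.
suff [E1 E2] : nat_of_ord p = nat_of_ord p' /\ nat_of_ord q = nat_of_ord q'.
  by split=> //; apply: ord_inj.
move: G0 => [[_]|[hc [_]]|[hc [_]]]; rewrite /same_pair => hp; move: can can' c3 c3'; rewrite /sorted_gaps.
- by case: c {wf wf' fP fk gP gk} => /=; clear -p4 pq qm p4' pq' qm' hp; lia.
- by rewrite hc /=; clear -p4 pq qm p4' pq' qm' hp; lia.
- by rewrite hc /=; clear -p4 pq qm p4' pq' qm' hp; lia.
Qed.

Lemma three_affine c p q e r p' q' : three_wf c p q -> three_wf c p' q' ->
  regular 4 (three_zigzags c p q) -> unit_step e ->
  (forall y, y \in [:: 0; p'; q'] -> e * (y - r) \in [:: 0; p; q]) ->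
  (forall x y, (x, y) \in ((p - 1, q + 1) :: if c then [:: (1, q - 1); (p + 1, -1)] else [:: (1, p + 1); (q - 1, -1)]) ->
    adj (three_zigzags c p' q') (e * x + r) (e * y + r)) ->
  isomorphic (three_zigzags c p q) (three_zigzags c p' q').
Proof.
move=> wf wf' rG he hP hM; have m4 := three_size wf.
exists (fun x => e * x + r); first exact: affine_bij.
apply: (affine_adj m4 he rG (three_uniq wf')) => //; first by case: (c).
exact: break_affine.
Qed.

Lemma nat_oppE p : (0 < p)%N -> nat_of_ord (- p) = (m.+2 - p)%N.
Proof. by move=> p0; apply: ord_opp; rewrite ord_eqE -lt0n. Qed.

Lemma nat_subE p q : (p < q)%N -> nat_of_ord (q - p) = (q - p)%N.
Proof.
move=> pq; have -> : q - p = (q - p)%:R.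
  by rewrite natrB ?(ltnW pq) // !Zp_nat !valZpK.
by rewrite natr_ord //; have := ltn_ord q; clear; lia.
Qed.

Lemma three_reflect c p q : three_wf c p q -> regular 4 (three_zigzags c p q) ->
  three_wf c (- q) (- p) /\ isomorphic (three_zigzags c p q) (three_zigzags c (- q) (- p)).
Proof.
move=> wf rG; have /and4P[p4 pq qm cc] := wf.
have wf' : three_wf c (- q) (- p).
  rewrite /three_wf !nat_oppE; [|by clear -p4; lia|by clear -pq; lia].
  by move: cc; case: (c) => /=; clear -p4 pq qm; lia.
split=> //; apply: (three_affine wf wf' rG (unit_stepN1 m) (r := 0)).
  move=> y; rewrite subr0 mulN1r !inE => /or3P[]/eqP->; rewrite ?oppr0 ?opprK ?eqxx ?orbT //.
move=> x y xyM; have xy := three_chord_neq wf xyM; rewrite !addr0 !mulN1r.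
have xy' : - x != - y by rewrite (inj_eq oppr_inj).
rewrite adj_sym; apply: ring_adjM; first by rewrite eq_sym.
by move: xyM; case: (c); rewrite !inE => /or3P[]/eqP[-> ->]; rewrite ?opprD ?opprK ?eqxx ?orbT.
Qed.

(** The rotation that takes [p] to 0. *)
Lemma three_rotate p q : three_wf true p q -> regular 4 (three_zigzags true p q) ->
  three_wf true (q - p) (- p) /\ isomorphic (three_zigzags true p q) (three_zigzags true (q - p) (- p)).
Proof.
move=> wf rG; have /and4P[p4 pq qm /= cc] := wf.
have wf' : three_wf true (q - p) (- p).
  rewrite /three_wf nat_oppE ?nat_subE //; [|by clear -p4; lia].
  by clear -p4 pq qm cc; lia.
split=> //; apply: (three_affine wf wf' rG (unit_step1 m) (r := - p)).
  move=> y; rewrite opprK mul1r !inE => /or3P[]/eqP->; rewrite ?add0r ?subrK ?addNr ?eqxx ?orbT //.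
move=> x y xyM; have xy := three_chord_neq wf xyM; rewrite !mul1r.
have xy' : x - p != y - p by rewrite (inj_eq (addIr _)).
have E1 : p - 1 - p = -1 by ring. have E2 : q + 1 - p = q - p + 1 by ring.
have E3 : 1 - p = - p + 1 by ring. have E4 : q - 1 - p = q - p - 1 by ring.
have E5 : p + 1 - p = 1 by ring. have E6 : -1 - p = - p - 1 by ring.
move: xyM; rewrite !inE => /or3P[]/eqP[xE yE]; rewrite xE yE ?E1 ?E2 ?E3 ?E4 ?E5 ?E6 in xy' *.
- by rewrite adj_sym; apply: ring_adjM; rewrite 1?eq_sym // !inE eqxx !orbT.
- by rewrite adj_sym; apply: ring_adjM; rewrite 1?eq_sym // !inE eqxx.
- by apply: ring_adjM; rewrite // !inE eqxx !orbT.
Qed.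

(** Reflections exchange the two zigzags that end at 0; when [c] is set,
    rotations permute the three zigzags cyclically. *)
Lemma three_sorted c p q : three_wf c p q -> regular 4 (three_zigzags c p q) ->
  exists p' q', [/\ three_wf c p' q', sorted_gaps c p' q' & isomorphic (three_zigzags c p q) (three_zigzags c p' q')].
Proof.
have refl := @three_reflect; have rot := @three_rotate.
case: c => wf rG; last first.
  have [can|ncan] := boolP (sorted_gaps false p q).
    by exists p, q; split=> //; exact: isomorphic_refl.
  have [wf' i] := three_reflect wf rG; exists (- q), (- p); split=> //.
  have /and4P[p4 pq qm _] := wf; move: ncan; rewrite /sorted_gaps.
  by rewrite !nat_oppE; clear -p4 pq qm; lia.
pose ok (p q : V) := exists p' q' : V,
  [/\ three_wf true p' q', sorted_gaps true p' q' & isomorphic (three_zigzags true p q) (three_zigzags true p' q')].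
have can_ok p1 q1 : three_wf true p1 q1 -> sorted_gaps true p1 q1 -> ok p1 q1.
  by move=> wf1 can; exists p1, q1; split=> //; exact: isomorphic_refl.
have ok_iso p1 q1 p2 q2 : isomorphic (three_zigzags true p1 q1) (three_zigzags true p2 q2) -> ok p2 q2 -> ok p1 q1.
  by move=> i [p' [q' [h1 h2 h3]]]; exists p', q'; split=> //; apply: isomorphic_trans i h3.
(* Cyclically sorted lengths; this holds for the graph or for its mirror image. *)
have cyc p1 q1 : three_wf true p1 q1 -> regular 4 (three_zigzags true p1 q1) ->
    [|| sorted_gaps true p1 q1, (q1 - p1 <= m.+2 - q1)%N && (m.+2 - q1 <= p1)%N
      | (m.+2 - q1 <= p1)%N && (p1 <= q1 - p1)%N] -> ok p1 q1.
  move=> wf1 rG1 /or3P[can|h|h]; first exact: can_ok.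
  - have [wf2 i2] := three_rotate wf1 rG1; apply: (ok_iso _ _ _ _ i2); apply: can_ok => //.
    have /and4P[p4 pq qm _] := wf1; move: h; rewrite /sorted_gaps nat_oppE ?nat_subE //; [|by clear -p4; lia].
    by clear -p4 pq qm; lia.
  - have [wf2 i2] := three_rotate wf1 rG1; have rG2 := regular_iso i2 rG1.
    have [wf3 i3] := three_rotate wf2 rG2; apply: (ok_iso _ _ _ _ i2); apply: (ok_iso _ _ _ _ i3); apply: can_ok => //.
    have /and4P[p4 pq qm _] := wf1; have /and4P[p4' pq' qm' _] := wf2.
    have A2 := nat_subE pq; have B2 : nat_of_ord (- p1) = (m.+2 - p1)%N.
      by apply: nat_oppE; clear -p4; lia.
    have A3 := nat_subE pq'; have B3 : nat_of_ord (- (q1 - p1)) = (m.+2 - (q1 - p1)%R)%N.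
      by apply: nat_oppE; clear -p4'; lia.
    by move: h; rewrite /sorted_gaps A3 B3 A2 B2; clear -p4 pq qm; lia.
have /and4P[p4 pq qm _] := wf.
have [h|h] := boolP [|| sorted_gaps true p q, (q - p <= m.+2 - q)%N && (m.+2 - q <= p)%N
      | (m.+2 - q <= p)%N && (p <= q - p)%N]; first exact: cyc.
have [wf' i] := three_reflect wf rG; apply: (ok_iso _ _ _ _ i); apply: (cyc _ _ wf' (regular_iso i rG)).
move: h; rewrite /sorted_gaps !nat_oppE; [|by clear -p4; lia|by clear -pq; lia].
by clear -p4 pq qm; lia.
Qed.

End ThreeForks.

(** * The number of isomorphism classes *)

Definition level3_set n : {set sgraph 'I_n} :=
  [set G : sgraph 'I_n | `[< K5_descendant G >] && (level G == 3)].

Definition shapes m : {set bool * ('I_m.+2 * 'I_m.+2)} :=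
  [set t | three_wf t.1 t.2.1 t.2.2 && sorted_gaps t.1 t.2.1 t.2.2].

Lemma level3_shape n (G : sgraph 'I_n) : G \in level3_set n ->
  exists m (e : n = m.+2), exists2 t : bool * ('I_m.+2 * 'I_m.+2), t \in shapes m &
    isomorphic G (three_zigzags t.1 t.2.1 t.2.2).
Proof.
rewrite inE => /andP[/asboolP dG /eqP lG].
have [m [c [p [q [wf h]]]]] := level3_classification dG lG.
have e : n = m.+2 by have := isomorphic_card h; rewrite !card_ord.
have [p' [q' [wf' can i]]] := three_sorted wf (regular_iso h (K5_descendant_regular dG)).
exists m, e, (c, (p', q')); first by rewrite inE wf'.
exact: isomorphic_trans h i.
Qed.

Lemma num_level3_small n : (n < 2)%N -> num_K5_descendants 3 n = 0%N.
Proof.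
move=> n2; rewrite /num_K5_descendants /num_iso_classes -/(level3_set n).
suff -> : level3_set n = set0 by rewrite /equivalence_partition imset0 cards0.
apply/setP=> G; rewrite [RHS]inE; apply/negP => /level3_shape[m [e _]].
by move: n2; rewrite e.
Qed.

(** The isomorphism classes are those of the graphs with parameters in [shapes
    m], and these are pairwise not isomorphic. *)
Lemma num_level3 m : num_K5_descendants 3 m.+2 = #|shapes m|.
Proof.
rewrite /num_K5_descendants /num_iso_classes -/(level3_set m.+2).
pose R (G H : sgraph 'I_m.+2) := `[< isomorphic G H >].
pose F (t : bool * ('I_m.+2 * 'I_m.+2)) := three_zigzags t.1 t.2.1 t.2.2.
pose cl t := [set H in level3_set m.+2 | R (F t) H].
have FD t : t \in shapes m -> F t \in level3_set m.+2.
  rewrite !inE => /andP[wf _]; rewrite (level_three wf) eqxx andbT.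
  by apply/asboolP/three_descendant.
have -> : equivalence_partition R (level3_set m.+2) = cl @: shapes m.
  apply/setP=> B; apply/imsetP/imsetP => [[G GD ->]|[t tS ->]]; last by exists (F t); rewrite ?FD.
  have [m' [e [t tS i]]] := level3_shape GD.
  case: e => e; subst m'; exists t => //.
  apply/setP=> H; rewrite !inE; congr (_ && _); apply/asboolP/asboolP => h.
    exact: isomorphic_trans (isomorphic_sym i) h.
  exact: isomorphic_trans i h.
rewrite card_in_imset // => t t' tS t'S /setP/(_ (F t')).
rewrite [in LHS]inE [in RHS]inE FD //= => E.
have /asboolP iso : R (F t) (F t') by rewrite E; apply/asboolP/isomorphic_refl.
move: tS t'S; rewrite !inE => /andP[wf can] /andP[wf' can'].
have [] := three_iso_eq wf wf' can can' iso.
by case: (t) (t') => [a [b c]] [a' [b' c']] /= -> -> ->.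
Qed.

Lemma sum_interval n lo hi :
  (\sum_(q < n) ((lo <= q < hi) : nat))%N = (minn n hi - lo)%N.
Proof.
elim: n => [|n IH]; first by rewrite big_ord0; clear; lia.
by rewrite big_ord_recr /= IH; clear; lia.
Qed.

(** The parameters with [c = false]: for a given [p], the other break ranges
    over [p < q <= n - p]. *)
Definition count_false n := (\sum_(p < n | 4 <= p) (n - p.*2))%N.
(** The parameters with [c = true]: for a given [p], the other break ranges
    over [2p <= q <= (n+p)/2]. *)
Definition count_true n := (\sum_(p < n | (4 <= p) && (3 * p <= n)) ((n - 3 * p) %/ 2).+1)%N.

Lemma card_shapes m : #|shapes m| = (count_false m.+2 + count_true m.+2)%N.
Proof.
rewrite -sum1_card big_mkcond /=.
pose b c (p q : 'I_m.+2) : nat := three_wf c p q && sorted_gaps c p q.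
rewrite (eq_bigr (fun t : bool * ('I_m.+2 * 'I_m.+2) => b t.1 t.2.1 t.2.2)); last first.
  by move=> [c [p q]] _; rewrite inE /b /=; case: (_ && _).
rewrite -(pair_bigA _ (fun c (t : 'I_m.+2 * 'I_m.+2) => b c t.1 t.2)) big_bool /= addnC.
rewrite -!(pair_bigA _ (fun p q => b _ p q)) /= /count_false /count_true [in RHS]big_mkcond.
congr (_ + _)%N; first apply: eq_bigr => p _.
  case: ifP => p4; last first.
    by rewrite big1 // => q _; rewrite /b /three_wf p4.
  rewrite (eq_bigr (fun q : 'I_m.+2 => ((p.+1 <= q < (m.+2 - p).+1) : nat))%N).
    by rewrite sum_interval; have := ltn_ord p; clear -p4; lia.
  move=> q _; rewrite /b /three_wf /sorted_gaps p4 andbT /=; have := ltn_ord p; have := ltn_ord q; clear -p4.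
  by move: (nat_of_ord p) (nat_of_ord q) p4 => x y; lia.
rewrite [in RHS]big_mkcond; apply: eq_bigr => p _.
case: ifP => [/andP[p4 p3]|p43]; last first.
  rewrite big1 // => q _; rewrite /b /three_wf /sorted_gaps; move/negbT: p43.
  move: (nat_of_ord p) (nat_of_ord q) => x y; clear; lia.
rewrite (eq_bigr (fun q : 'I_m.+2 => ((p.*2 <= q < ((m.+2 + p) %/ 2).+1) : nat))%N).
  by rewrite sum_interval; have := ltn_ord p; clear -p4 p3; lia.
move=> q _; rewrite /b /three_wf /sorted_gaps p4 /=; have := ltn_ord p; have := ltn_ord q.
by move: (nat_of_ord p) (nat_of_ord q) p4 p3 => x y; clear; lia.
Qed.

Lemma count_falseS n : count_false n.+1 = (count_false n + (n %/ 2 - 3))%N.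
Proof.
rewrite /count_false !big_mkcond big_ord_recr /=.
rewrite [X in (_ + X)%N](_ : _ = 0)%N ?addn0; last by case: ifP => //; clear; lia.
have -> : (n %/ 2 - 3 = \sum_(p < n) ((4 <= p < (n %/ 2).+1) : nat))%N.
  by rewrite sum_interval; clear; lia.
rewrite [X in _ = (X + _)%N]big_mkcond -big_split /=; apply: eq_bigr => p _.
by have := ltn_ord p; case: ifP; clear; lia.
Qed.

Lemma count_true_widen n N : (n <= N)%N ->
  count_true n = (\sum_(p < N | (4 <= p) && (3 * p <= n)) ((n - 3 * p) %/ 2).+1)%N.
Proof.
elim: N => [|N IH]; first by rewrite leqn0 => /eqP->.
rewrite leq_eqVlt => /predU1P[->//|]; rewrite ltnS => nN; rewrite (IH nN).
rewrite [in RHS]big_mkcond big_ord_recr /= -big_mkcond.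
by case: ifP; rewrite ?addn0 //; clear -nN; lia.
Qed.

(** Shortening each of the three zigzags by one triangle leaves only the case
    where the shortest one has length 3. *)
Lemma count_trueS n : (count_true n.+3 = count_true n + (if 9 <= n then ((n - 9) %/ 2).+1 else 0))%N.
Proof.
rewrite (@count_true_widen n n.+4) ?(@count_true_widen n.+3 n.+4.+1); [|by clear; lia|by clear; lia].
rewrite big_mkcond big_ord_recl /= add0n [in RHS]big_mkcond /=.
have -> : (if 9 <= n then ((n - 9) %/ 2).+1 else 0)%N =
    (\sum_(p < n.+4) (if (p == 3 :> nat) && (9 <= n) then ((n - 9) %/ 2).+1 else 0))%N.
  rewrite (bigD1 (inord 3)) //= big1 ?addn0 ?inordK //= => i.
  by rewrite -val_eqE /= inordK // => /negbTE->.
rewrite -big_split /=; apply: eq_bigr => p _; rewrite /bump /= add1n.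
by do 3!case: ifP; clear; lia.
Qed.

(** * The generating function *)

Section Fps.
Variable F : fieldType.

(** The equation [h * g = f] determines the coefficients of [h] one after the
    other. *)
Lemma fps_div_unique (f g h : nat -> F) : g 0%N != 0 -> fps_mul h g =1 f -> h =1 fps_div f g.
Proof.
move=> g0 hg n; elim/ltn_ind: n => n IH.
have := hg n; rewrite -(fps_divK f g0 n) /fps_mul !big_ord_recr /= subnn.
rewrite (eq_bigr (fun i : 'I_n => fps_div f g i * g (n - i)%N)).
  by move/addrI/(mulIf g0).
by move=> i _; rewrite IH.
Qed.

End Fps.

Lemma denominator_poly : (1 - 'X) ^+ 3 * (1 + 'X + 'X^2) =
  Poly [:: 1; -2%:R; 1; -1; 2%:R; -1] :> {poly rat}.
Proof. rewrite /= !cons_poly_def; ring. Qed.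

Lemma fps_mul_denominator (a : nat -> rat) n :
  fps_mul a (fps_of_poly ((1 - 'X) ^+ 3 * (1 + 'X + 'X^2))) n.+4.+1 =
  a n.+4.+1 - 2%:R * a n.+4 + a n.+3 - a n.+2 + 2%:R * a n.+1 - a n.
Proof.
rewrite /fps_mul /fps_of_poly denominator_poly (reindex_inj rev_ord_inj).
pose L : seq rat := [:: 1; -2%:R; 1; -1; 2%:R; -1].
rewrite (eq_bigr (fun j : 'I_n.+2.+4 => a (n.+4.+1 - j)%N * L`_j)); last first.
  move=> j _; rewrite coef_Poly (_ : nat_of_ord (rev_ord j) = n.+4.+1 - j)%N //.
  by rewrite subKn // -ltnS.
rewrite -(big_mkord xpredT (fun j => a (n.+4.+1 - j)%N * L`_j)).
do 6!rewrite big_ltn //; rewrite big_nat big1 => [|j /andP[j6 _]]; last first.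
  by rewrite nth_default ?mulr0.
by rewrite !subSS !subn0 /L /=; ring.
Qed.

Lemma numerator_coef n :
  fps_of_poly ('X^9 * (1 + 'X^2) : {poly rat}) n = ((n == 9) || (n == 11))%:R.
Proof.
rewrite /fps_of_poly mulrDr mulr1 -exprD coefD !coefXn.
by case: (n =P 9%N) => [->|_]; rewrite ?addr0 ?add0r.
Qed.

Definition count n : nat := (count_false n + count_true n)%N.

Lemma count_small n : (n < 9)%N -> count n = 0%N.
Proof.
move=> n9; rewrite /count /count_false /count_true !big1 // => p.
  by move=> /andP[p4 p3]; move: n9 p4 p3; clear; lia.
by move: n9; have := ltn_ord p; clear; lia.
Qed.

(** The contributions of [count_false] and [count_true] to the recurrence are
    alternating sequences of opposite signs, except at the start, where the
    numerator comes from. *)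
Lemma count_rec n :
  (count n.+4.+1 + count n.+3 + 2 * count n.+1 =
   2 * count n.+4 + count n.+2 + count n + ((n == 4) || (n == 6)))%N.
Proof.
rewrite /count (count_trueS n.+2) (count_trueS n.+1) (count_trueS n) !count_falseS.
move: (count_false n) (count_true n) (count_true n.+1) (count_true n.+2) => d c c1 c2.
by do 3!case: ifP; clear; lia.
Qed.

Theorem proposition3p6 :
  (fun n : nat => (num_K5_descendants 3 n)%:R : rat) =1
  fps_div (fps_of_poly ('X^9 * (1 + 'X^2)))
          (fps_of_poly ((1 - 'X) ^+ 3 * (1 + 'X + 'X^2))).
Proof.
have E n : num_K5_descendants 3 n = count n.
  case: n => [|[|m]]; [by rewrite num_level3_small // count_small..|].
  by rewrite num_level3 card_shapes.
apply: fps_div_unique.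
  by rewrite /fps_of_poly denominator_poly coef_Poly oner_neq0.
move=> n; have [n5|n5] := ltnP n 5.
  rewrite numerator_coef /fps_mul big1 => [|i _].
    by move: n5; case: n => [|[|[|[|[|]]]]].
  by rewrite E count_small ?mul0r //; have := ltn_ord i; clear -n5; lia.
rewrite -(subnK n5) addnC; move: (n - 5)%N => {n n5}n.
rewrite !addSn add0n (fps_mul_denominator (fun k => (num_K5_descendants 3 k)%:R)) !E numerator_coef.
have -> : ((n.+4.+1 == 9) || (n.+4.+1 == 11))%N = ((n == 4) || (n == 6))%N by [].
have := count_rec n; move: (nat_of_bool _) => e.
move: (count n) (count n.+1) (count n.+2) (count n.+3) (count n.+4) (count n.+4.+1) => a0 a1 a2 a3 a4 a5.
move=> /(congr1 (fun k => k%:R : rat)); rewrite !(natrD, natrM) => h.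
apply/eqP; rewrite -subr_eq0; apply/eqP.
transitivity (a5%:R + a3%:R + 2%:R * a1%:R - (2%:R * a4%:R + a2%:R + a0%:R + e%:R) : rat).
  by ring.
by rewrite h subrr.
Qed.
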